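(* Let $(X,T)$ be a KTQ and let $D$ be a KTQ-colored (by $(X,T)$) oriented knotted surface diagram in $\mathbb{R}^3$. Then its associated chain $c_D$, viewed in $C_2^N(X,T)$, is a cycle with respect to the differential $\partial_2\colon C_2^N(X,T)\to C_1^N(X,T)$.
   Context: A ternary quasigroup is a set $X$ with $T\colon X^3\to X$ such that in $T(x_1,x_2,x_3)=x_4$ any three of the elements determine the remaining one uniquely. A knot-theoretic ternary quasigroup (KTQ) is a ternary quasigroup satisfying, for all $a,b,c,d\in X$: (A1) $T(T(a,b,c),c,d)=T\big(T(a,b,T(b,c,d)),\,T(b,c,d),\,d\big)$; (A2) $T(a,b,T(b,c,d))=T\big(a,\,T(a,b,c),\,T(T(a,b,c),c,d)\big)$. $C_n(X)$ is the free $\mathrm{R}$-module ($\mathrm{R}$ a commutative unital ring) on $X^{n+2}$. For $n\ge 1$, $C_n^D(X,T)$ is its submodule generated by tuples $(x_0,\ldots,x_{n+1})$ with $x_{j+1}=T(x_j,x_{j+1},x_{j+2})$ for some $0\le j\le n-1$; $C_n^N(X,T)=C_n(X)/C_n^D(X,T)$. Writing $abcT=T(a,b,c)$, the differential $\partial_2$ is induced by $\partial_2(a,b,c,d)=(b,c,d)-(a,abcT,(abcT)cdT)-(abcT,c,d)+(a,b,bcdT)+(ab(bcdT)T,bcdT,d)-(a,b,c)$. A knotted surface diagram $D$ is the generic projection $p(S)\subset\mathbb{R}^3$ of a closed surface $S$ smoothly embedded in $\mathbb{R}^4$, with under-over information at double points. The closure of its double point set is a graph with vertices of degree $1$ (branch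 points) or $6$ (triple points), possibly with loops without vertices; edges and such loops are called double point edges. For oriented $S$, $p(S)$ is co-oriented off branch points by a normal $v$ such that $(v,v_1,v_2)$ matches the orientation of $\mathbb{R}^3$ whenever the tangent frame $(v_1,v_2)$ matches the orientation of $S$. Regions are the components of $\mathbb{R}^3-p(S)$. For a double point edge, the ascending path is $(r_1,r_2,r_3)$: $r_1$ is the source region (all co-orientation arrows at the edge point out of it), $r_1,r_2$ are separated by the under-sheet, $r_3$ is the target region (all arrows point into it); $r_4$ is the remaining region near the edge. A KTQ-coloring is a function $c$ from regions to $X$ with $c(r_4)=T(c(r_1),c(r_2),c(r_3))$ for each double point edge. At a triple point let $v_T,v_M,v_B$ be the co-orientation normals to the top, middle and bottom sheets. The triple point is positive if $(v_T,v_M,v_B)$ matches the right-hand orientation of $\mathbb{R}^3$, negative otherwise. Its ascending path is the sequence of regions $(r_0,r_1,r_2,r_3)$ near it, starting at the source region (all three normals point away from it), ending at the target region (all three normals point towards it), with $r_0,r_1$ separated by the bottom sheet, $r_1,r_2$ by the middle sheet, $r_2,r_3$ by the top sheet; its colored path is $(c(r_0),c(r_1),c(r_2),c(r_3))$. The associated chain $c_D$ is the sum of colored paths over all triple points, each taken with the sign of the triple point. *)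

(* Defs.v *)
From HB Require Import structures.
From mathcomp Require Import all_boot all_order all_algebra finmap.
From mathcomp Require Import all_classical all_reals all_analysis.
From mathcomp Require Import generic_quotient ring_quotient.
From mathcomp Require monalg.
(* The notations of [monalg] are incompatible with those of [analysis]. *)
Import -(notations) monalg.

Set Implicit Arguments.
Unset Strict Implicit.
Unset Printing Implicit Defensive.

Import Order.TTheory GRing.Theory Num.Theory numFieldNormedType.Exports.

Local Open Scope classical_set_scope.
Local Open Scope ring_scope.

Definition ternary_quasigroup (X : Type) (T : X -> X -> X -> X) : Prop :=
  [/\ forall x2 x3 x4, exists! x1, T x1 x2 x3 = x4,
      forall x1 x3 x4, exists! x2, T x1 x2 x3 = x4
    & forall x1 x2 x4, exists! x3, T x1 x2 x3 = x4].

Definition KTQ (X : Type) (T : X -> X -> X -> X) : Prop :=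
  [/\ ternary_quasigroup T,
      forall a b c d,
        T (T a b c) c d = T (T a b (T b c d)) (T b c d) d
    & forall a b c d,
        T a b (T b c d) = T a (T a b c) (T (T a b c) c d)].

(* [malg K k] is the type of finitely supported functions [K -> k], with basis
   the elements [mkmalgU x 1]. *)
Definition chain (k : comNzRingType) (X : choiceType) (n : nat) :=
  malg (n.+2.-tuple X) k.

HB.instance Definition _ (k : comNzRingType) (X : choiceType) (n : nat) :=
  GRing.Lmodule.on (@chain k X n).

Definition basis_chain (k : comNzRingType) (X : choiceType) (n : nat)
  (x : n.+2.-tuple X) : chain k X n := mkmalgU x 1.

Definition linear_extension (k : comNzRingType) (X : choiceType) (n : nat)
    (V : lmodType k) (f : n.+2.-tuple X -> V) (z : chain k X n) : V :=
  \sum_(x <- msupp z) mcoeff x z *: f x.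

Definition generated_submodule (k : comNzRingType) (V : lmodType k)
    (A : set V) : set V :=
  [set v | exists2 s : seq (k * V),
    forall p, p \in s -> A p.2 & v = \sum_(p <- s) p.1 *: p.2].

Definition degenerate_tuple (X : choiceType) (T : X -> X -> X -> X) (n : nat)
    (x : n.+2.-tuple X) : Prop :=
  exists j : 'I_n,
    tnth x (inord j.+1) =
    T (tnth x (inord j)) (tnth x (inord j.+1)) (tnth x (inord j.+2)).

Definition degenerate_chain (k : comNzRingType) (X : choiceType)
    (T : X -> X -> X -> X) (n : nat) : pred (chain k X n) :=
  fun z => `[< generated_submodule
                 [set basis_chain k x | x in degenerate_tuple T (n := n)] z >].

Lemma generated_submodule_closed (k : comNzRingType) (V : lmodType k)
    (A : set V) :
  generated_submodule A 0 /\
  forall a u v, generated_submodule A u -> generated_submodule A v ->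
    generated_submodule A (a *: u + v).
Proof.
split; first by exists [::] => //; rewrite big_nil.
move=> a u v [s sA ->] [t tA ->].
exists ([seq (a * p.1, p.2) | p <- s] ++ t).
  by move=> p; rewrite mem_cat => /orP[/mapP[q qs ->]|/tA//]; exact: (sA q qs).
rewrite big_cat big_map scaler_sumr; congr (_ + _).
by apply: eq_bigr => p _; rewrite scalerA.
Qed.

Lemma degenerate_chain_closed k X T n :
  submod_closed (@degenerate_chain k X T n).
Proof.
have [h0 h] := generated_submodule_closed
  [set @basis_chain k X n x | x in degenerate_tuple T (n := n)].
split=> [|a u v /asboolP hu /asboolP hv]; apply/asboolP => //.
exact: h.
Qed.

HB.instance Definition _ (k : comNzRingType) (X : choiceType)
    (T : X -> X -> X -> X) (n : nat) :=
  GRing.isZmodClosed.Build (chain k X n) (@degenerate_chain k X T n)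
    (GRing.submod_closedB (@degenerate_chain_closed k X T n)).

Definition normal_chain (k : comNzRingType) (X : choiceType)
    (T : X -> X -> X -> X) (n : nat) :=
  Quotient.quot
    (GRing.ZmodClosed.clone (chain k X n) (@degenerate_chain k X T n) _).

HB.instance Definition _ (k : comNzRingType) (X : choiceType)
  (T : X -> X -> X -> X) (n : nat) := Choice.on (@normal_chain k X T n).
HB.instance Definition _ (k : comNzRingType) (X : choiceType)
  (T : X -> X -> X -> X) (n : nat) :=
  EqQuotient.on (@normal_chain k X T n).
HB.instance Definition _ (k : comNzRingType) (X : choiceType)
  (T : X -> X -> X -> X) (n : nat) := GRing.Zmodule.on (@normal_chain k X T n).
HB.instance Definition _ (k : comNzRingType) (X : choiceType)
  (T : X -> X -> X -> X) (n : nat) := ZmodQuotient.on (@normal_chain k X T n).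

Definition to_normal_chain (k : comNzRingType) (X : choiceType)
    (T : X -> X -> X -> X) (n : nat) (z : chain k X n) : normal_chain k T n :=
  (\pi_(normal_chain k T n) z)%qT.

Lemma to_normal_chain_eq (k : comNzRingType) (X : choiceType)
    (T : X -> X -> X -> X) (n : nat) (x y : chain k X n) :
  (to_normal_chain T x = to_normal_chain T y) <-> degenerate_chain T (x - y).
Proof.
rewrite /to_normal_chain; split=> [/eqP|] h.
  by move: h; rewrite -Quotient.idealrBE.
by apply/eqP; rewrite -Quotient.idealrBE.
Qed.

Lemma to_normal_chain_repr (k : comNzRingType) (X : choiceType) (T : X -> X -> X -> X)
    (n : nat) (q : normal_chain k T n) :
  to_normal_chain T (repr q) = q.
Proof. exact: reprK. Qed.

Lemma to_normal_chainB (k : comNzRingType) (X : choiceType)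
  (T : X -> X -> X -> X) (n : nat) : zmod_morphism (@to_normal_chain k X T n).
Proof. by move=> x y; rewrite /to_normal_chain raddfB. Qed.

HB.instance Definition _ (k : comNzRingType) (X : choiceType)
    (T : X -> X -> X -> X) (n : nat) :=
  GRing.isZmodMorphism.Build (chain k X n) (normal_chain k T n)
    (@to_normal_chain k X T n) (@to_normal_chainB k X T n).

Definition normal_scale (k : comNzRingType) (X : choiceType)
    (T : X -> X -> X -> X) (n : nat) (a : k) (q : normal_chain k T n) :
    normal_chain k T n :=
  to_normal_chain T (a *: repr q).

Lemma normal_scale_pi (k : comNzRingType) (X : choiceType)
    (T : X -> X -> X -> X) (n : nat) (a : k) (z : chain k X n) :
  normal_scale a (to_normal_chain T z) = to_normal_chain T (a *: z).
Proof.
apply/to_normal_chain_eq; rewrite -scalerBr.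
have [h0 h] := @degenerate_chain_closed k X T n.
by rewrite -[_ *: _]addr0; apply: h => //; apply/to_normal_chain_eq; rewrite to_normal_chain_repr.
Qed.

Section NormalLmodule.
Context (k : comNzRingType) (X : choiceType) (T : X -> X -> X -> X) (n : nat).
Local Notation Q := (normal_chain k T n).

Let scaleA a b (v : Q) : normal_scale a (normal_scale b v) = normal_scale (a * b) v.
Proof. by rewrite -[v]to_normal_chain_repr !normal_scale_pi scalerA. Qed.

Let scale1 : left_id 1 (@normal_scale k X T n).
Proof. by move=> v; rewrite -[v]to_normal_chain_repr normal_scale_pi scale1r. Qed.

Let scaleDr : right_distributive (@normal_scale k X T n) +%R.
Proof.
move=> a u v; rewrite -[u]to_normal_chain_repr -[v]to_normal_chain_repr -raddfD !normal_scale_pi -raddfD.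
by rewrite scalerDr.
Qed.

Let scaleDl (v : Q) : {morph (@normal_scale k X T n)^~ v : a b / a + b}.
Proof.
by move=> a b; rewrite -[v]to_normal_chain_repr !normal_scale_pi -raddfD scalerDl.
Qed.

HB.instance Definition _ :=
  GRing.Zmodule_isLmodule.Build k Q scaleA scale1 scaleDr scaleDl.

Let to_normal_chainZ : scalable (@to_normal_chain k X T n).
Proof. by move=> a z; rewrite -normal_scale_pi. Qed.

HB.instance Definition _ :=
  GRing.isScalable.Build k (chain k X n) Q *:%R (@to_normal_chain k X T n)
    to_normal_chainZ.

End NormalLmodule.
Section LinearExtension.
Context (k : comNzRingType) (X : choiceType) (n : nat) (V : lmodType k).
Context (f : n.+2.-tuple X -> V).

Lemma linear_extensionEw (d : finmap.finset_of (Phant (n.+2.-tuple X)))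
    (z : chain k X n) : (forall x, x \in msupp z -> x \in d) ->
  linear_extension f z = \sum_(x <- d) mcoeff x z *: f x.
Proof.
move=> zd; apply: big_fset_incl => [|x _ xz]; first exact/fsubsetP.
by rewrite mcoeff_outdom ?scale0r.
Qed.

Lemma linear_extension_is_linear : linear (linear_extension (k := k) f).
Proof.
move=> a y z.
pose d := (msupp (a *: y + z) `|` (msupp y `|` msupp z))%fset.
rewrite !(@linear_extensionEw d) ?scaler_sumr -?big_split /=.
- by apply: eq_bigr => x _; rewrite mcoeffD mcoeffZ scalerDl scalerA.
- by move=> x; rewrite !in_fsetU => ->; rewrite !orbT.
- by move=> x; rewrite !in_fsetU => ->; rewrite !orbT.
- by move=> x; rewrite !in_fsetU => ->.
Qed.

HB.instance Definition _ := GRing.isLinear.Build k (chain k X n) V *:%R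
  (linear_extension f) linear_extension_is_linear.

Lemma linear_extension_basis (x : n.+2.-tuple X) :
  linear_extension f (basis_chain k x) = f x.
Proof.
rewrite (@linear_extensionEw [fset x]%fset) ?big_seq_fset1.
  by rewrite mcoeffUU scale1r.
by move=> y; apply/fsubsetP/msuppU_le.
Qed.

End LinearExtension.

Definition boundary2_tuple (k : comNzRingType) (X : choiceType)
    (T : X -> X -> X -> X) (x : 4.-tuple X) : chain k X 1 :=
  let e u v w : chain k X 1 := @basis_chain k X 1 [tuple u; v; w] in
  let a := tnth x (inord 0) in
  let b := tnth x (inord 1) in
  let c := tnth x (inord 2) in
  let d := tnth x (inord 3) in
  e b c d - e a (T a b c) (T (T a b c) c d) - e (T a b c) c d
  + e a b (T b c d) + e (T a b (T b c d)) (T b c d) d - e a b c.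

Definition boundary2 (k : comNzRingType) (X : choiceType)
    (T : X -> X -> X -> X) : chain k X 2 -> chain k X 1 :=
  linear_extension (@boundary2_tuple k X T).

HB.instance Definition _ (k : comNzRingType) (X : choiceType)
  (T : X -> X -> X -> X) := GRing.Linear.on (@boundary2 k X T).

(* The choice of representative is irrelevant when [T] is a KTQ: see
   [normal_boundary2E]. *)
Definition normal_boundary2 (k : comNzRingType) (X : choiceType)
    (T : X -> X -> X -> X) (q : normal_chain k T 2) : normal_chain k T 1 :=
  to_normal_chain T (boundary2 T (repr q)).

Lemma degenerate_basis3 (k : comNzRingType) (X : choiceType)
    (T : X -> X -> X -> X) (a b c : X) : b = T a b c ->
  to_normal_chain T (@basis_chain k X 1 [tuple a; b; c]) = 0.
Proof.
move=> h; rewrite -[RHS](raddf0 (@to_normal_chain k X T 1)).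
apply/to_normal_chain_eq/asboolP; rewrite subr0.
exists [:: (1, @basis_chain k X 1 [tuple a; b; c])]; last first.
  by rewrite big_seq1 scale1r.
move=> p; rewrite inE => /eqP -> /=.
exists [tuple a; b; c] => //; exists ord0.
by rewrite !(tnth_nth a) !inordK.
Qed.

Lemma boundary2_degenerate (k : comNzRingType) (X : choiceType)
    (T : X -> X -> X -> X) (hT : KTQ T) (x : 4.-tuple X) :
  degenerate_tuple (n := 2) T x -> to_normal_chain T (boundary2_tuple k T x) = 0.
Proof.
have degE y : degenerate_tuple (n := 2) T y ->
    tnth y (inord 1) = T (tnth y (inord 0)) (tnth y (inord 1)) (tnth y (inord 2))
    \/ tnth y (inord 2) =
       T (tnth y (inord 1)) (tnth y (inord 2)) (tnth y (inord 3)).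
  by case=> -[[|[|//]] ?] /= h; [left|right].
move=> /degE {degE}.
case: hT => _ A1 A2; rewrite /boundary2_tuple.
move: (tnth x (inord 0)) (tnth x (inord 1)) (tnth x (inord 2))
  (tnth x (inord 3)) => a b c d.
set e := fun u v w : X => @basis_chain k X 1 [tuple u; v; w].
case=> h; rewrite -!/(e _ _ _).
  rewrite -!h (_ : _ - _ = e (T a b (T b c d)) (T b c d) d - e a b c).
    rewrite raddfB /= !degenerate_basis3 ?subr0 //.
    by rewrite -A1 -h.
  by rewrite [_ - e b c d]addrAC subrr add0r addNr add0r.
rewrite -!h (_ : _ - _ = e b c d - e a (T a b c) (T (T a b c) c d)).
  rewrite raddfB /= !degenerate_basis3 ?subr0 //.
  by rewrite -A2 -h.
by rewrite addrAC addrK addrNK.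
Qed.

Lemma normal_boundary2E (k : comNzRingType) (X : choiceType)
    (T : X -> X -> X -> X) (hT : KTQ T) (z : chain k X 2) :
  normal_boundary2 (to_normal_chain T z) = to_normal_chain T (boundary2 T z).
Proof.
apply/eqP; rewrite -subr_eq0 -!raddfB; set y := _ - z.
have /asboolP[s sD ->] : degenerate_chain T y.
  by apply/to_normal_chain_eq; rewrite to_normal_chain_repr.
rewrite (raddf_sum (@boundary2 k X T)) raddf_sum big_seq big1 // => p ps.
have [x xD px] := sD p ps.
rewrite /= -px (linearZ_LR (@boundary2 k X T)) linearZ_LR /=.
by rewrite /boundary2 linear_extension_basis boundary2_degenerate // scaler0.
Qed.

Fixpoint iter_derive (R : realType) (V W : normedModType R) (vs : seq V)
    (f : V -> W) : V -> W :=
  if vs is v :: vs' then fun x => 'D_v (iter_derive vs' f) x else f.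

(* For open [U], differentiability of all iterated directional derivatives is
   C-infinity regularity on [U]. *)
Definition smooth_on (R : realType) (V W : normedModType R) (U : set V)
    (f : V -> W) : Prop :=
  forall (vs : seq V) (x : V), U x -> differentiable (iter_derive vs f) x.

Definition diffeomorphism (R : realType) (V W : normedModType R)
    (U : set V) (U' : set W) (h : V -> W) : Prop :=
  [/\ open U, open U', smooth_on U h &
      exists g : W -> V,
        [/\ smooth_on U' g,
            forall x, U x -> U' (h x) /\ g (h x) = x
          & forall y, U' y -> U (g y) /\ h (g y) = y]].

(* A smooth embedding of [V] onto a relatively open piece of [S]; the last
   clause says that it is a homeomorphism onto its image. *)
Definition local_parametrization (R : realType) (S : set 'rV[R]_4)
    (V : set 'rV[R]_2) (phi : 'rV[R]_2 -> 'rV[R]_4) : Prop :=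
  [/\ open V,
      smooth_on V phi,
      forall u, V u -> row_free ('J phi u),
      {in V &, injective phi}
    & forall V', open V' -> V' `<=` V ->
        exists2 U, open U & phi @` V' = S `&` U].

(* A closed smooth surface in R^4, not necessarily connected, with an
   orientation given by an atlas.  The rows of ['J phi u] are the two partial
   derivatives of [phi]. *)
Record oriented_closed_surface (R : realType) := OrientedClosedSurface {
  carrier :> set 'rV[R]_4;
  atlas : set (set 'rV[R]_2 * ('rV[R]_2 -> 'rV[R]_4));
  carrier_compact : compact carrier;
  atlas_param : forall V phi, atlas (V, phi) ->
    local_parametrization carrier V phi;
  atlas_cover : forall x, carrier x ->
    exists V phi, atlas (V, phi) /\ (phi @` V) x;
  atlas_oriented : forall V phi V' phi' u u',
    atlas (V, phi) -> atlas (V', phi') -> V u -> V' u' -> phi u = phi' u' ->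
    exists2 M : 'M[R]_2, 0 < \det M & 'J phi u = M *m 'J phi' u'
}.

(* [F] has as rows a tangent frame at [x] that matches the orientation. *)
Definition oriented_frame (R : realType) (S : oriented_closed_surface R)
    (x : 'rV[R]_4) (F : 'M[R]_(2, 4)) : Prop :=
  exists V phi u (M : 'M[R]_2),
    [/\ atlas S (V, phi), V u, phi u = x, 0 < \det M & F = M *m 'J phi u].

(* The projection R^4 -> R^3 forgets the last coordinate, which serves as the
   height that distinguishes over from under. *)
Definition proj (R : realType) (x : 'rV[R]_4) : 'rV[R]_3 :=
  x *m (pid_mx 3 : 'M[R]_(4, 3)).

Definition height (R : realType) (x : 'rV[R]_4) : R := x 0 ord_max.

Definition cube (R : realType) (n : nat) : set 'rV[R]_n :=
  [set u | forall j, `|u 0 j| < 1].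
Arguments cube : clear implicits.

(* The [i]-th coordinate plane of R^3. *)
Definition plane_sheet (R : realType) (i : 'I_3) (u : 'rV[R]_2) : 'rV[R]_3 :=
  \row_j (if unlift i j is Some l then u 0 l else 0).

Definition whitney_umbrella (R : realType) (u : 'rV[R]_2) : 'rV[R]_3 :=
  let s := u 0 0 in let t := u 0 1 in
  \row_j [:: s; s * t; t ^+ 2]`_j.

(* In suitable smooth coordinates, the part of [S] lying over a neighborhood
   [W] of [y] consists of [n] disjoint pieces that project by [m 0], ...,
   [m (n-1)]. *)
Definition local_form (R : realType) (S : set 'rV[R]_4) (y : 'rV[R]_3)
    (n : nat) (m : 'I_n -> 'rV[R]_2 -> 'rV[R]_3) : Prop :=
  exists (W : set 'rV[R]_3) (h : 'rV[R]_3 -> 'rV[R]_3)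
         (phi : 'I_n -> 'rV[R]_2 -> 'rV[R]_4),
    [/\ diffeomorphism W (cube R 3) h, W y /\ h y = 0,
        forall i, local_parametrization S (cube R 2) (phi i),
        forall i u, cube R 2 u ->
          W (proj (phi i u)) /\ h (proj (phi i u)) = m i u
      & forall x, S x -> W (proj x) -> exists! i, (phi i @` cube R 2) x].

(* Every point of the image has a neighborhood with one, two or three sheets
   in general position, or is a branch point. *)
Definition generic_projection (R : realType) (S : set 'rV[R]_4) : Prop :=
  forall y, (@proj R @` S) y ->
    (exists2 n, (0 < n <= 3)%N &
       local_form S y (fun i : 'I_n => @plane_sheet R (inord i))) \/
    local_form S y (fun _ : 'I_1 => @whitney_umbrella R).

Record oriented_diagram (R : realType) := OrientedDiagram {
  surface :> oriented_closed_surface R;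
  surface_generic : generic_projection surface
}.

Definition double_point (R : realType) (S : set 'rV[R]_4) (y : 'rV[R]_3)
    (xB xT : 'rV[R]_4) : Prop :=
  height xB < height xT /\ S `&` @proj R @^-1` [set y] = [set xB; xT].

Definition double_points (R : realType) (S : set 'rV[R]_4) : set 'rV[R]_3 :=
  [set y | exists xB xT, double_point S y xB xT].

Definition triple_point (R : realType) (S : set 'rV[R]_4) (y : 'rV[R]_3)
    (xB xM xT : 'rV[R]_4) : Prop :=
  [/\ height xB < height xM, height xM < height xT
    & S `&` @proj R @^-1` [set y] = [set xB; xM; xT]].

Definition triple_points (R : realType) (S : set 'rV[R]_4) : set 'rV[R]_3 :=
  [set y | exists xB xM xT, triple_point S y xB xM xT].

(* These edges do not contain their end points. *)
Definition double_point_edge (R : realType) (S : set 'rV[R]_4)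
    (e : set 'rV[R]_3) : Prop :=
  exists2 y, double_points S y & e = connected_component (double_points S) y.

Definition region (R : realType) (S : set 'rV[R]_4) (r : set 'rV[R]_3) : Prop :=
  exists2 z, (~` (@proj R @` S)) z &
    r = connected_component (~` (@proj R @` S)) z.

(* [v] is a co-orientation normal to the sheet of the diagram through
   [proj x] that is the projection of a neighborhood of [x] in [S]. *)
Definition conormal (R : realType) (S : oriented_closed_surface R)
    (x : 'rV[R]_4) (v : 'rV[R]_3) : Prop :=
  exists F : 'M[R]_(2, 4), let G := F *m (pid_mx 3 : 'M[R]_(4, 3)) in
    [/\ oriented_frame S x F, v *m G^T = 0
      & 0 < \det (col_mx v G : 'M[R]_3)].

(* The vector [w] points to the side of the sheet at [x] into which the
   co-orientation arrow points if [b], and to the other side otherwise. *)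
Definition on_side (R : realType) (S : oriented_closed_surface R)
    (w : 'rV[R]_3) (x : 'rV[R]_4) (b : bool) : Prop :=
  exists2 v, conormal S x v &
    if b then 0 < (w *m v^T) 0 0 else (w *m v^T) 0 0 < 0.

(* [r] is the region near [y] lying on the given side of each of the given
   sheets through [y]: it contains the points close to [y] in some direction
   pointing to these sides. *)
Definition region_near (R : realType) (S : oriented_closed_surface R)
    (y : 'rV[R]_3) (sides : seq ('rV[R]_4 * bool)) (r : set 'rV[R]_3) : Prop :=
  region S r /\
  exists w, (forall s, s \in sides -> on_side S w s.1 s.2) /\
            \forall t \near 0^'+, r (y + t *: w).

(* [r1], [r2], [r3] is the ascending path of [e]; [r4] is the fourth region. *)
Definition edge_regions (R : realType) (S : oriented_closed_surface R)
    (e r1 r2 r3 r4 : set 'rV[R]_3) : Prop :=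
  exists y xB xT,
    [/\ e y, double_point S y xB xT &
    [/\ region_near S y [:: (xB, false); (xT, false)] r1,
        region_near S y [:: (xB, true); (xT, false)] r2,
        region_near S y [:: (xB, true); (xT, true)] r3
      & region_near S y [:: (xB, false); (xT, true)] r4]].

(* Only the values of [c] on regions matter. *)
Definition KTQ_coloring (R : realType) (S : oriented_closed_surface R)
    (X : Type) (T : X -> X -> X -> X) (c : set 'rV[R]_3 -> X) : Prop :=
  forall e r1 r2 r3 r4, double_point_edge S e ->
    edge_regions S e r1 r2 r3 r4 -> c r4 = T (c r1) (c r2) (c r3).

Definition positive_triple_point (R : realType)
    (S : oriented_closed_surface R) (y : 'rV[R]_3) : Prop :=
  exists xB xM xT vB vM vT,
    [/\ triple_point S y xB xM xT,
        conormal S xB vB, conormal S xM vM, conormal S xT vT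
      & 0 < \det (col_mx vT (col_mx vM vB) : 'M[R]_3)].

Definition triple_point_sign (R : realType) (S : oriented_closed_surface R)
    (y : 'rV[R]_3) : int :=
  if `[< positive_triple_point S y >] then 1 else -1.

(* The [i]-th region of the ascending path, having crossed the [i] lowest
   sheets.  The default value is irrelevant: at a triple point of a generic
   projection there is exactly one such region. *)
Definition ascending_path (R : realType) (S : oriented_closed_surface R)
    (y : 'rV[R]_3) (i : 'I_4) : set 'rV[R]_3 :=
  xget set0 [set r | exists xB xM xT, triple_point S y xB xM xT /\
    region_near S y [:: (xB, 0 < i)%N; (xM, 1 < i)%N; (xT, 2 < i)%N] r].

Definition colored_path (R : realType) (S : oriented_closed_surface R)
    (X : choiceType) (c : set 'rV[R]_3 -> X) (y : 'rV[R]_3) : 4.-tuple X :=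
  [tuple c (ascending_path S y i) | i < 4].

(* The sum is finite, as a generic projection of a compact surface has finitely
   many triple points. *)
Definition associated_chain (k : comNzRingType) (R : realType)
    (S : oriented_closed_surface R) (X : choiceType)
    (c : set 'rV[R]_3 -> X) : chain k X 2 :=
  \sum_(y \in triple_points S)
    (triple_point_sign S y)%:~R *: @basis_chain k X 2 (colored_path S c y).

(* Main.v *)
Require Import Defs.
From mathcomp Require Import all_boot all_order all_algebra fingroup perm.
From mathcomp Require Import all_classical all_reals all_analysis.
From mathcomp Require Import ring lra zify.

Set Implicit Arguments.
Unset Strict Implicit.
Unset Printing Implicit Defensive.

Import Order.TTheory GRing.Theory Num.Theory numFieldNormedType.Exports.

Local Open Scope classical_set_scope.
Local Open Scope ring_scope.

Local Notation proj := Defs.proj.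

(** The statement is a Stokes formula along the double curves of the diagram.

    Attach to every double point [q] the class [edge_color q] in [C_1^N] of the
    colored ascending path of the edge through [q].  Orient the double curves by
    the vector product of the conormals of the upper and of the lower sheet.  A
    function on the double points that is locally constant off a finite set has
    a [jump] at each double point: its value just after the point minus its
    value just before it.  Since [edge_color] itself is locally constant, it has
    no jumps at all.

    Now cover the compact image of the surface by finitely many small boxes,
    each adapted to one of the local models of a generic projection, and cut
    [edge_color] into pieces supported in disjoint parts of these boxes.  The
    pieces do have jumps, where a double curve passes from one part to another,
    but the pieces sum to [edge_color], so the jumps of all the pieces, summed
    over all double points, give zero ([contributions_cancel]).  On the other
    hand the jumps of a single piece can be summed within its box
    ([local_box]), where a double curve is a coordinate axis and the sum
    telescopes:
    - along an axis without triple point the piece vanishes at both ends, so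
      its jumps sum to zero;
    - around a triple point each of the three axes consists of two open half
      axes, since the triple point itself is not a double point.  Each half axis
      contributes, up to sign, the colored ascending path of its edge.  The
      coloring rule turns the colors of the octants into the entries of
      [boundary2_tuple], and the total is minus the sign of the triple point
      times the boundary of its colored path ([triple_contribution]);
    - at a branch point the double curve stops, and nothing compensates the
      value there; but the second and the fourth region at the edge are the
      same region, which surrounds the pinch point.  The coloring rule then
      reads [c r2 = T (c r1) (c r2) (c r3)], so the colored path is degenerate
      and vanishes in [C_1^N] ([edge_color_whitney]).
    The cancellation of these contributions is the theorem.

    The geometric input is a normal form of the charts
    ([normal_plane_chart_exists]).  In suitable coordinates the sheets are
    coordinate planes, numbered from bottom to top and co-oriented by the
    coordinates, so that regions near a point are octants and the sign of a
    triple point is the sign of a Jacobian determinant.  To compare the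
    orientation of the surface, given by an atlas, with the parametrizations in
    the local models, one needs that two parametrizations have the same tangent
    planes ([param_tangent]) and that on a connected domain they differ in
    orientation by a constant sign ([orientation_sign_constant]). *)

(** * Connectedness *)

(** The points of [A] satisfying [P] are open and closed relatively to [A]. *)
Lemma connected_locally_constant (E : topologicalType) (A : set E)
    (P : E -> Prop) : connected A ->
  (forall x, A x -> \forall y \near x, A y -> (P y <-> P x)) ->
  forall x y, A x -> A y -> P x -> P y.
Proof.
move=> cA lP x y Ax Ay Px.
have oP (Q : E -> Prop) :
    (forall x, A x -> \forall y \near x, A y -> (Q y <-> Q x)) ->
    exists2 C, open C & A `&` Q = A `&` C.
  move=> lQ; exists ([set z | A z -> Q z]^°); first exact: open_interior.
  apply/seteqP; split=> z [Az Qz]; split=> //.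
    by apply: filterS (lQ z Az) => w h Aw; apply/h.
  exact: (interior_subset Qz).
have [C oC eC] := oP P lP.
have [D oD eD] : exists2 D, open D & A `&` ~` P = A `&` D.
  apply: oP => z Az; apply: filterS (lP z Az) => w h Aw.
  by have [wz zw] := h Aw; split=> nP p; apply: nP; auto.
suff eA : A `&` P = A by move: Ay; rewrite -eA => -[].
apply: cA; [by exists x | by exists C | exists (~` D); first exact: open_closedC].
apply/seteqP; split=> z [Az h]; split=> //.
  by move=> Dz; have [_] : (A `&` ~` P) z by rewrite eD.
apply: contrapT => Pz; apply: h.
by have : (A `&` D) z; [rewrite -eD|case].
Qed.

Lemma star_connected (R : realType) (V : normedModType R) (A : set V) (o : V) :
  (forall x t, A x -> 0 <= t <= 1 -> A (o + t *: (x - o))) -> connected A.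
Proof.
move=> sA.
pose seg (x : V) := (fun t : R => o + t *: (x - o)) @` `[0, 1].
have -> : A = \bigcup_(x in A) seg x.
  apply/seteqP; split=> [x Ax|_ [x Ax [t t01 <-]]].
    exists x => //; exists 1; last by rewrite scale1r addrC subrK.
    by rewrite /= in_itv /= ler01 lexx.
  by apply: sA => //; move: t01; rewrite /= in_itv.
apply: bigcup_connected.
  exists o => x _; exists 0; last by rewrite scale0r addr0.
  by rewrite /= in_itv /= ler01 lexx.
move=> x _; apply: connected_continuous_connected.
  exact: segment_connected.
apply: continuous_subspaceT => t.
by apply: cvgD; [exact: cvg_cst|apply: cvgZr_tmp; exact: cvg_id].
Qed.

Lemma cube_connected (R : realType) n : connected (cube R n).
Proof.
apply: (@star_connected _ _ _ 0) => x t cx t01 j.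
rewrite add0r subr0 mxE normrM; apply: le_lt_trans (cx j).
by rewrite ler_piMl // ger0_norm; case/andP: t01.
Qed.

Lemma cube0 (R : realType) n : cube R n 0.
Proof. by move=> j; rewrite mxE normr0. Qed.

Lemma constant_sign (R : realType) (E : topologicalType) (A : set E)
    (f : E -> R) : connected A ->
  (forall x, A x -> {for x, continuous f}) -> (forall x, A x -> f x != 0) ->
  forall x y, A x -> A y -> (0 < f x) = (0 < f y).
Proof.
move=> cA fc f0.
suff pos x y : A x -> A y -> 0 < f x -> 0 < f y.
  by move=> x y Ax Ay; apply/idP/idP; apply: pos.
move=> Ax Ay; apply: (@connected_locally_constant _ A (fun z => 0 < f z)) => //.
move=> z Az; case: (ltgtP 0 (f z)) => [fz|fz|fz].
- have : \forall w \near z, 0 < f w by apply: (cvgr_gt (f z)) => //; exact: fc.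
  by apply: filterS.
- have : \forall w \near z, f w < 0 by apply: (cvgr_lt (f z)) => //; exact: fc.
  by apply: filterS => w fw _; rewrite ltNge ltW.
- by have := f0 z Az; rewrite -fz eqxx.
Qed.

(** * Jacobian matrices *)
Section Differential.
Context {R : realType}.

Lemma mx_norm_ltP m n (M : 'M[R]_(m, n)) (e : R) : 0 < e ->
  `|M| < e <-> forall i j, `|M i j| < e.
Proof.
move=> e0; rewrite [`|M|]mx_normrE; split=> [h i j|h].
  apply: le_lt_trans h.
  exact: (@le_bigmax _ _ _ _ (fun i => `|M i.1 i.2|) (i, j)).
by apply/bigmax_ltP; split.
Qed.

Lemma mx_norm_leP m n (M : 'M[R]_(m, n)) (e : R) : 0 <= e ->
  `|M| <= e <-> forall i j, `|M i j| <= e.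
Proof.
move=> e0; rewrite [`|M|]mx_normrE; split=> [h i j|h].
  apply: le_trans h.
  exact: (@le_bigmax _ _ _ _ (fun i => `|M i.1 i.2|) (i, j)).
by apply/bigmax_leP; split.
Qed.

Lemma cvg_mx (T : Type) (F : set_system T) {FF : Filter F} m n
    (f : T -> 'M[R]_(m, n)) (l : 'M[R]_(m, n)) :
  (forall i j, f x i j @[x --> F] --> l i j) -> f x @[x --> F] --> l.
Proof.
move=> fl; apply/cvgrPdist_lt => e e0.
have h (p : 'I_m * 'I_n) : \forall x \near F, `|l p.1 p.2 - f x p.1 p.2| < e.
  exact: cvgr_dist_lt.
have hF := @filter_forall _ _ _ F FF h; near=> x.
have hx : forall p : 'I_m * 'I_n, `|l p.1 p.2 - f x p.1 p.2| < e by near: x.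
by apply/mx_norm_ltP => // i j; rewrite !mxE; exact: (hx (i, j)).
Unshelve. all: by end_near. Qed.

Lemma cvg_entry (T : Type) (F : set_system T) {FF : Filter F} m n
    (f : T -> 'M[R]_(m, n)) (l : 'M[R]_(m, n)) i j :
  f x @[x --> F] --> l -> f x i j @[x --> F] --> l i j.
Proof.
by move=> fl; apply: (cvg_comp f (fun M : 'M[R]_(m, n) => M i j) fl);
  exact: coord_continuous.
Qed.

Lemma cvg_mulmx (T : Type) (F : set_system T) {FF : Filter F} m n p
    (f : T -> 'M[R]_(m, n)) (g : T -> 'M[R]_(n, p))
    (a : 'M[R]_(m, n)) (b : 'M[R]_(n, p)) :
  f x @[x --> F] --> a -> g x @[x --> F] --> b ->
  f x *m g x @[x --> F] --> a *m b.
Proof.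
move=> fa gb; apply: cvg_mx => i j; under eq_fun do rewrite mxE.
rewrite mxE; apply: cvg_big => [|k _]; first exact: add_continuous.
by apply: cvgM; exact: cvg_entry.
Qed.

Lemma cvg_det (T : Type) (F : set_system T) {FF : Filter F} n
    (f : T -> 'M[R]_n) (a : 'M[R]_n) : f x @[x --> F] --> a -> \det (f x) @[x --> F] --> \det a.
Proof.
move=> fa; apply: cvg_big => [|s _]; first exact: add_continuous.
apply: cvgM; first exact: cvg_cst.
apply: cvg_big => [|k _]; [exact: mul_continuous|exact: cvg_entry].
Qed.

Lemma mulmx_continuous m n p (M : 'M[R]_(n, p)) :
  continuous (fun A : 'M[R]_(m, n) => A *m M).
Proof.
move=> A; apply: (@cvg_mulmx _ (nbhs A) _ _ _ _ id (cst M) A M) => //.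
exact: cvg_cst.
Qed.

(** Locking the matrix-valued function, and not its values, lets unification
    tell the derivatives of two maps apart without unfolding either. *)
Definition jac m n : ('rV[R]_m -> 'rV[R]_n) -> 'rV[R]_m -> 'M[R]_(m, n) :=
  locked (fun f x => 'J f x).

Lemma jacE m n (f : 'rV[R]_m -> 'rV[R]_n) x : jac f x = 'J f x.
Proof. by rewrite /jac -lock. Qed.

Lemma mul_jac m n (f : 'rV[R]_m -> 'rV[R]_n) x v : v *m jac f x = 'd f x v.
Proof. by rewrite jacE /jacobian mul_rV_lin1. Qed.

Lemma derive_jac m n (f : 'rV[R]_m -> 'rV[R]_n) x v :
  differentiable f x -> 'D_v f x = v *m jac f x.
Proof. by move=> df; rewrite mul_jac deriveE. Qed.

Lemma differentiable_estimate m n (f : 'rV[R]_m -> 'rV[R]_n) x (e : R) :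
  differentiable f x -> 0 < e ->
  \forall v \near 0, `|f (x + v) - f x - v *m jac f x| <= e * `|v|.
Proof.
move=> df e0; have [_ /eqaddoP /(_ e e0)] := (diff_locallyP x f).1 df.
apply: filterS => v; rewrite /= !fctE /= opprD addrA mul_jac.
by rewrite [v + x]addrC.
Qed.

Lemma jacobian_comp m n p (f : 'rV[R]_m -> 'rV[R]_n) (g : 'rV[R]_n -> 'rV[R]_p) x :
  differentiable f x -> differentiable g (f x) ->
  jac (g \o f) x = jac f x *m jac g (f x).
Proof.
move=> df dg; apply/row_matrixP => i; rewrite !rowE mulmxA !mul_jac.
by rewrite diff_comp.
Qed.

Lemma near_jacobian m n (f g : 'rV[R]_m -> 'rV[R]_n) x :
  {near x, f =1 g} -> differentiable f x -> differentiable g x ->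
  jac f x = jac g x.
Proof.
move=> fg df dg; apply/row_matrixP => i.
have E h : differentiable h x -> row i (jac h x) = 'D_(delta_mx 0 i) h x.
  by move=> dh; rewrite rowE (derive_jac _ dh).
transitivity ('D_(delta_mx 0 i) f x); first exact: E.
transitivity ('D_(delta_mx 0 i) g x); last by rewrite E.
exact: (near_eq_derive _ fg).
Qed.

Lemma jacobian_id m (x : 'rV[R]_m) : jac id x = 1%:M.
Proof.
apply/row_matrixP => i; rewrite !rowE mul_jac mulmx1.
by rewrite diff_val.
Qed.

Lemma mulmx_diff m n (M : 'M[R]_(m, n)) (x : 'rV[R]_m) :
  differentiable (fun x : 'rV[R]_m => x *m M) x /\
  jac (fun x : 'rV[R]_m => x *m M) x = M.
Proof.
pose f : {linear 'rV[R]_m -> 'rV[R]_n} := mulmxr M.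
rewrite (_ : (fun x => _) = f) //.
have cf : continuous f by move=> y; exact: mulmx_continuous.
split; first exact: linear_differentiable.
apply/row_matrixP => i; rewrite !rowE mul_jac diff_lin //.
Qed.

Lemma jacobian_left_inverse m n (f : 'rV[R]_m -> 'rV[R]_n)
    (g : 'rV[R]_n -> 'rV[R]_m) x :
  differentiable f x -> differentiable g (f x) ->
  (\forall y \near x, g (f y) = y) -> jac f x *m jac g (f x) = 1%:M.
Proof.
move=> df dg gf; rewrite -jacobian_comp // -(jacobian_id x).
by apply: near_jacobian => //; exact: differentiable_comp.
Qed.

(** The entries of the Jacobian matrix are directional derivatives, which are
    themselves differentiable for a smooth map. *)
Lemma jacobian_continuous m n (U : set 'rV[R]_m) (f : 'rV[R]_m -> 'rV[R]_n) x :
  open U -> smooth_on U f -> U x -> jac f y @[y --> x] --> jac f x.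
Proof.
move=> oU sf Ux; apply: (@cvg_mx _ (nbhs x)) => i j.
have JE y : U y -> jac f y i j = ('D_(delta_mx 0 i) f y) 0 j.
  move=> Uy; have df : differentiable f y := sf [::] y Uy.
  by rewrite (derive_jac _ df) -rowE [RHS]mxE.
suff h : jac f y i j @[y --> x] --> ('D_(delta_mx 0 i) f x) 0 j.
  exact: (@eq_ind R _ (fun l : R => jac f y i j @[y --> x] --> l) h _
    (esym (JE x Ux))).
have h : ('D_(delta_mx 0 i) f y) 0 j @[y --> x] --> ('D_(delta_mx 0 i) f x) 0 j.
  apply: (@cvg_entry _ (nbhs x)).
  exact: differentiable_continuous (sf [:: delta_mx 0 i] x Ux).
apply: cvg_trans h; apply: (@near_eq_cvg _ _ (nbhs x)).
near=> y; apply/esym/JE; near: y.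
exact: open_nbhs_nbhs.
Unshelve. all: by end_near. Qed.

Lemma cvg_scale_right0 (V : normedModType R) (w : V) : t *: w @[t --> 0^'+] --> (0 : V).
Proof.
rewrite -[X in _ --> X](scale0r w).
by apply: cvg_at_right_filter; apply: cvgZr_tmp; exact: cvg_id.
Qed.

Lemma differentiable_coord_incr m n (f : 'rV[R]_m -> 'rV[R]_n) x w i :
  differentiable f x -> 0 < (w *m jac f x) 0 i ->
  \forall t \near 0^'+, f x 0 i < f (x + t *: w) 0 i.
Proof.
have [D eD] : exists D, D = w *m jac f x by eexists.
rewrite -eD; set d := D 0 i => df d0.
have e0 : 0 < d / (`|w| + 1) by rewrite divr_gt0 // ltr_wpDl.
have /(_ _ e0) := differentiable_estimate df.
move=> /(cvg_scale_right0 w).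
rewrite /= => est; near=> t.
have t0 : 0 < t by near: t; exact: nbhs_right_gt.
have : `|f (x + t *: w) - f x - (t *: w) *m jac f x| <= d / (`|w| + 1) * `|t *: w|.
  by near: t; exact: est.
move=> /mx_norm_leP h.
have := h _ 0 i; rewrite -scalemxAl -eD !mxE -/d normrZ gtr0_norm //.
move=> h1.
have {h1} := h1 (mulr_ge0 (ltW e0) (mulr_ge0 (ltW t0) (normr_ge0 w))).
rewrite ler_norml => /andP[+ _].
have : d / (`|w| + 1) * (t * `|w|) < t * d.
  have -> : d / (`|w| + 1) * (t * `|w|) = t * (d * (`|w| / (`|w| + 1))) by ring.
  rewrite ltr_pM2l // gtr_pMr // ltr_pdivrMr ?mul1r ?ltrDl //.
lra.
Unshelve. all: by end_near. Qed.

(** A left inverse of the derivative recovers a displacement from its image up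
    to a first-order error; for small displacements this error is at most half
    of the displacement and can be absorbed. *)
Lemma immersion_lower_bound m n (f : 'rV[R]_m -> 'rV[R]_n) x :
  differentiable f x -> row_free (jac f x) ->
  exists2 C, 0 < C & \forall v \near 0, `|v| <= C * `|f (x + v) - f x|.
Proof.
move=> df /row_freeP[L JL].
have [k k0 Lk] := @linear_lipschitz _ _ _ (mulmxr L) (@mulmx_continuous 1 n m L).
exists (2 * k); first by rewrite mulr_gt0.
have e0 : 0 < (2 * k)^-1 by rewrite invr_gt0 mulr_gt0.
apply: filterS (differentiable_estimate df e0) => v est.
have := Lk (v *m jac f x); rewrite /= -mulmxA JL mulmx1.
have : `|v *m jac f x| <= `|f (x + v) - f x| + (2 * k)^-1 * `|v|.
  rewrite (_ : v *m jac f x = (f (x + v) - f x) - (f (x + v) - f x - v *m jac f x)).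
    by apply: le_trans (ler_normB _ _) _; rewrite lerD2l.
  by rewrite opprB addrC subrK.
move=> h1 h2.
have : k * `|v *m jac f x| <= k * `|f (x + v) - f x| + `|v| / 2.
  apply: le_trans (_ : k * (`|f (x + v) - f x| + (2 * k)^-1 * `|v|) <= _).
    by rewrite ler_pM2l.
  by have kn0 : k != 0; [rewrite gt_eqF | rewrite le_eqVlt; apply/orP; left; apply/eqP; field].
lra.
Qed.

End Differential.

(** * Tangent planes *)
Section Parametrizations.
Context {R : realType}.
Implicit Types (S : set 'rV[R]_4) (V : set 'rV[R]_2)
  (phi : 'rV[R]_2 -> 'rV[R]_4).

Lemma param_differentiable S V phi u :
  local_parametrization S V phi -> V u -> differentiable phi u.
Proof. by case=> _ sphi _ _ _ Vu; exact: (sphi [::] u Vu). Qed.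

Lemma param_free S V phi u :
  local_parametrization S V phi -> V u -> row_free (jac phi u).
Proof. by case=> _ _ h _ _ Vu; rewrite jacE; exact: h. Qed.

Lemma param_mem S V phi u : local_parametrization S V phi -> V u -> S (phi u).
Proof.
case=> oV _ _ _ h Vu; have [U _ e] := h V oV (fun _ => id).
by have [] : (S `&` U) (phi u) by rewrite -e; exists u.
Qed.

(** A parametrization is a homeomorphism onto its image: points of the surface
    close to [phi u] have parameters close to [u]. *)
Lemma param_open S V phi u N :
  local_parametrization S V phi -> V u -> nbhs u N ->
  exists U, [/\ open U, U (phi u) &
    forall x, S x -> U x -> exists w, [/\ N w, V w & phi w = x]].
Proof.
case=> oV _ _ _ h Vu Nu.
have [U oU e] := h (N^° `&` V) (openI (@open_interior _ N) oV)
  (fun _ => @proj2 _ _).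
exists U; split=> //.
  have [//] : (S `&` U) (phi u).
  by rewrite -e; exists u.
move=> x Sx Ux; have : (S `&` U) x by [].
by rewrite -e => -[w [/interior_subset Nw Vw] <-]; exists w.
Qed.

Lemma param_transition S V phi V' phi' u u' N :
  local_parametrization S V phi -> local_parametrization S V' phi' ->
  V u -> V' u' -> phi u = phi' u' -> nbhs u N ->
  \forall w' \near u', exists w, [/\ N w, V w & phi w = phi' w'].
Proof.
move=> pphi pphi' Vu V'u' e Nu.
have [U [oU Uu h]] := param_open pphi Vu Nu.
have cphi' := differentiable_continuous (param_differentiable pphi' V'u').
have : \forall w' \near u', U (phi' w').
  by apply: cphi'; rewrite -e; exact: open_nbhs_nbhs.
have : \forall w' \near u', V' w' by case: pphi' => oV' *; apply: open_nbhs_nbhs; split.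
by apply: filterS2 => w' V'w' Uw'; apply: h => //; exact: (param_mem pphi').
Qed.

(** Two parametrizations of a surface have the same tangent plane at a common
    point. No regularity of the coordinate change has to be established first:
    the lower bound for immersions shows that a displacement of size [t] in one
    chart has size at most a multiple of [t] in the other. *)
Lemma param_tangent S V phi V' phi' u u' :
  local_parametrization S V phi -> local_parametrization S V' phi' ->
  V u -> V' u' -> phi u = phi' u' ->
  exists2 M, M \in unitmx & jac phi' u' = M *m jac phi u.
Proof.
move=> pphi pphi' Vu V'u' e.
have df := param_differentiable pphi Vu.
have df' := param_differentiable pphi' V'u'.
have free := param_free pphi Vu.
have free' := param_free pphi' V'u'.
suff /submxP[M JM] : (jac phi' u' <= jac phi u)%MS.
  exists M => //; rewrite -row_free_unit -row_leq_rank.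
  by move: free'; rewrite -row_leq_rank JM => /leq_trans; apply; exact: mxrankM_maxl.
(* It suffices that the derivative of [phi'] along any [v] is killed by the
   cokernel [N] of the derivative of [phi]; its image [d] under [N] will be
   bounded by arbitrarily small numbers. *)
rewrite submxE; set N := cokermx _; apply/eqP/row_matrixP => i.
rewrite row0 rowE mulmxA; move: (delta_mx 0 i) => v.
have JN : jac phi u *m N = 0 by exact: mulmx_coker.
have [k k0 Nk] := @linear_lipschitz _ _ _ (mulmxr N) (@mulmx_continuous R 1 4 4 N).
have [C C0 imm] := immersion_lower_bound df free.
set d := _ *m N.
pose K := k * (`|v| + C * (`|v *m jac phi' u'| + `|v|)).
suff small a : 0 < a <= 1 -> `|d| <= a * K.
  apply/eqP; rewrite -normr_le0 leNgt; apply/negP => d0.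
  have K0 : 0 <= K by rewrite mulr_ge0 ?addr_ge0 ?mulr_ge0 // ltW.
  have Kd0 : 0 < K + `|d| by rewrite ltr_wpDl.
  have := small (`|d| / (2 * (K + `|d|))).
  rewrite divr_gt0 ?mulr_gt0 //= ler_pdivrMr ?mulr_gt0 //.
  have -> : `|d| <= 1 * (2 * (K + `|d|)) by lra.
  move=> /(_ isT); rewrite mulrAC ler_pdivlMr ?mulr_gt0 // ler_pM2l //.
  lra.
move=> /andP[a0 a1].
have est := differentiable_estimate df a0.
have est' : \forall t \near 0^'+,
    `|phi' (u' + t *: v) - phi' u' - (t *: v) *m jac phi' u'| <= a * `|t *: v|
  := cvg_scale_right0 v (differentiable_estimate df' a0).
(* The displacement [t *: v] of [phi'] is the displacement [l] of [phi], and
   [l] is at most of order [t]. *)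
have [t [t0 ht [l [el hl le]]]] : exists t : R, [/\ 0 < t,
    `|phi' (u' + t *: v) - phi' u' - (t *: v) *m jac phi' u'| <= a * `|t *: v| &
    exists l, [/\ phi (u + l) = phi' (u' + t *: v),
      `|phi (u + l) - phi u - l *m jac phi u| <= a * `|l| &
      `|l| <= C * `|phi (u + l) - phi u|]].
  pose P l := `|phi (u + l) - phi u - l *m jac phi u| <= a * `|l| /\
      `|l| <= C * `|phi (u + l) - phi u|.
  have nP : \forall w \near u, P (w - u).
    rewrite (near_shift 0 u) /=; apply: filterS2 est imm => l h1 h2.
    by rewrite /shift /= subr0 addrK; split.
  have tr := param_transition pphi pphi' Vu V'u' e nP.
  have cv : u' + t *: v @[t --> 0^'+] --> u'.
    rewrite -[X in _ --> X]addr0; apply: cvgD; first exact: cvg_cst.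
    exact: cvg_scale_right0.
  have tr' : \forall t \near 0^'+, exists w,
    [/\ P (w - u), V w & phi w = phi' (u' + t *: v)] := cv _ tr.
  have : \forall t \near 0^'+, (0 : R) < t by exact: nbhs_right_gt.
  move=> tp.
  have [t [[[w [[P1 P2] Vw ew]] ht] t0]] := filter_ex (filterI (filterI tr' est') tp).
  exists t; split=> //; exists (w - u); split=> //.
  by rewrite [u + _]addrC subrK.
have eN : t *: d = (phi (u + l) - phi u - l *m jac phi u) *m N -
    (phi' (u' + t *: v) - phi' u' - (t *: v) *m jac phi' u') *m N.
  rewrite el e !(mulmxBl _ _ N) -[l *m _ *m N]mulmxA JN mulmx0 subr0.
  by rewrite opprB addrC subrK -!scalemxAl.
have hd : t * `|d| <= k * (a * `|l|) + k * (a * (t * `|v|)).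
  rewrite -[X in X * _](gtr0_norm t0) -normrZ eN.
  apply: le_trans (ler_normB _ _) _; apply: lerD.
    by apply: le_trans (Nk _) _; rewrite ler_pM2l.
  by apply: le_trans (Nk _) _; rewrite ler_pM2l // -[X in X * `|v|](gtr0_norm t0) -normrZ.
have hl2 : `|l| <= C * (t * `|v *m jac phi' u'| + t * `|v|).
  apply: le_trans le _; rewrite ler_pM2l // el e.
  rewrite -[X in X * _ + X * _](gtr0_norm t0) -!normrZ.
  rewrite -[X in `|X|](subrK ((t *: v) *m jac phi' u')) addrC.
  apply: le_trans (ler_normD _ _) _; apply: lerD.
    by rewrite -scalemxAl.
  apply: le_trans ht _; rewrite ler_piMl //.
rewrite -(ler_pM2l t0); apply: le_trans hd _.
rewrite -mulrDr /K.
have -> : t * (a * (k * (`|v| + C * (`|v *m jac phi' u'| + `|v|)))) =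
  k * (a * (C * (t * `|v *m jac phi' u'| + t * `|v|)) + a * (t * `|v|)) by ring.
by rewrite ler_pM2l // lerD2r ler_pM2l.
Qed.

End Parametrizations.

(** * Orientation and conormals *)

Lemma sign_mul_gt0 (R : realDomainType) (b : bool) (x y : R) :
  0 < (-1) ^+ b * x -> (0 < x * y) = (0 < (-1) ^+ b * y).
Proof.
case: b; rewrite ?expr1 ?expr0 ?mulN1r ?mul1r.
  by rewrite !oppr_gt0 => x0; rewrite nmulr_rgt0.
by move=> x0; rewrite pmulr_rgt0.
Qed.

Lemma sign_inj (R : realDomainType) (b b' : bool) (x : R) :
  0 < (-1) ^+ b * x -> 0 < (-1) ^+ b' * x -> b = b'.
Proof.
by case: b; case: b' => //=; rewrite expr0 expr1 => ? ?; exfalso; lra.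
Qed.

Section Orientation.
Context {R : realType} (S : oriented_closed_surface R).
Implicit Types (b : bool) (V : set 'rV[R]_2) (phi : 'rV[R]_2 -> 'rV[R]_4).

Lemma atlas_jac V phi V' phi' u u' :
  atlas S (V, phi) -> atlas S (V', phi') -> V u -> V' u' -> phi u = phi' u' ->
  exists2 M : 'M[R]_2, 0 < \det M & jac phi u = M *m jac phi' u'.
Proof.
move=> a a' Vu V'u' e; have [M dM J] := atlas_oriented a a' Vu V'u' e.
by exists M => //; rewrite jacE J jacE.
Qed.

(** The Boolean encodes a sign by [(-1) ^+ b]; it tells whether [phi] disagrees
    with the orientation of the surface at [phi u]. *)
Definition orientation_sign phi u (b : bool) := exists V' phi' u' (M : 'M[R]_2),
  [/\ atlas S (V', phi'), V' u', phi' u' = phi u,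
      jac phi' u' = M *m jac phi u & 0 < (-1) ^+ b * \det M].

Lemma orientation_sign_total V phi u : local_parametrization S V phi -> V u ->
  exists b, orientation_sign phi u b.
Proof.
move=> pphi Vu; have Su := param_mem pphi Vu.
have [V' [phi' [at' [u' V'u' e]]]] := atlas_cover Su.
have [M uM JM] := param_tangent pphi (atlas_param at') Vu V'u' (esym e).
exists (\det M < 0), V', phi', u', M; split=> //.
have : \det M != 0 by rewrite -unitfE -unitmxE.
by case: (ltgtP (\det M) 0) => //= dM _; rewrite ?expr1 ?expr0 ?mulN1r ?mul1r ?oppr_gt0.
Qed.

Lemma orientation_sign_unique V phi u b b' : local_parametrization S V phi ->
  V u -> orientation_sign phi u b -> orientation_sign phi u b' -> b = b'.
Proof.
move=> pphi Vu [V1 [phi1 [u1 [M1 [a1 V1u1 e1 J1 d1]]]]].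
move=> [V2 [phi2 [u2 [M2 [a2 V2u2 e2 J2 d2]]]]].
have [P dP JP] := atlas_jac a1 a2 V1u1 V2u2 (etrans e1 (esym e2)).
have eM : M1 = P *m M2.
  by apply: (row_free_inj (param_free pphi Vu)); rewrite -J1 JP J2 mulmxA.
move: d1; rewrite eM det_mulmx mulrCA pmulr_rgt0 // => d1.
exact: sign_inj d1 d2.
Qed.

(** With a left inverse [L] of the derivative of [phi] at [u], the sign of a
    coordinate change near [u] is the sign of the quotient of the determinants
    of the two Jacobian matrices multiplied by [L]. These vary continuously,
    which avoids differentiating the coordinate change. *)
Lemma orientation_sign_open V phi u b : local_parametrization S V phi -> V u ->
  orientation_sign phi u b -> \forall w \near u, orientation_sign phi w b.
Proof.
move=> pphi Vu [V' [phi' [u' [M [a' V'u' e J dM]]]]].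
have pphi' := atlas_param a'.
have [L JL] : exists L, jac phi u *m L = 1%:M by exact/row_freeP/(param_free pphi Vu).
have [oV sphi] : open V /\ smooth_on V phi by case: pphi.
have [oV' sphi'] : open V' /\ smooth_on V' phi' by case: pphi'.
have c1 : \det (jac phi w *m L) @[w --> u] --> \det (jac phi u *m L).
  apply: (@cvg_det _ _ (nbhs u)); apply: (@cvg_mulmx _ _ (nbhs u)).
    exact: jacobian_continuous sphi _.
  exact: cvg_cst.
have c2 : \det (jac phi' w' *m L) @[w' --> u'] --> \det (jac phi' u' *m L).
  apply: (@cvg_det _ _ (nbhs u')); apply: (@cvg_mulmx _ _ (nbhs u')).
    exact: jacobian_continuous sphi' _.
  exact: cvg_cst.
have n1 : \forall w \near u, 0 < \det (jac phi w *m L).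
  by apply: (cvgr_gt _ c1); rewrite JL det1.
have n2 : \forall w' \near u', 0 < (-1) ^+ b * \det (jac phi' w' *m L).
  apply: (@cvgr_gt _ _ (nbhs u') _ _ ((-1) ^+ b * \det (jac phi' u' *m L))).
    by apply: cvgM => //; exact: cvg_cst.
  by rewrite J -mulmxA JL mulmx1.
have nV : nbhs u V by exact: open_nbhs_nbhs.
have nV' : nbhs u' V' by exact: open_nbhs_nbhs.
have tr := param_transition pphi' pphi V'u' Vu e
  (@filterI _ _ (nbhs_filter u') _ _ n2 nV').
have := @filterI _ _ (nbhs_filter u) _ _ n1 (@filterI _ _ (nbhs_filter u) _ _ nV tr).
apply: (@filterS _ _ (nbhs_filter u)) => w [d1 [Vw [w' [[d2 _] V'w' ew]]]].
have [M' uM' JM'] := param_tangent pphi pphi' Vw V'w' (esym ew).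
exists V', phi', w', M'; split=> //.
move: d2; rewrite JM' -mulmxA det_mulmx mulrA mulrC.
by rewrite pmulr_rgt0.
Qed.

Lemma orientation_sign_constant V phi :
  local_parametrization S V phi -> connected V ->
  exists b, forall u, V u -> orientation_sign phi u b.
Proof.
move=> pphi cV; have [[u0 Vu0]|] := pselect (exists u0, V u0); last first.
  by move=> nV; exists false => u Vu; case: nV; exists u.
have [b hb] := orientation_sign_total pphi Vu0; exists b => u Vu.
apply: (@connected_locally_constant _ V
  (fun u => orientation_sign phi u b) cV _ u0 u Vu0 Vu hb) => w Vw.
have [b' hb'] := orientation_sign_total pphi Vw.
have := orientation_sign_open pphi Vw hb'.
apply: (@filterS _ _ (nbhs_filter w)) => w' hw' Vw'; split=> h.
  by rewrite (orientation_sign_unique pphi Vw' h hw').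
by rewrite (orientation_sign_unique pphi Vw h hb').
Qed.

Lemma oriented_frameP V phi u b : local_parametrization S V phi -> V u ->
  orientation_sign phi u b -> forall F, oriented_frame S (phi u) F <->
    exists2 M, 0 < (-1) ^+ b * \det M & F = M *m jac phi u.
Proof.
move=> pphi Vu [V' [phi' [u' [M' [a' V'u' e J dM']]]]] F.
split=> [[V1 [phi1 [u1 [M [a1 V1u1 e1 dM ->]]]]]|[M dM ->]].
  have [P dP JP] := atlas_jac a1 a' V1u1 V'u' (etrans e1 (esym e)).
  exists (M *m P *m M'); last by rewrite -jacE JP J !mulmxA.
  by rewrite !det_mulmx mulrCA pmulr_rgt0 // mulr_gt0.
have uM' : M' \in unitmx.
  by rewrite unitmxE unitfE; apply: contraTneq dM' => ->; rewrite mulr0 ltxx.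
exists V', phi', u', (M *m invmx M'); split=> //; last first.
  by rewrite -jacE J !mulmxA mulmxKV.
rewrite det_mulmx det_inv mulrC (sign_mul_gt0 _ (b := b)) //.
by move: dM'; rewrite -[X in 0 < X -> _]invrK invr_gt0 invfM invr_sign.
Qed.

(** The projected sheet [proj \o phi] determines the conormals up to a sign
    that is constant along a connected parameter domain. *)
Lemma conormalP V phi u b : local_parametrization S V phi -> V u ->
  orientation_sign phi u b -> let G := jac phi u *m pid_mx 3 : 'M[R]_(2, 3) in
  forall v, conormal S (phi u) v <->
    v *m G^T = 0 /\ 0 < (-1) ^+ b * \det (col_mx v G : 'M[R]_3).
Proof.
move=> pphi Vu ob G v.
have fr := oriented_frameP pphi Vu ob.
have detM (M : 'M[R]_2) :
    \det (col_mx v (M *m G) : 'M[R]_3) = \det M * \det (col_mx v G : 'M[R]_3).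
  have := @det_mulmx R (1 + 2) (block_mx 1%:M 0 0 M) (col_mx v G).
  by rewrite det_ublock det1 mul1r mul_block_col mul1mx !mul0mx addr0 add0r.
split=> [[F [/fr[M dM ->]]]|[v0 dv]].
  rewrite -mulmxA -/G trmx_mul mulmxA => vG.
  rewrite detM => d; split; last by rewrite -(sign_mul_gt0 _ dM).
  have uM : M^T \in unitmx.
    rewrite unitmx_tr unitmxE unitfE.
    by apply: contraTneq dM => ->; rewrite mulr0 ltxx.
  by rewrite -[LHS](mulmxK uM) vG mul0mx.
have [V' [phi' [u' [M [a' V'u' e J dM]]]]] := ob.
exists (M *m jac phi u); split.
- by apply/fr; exists M.
- by rewrite -mulmxA -/G trmx_mul mulmxA v0 mul0mx.
- by rewrite -mulmxA -/G detM (sign_mul_gt0 _ dM).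
Qed.

End Orientation.

(** * Charts in which the sheets are coordinate planes *)

Lemma det3E (R : comPzRingType) (M : 'M[R]_3) : let m i j := M (inord i) (inord j) in
  \det M = m 0%N 0%N * (m 1%N 1%N * m 2%N 2%N - m 1%N 2%N * m 2%N 1%N)
         - m 0%N 1%N * (m 1%N 0%N * m 2%N 2%N - m 1%N 2%N * m 2%N 0%N)
         + m 0%N 2%N * (m 1%N 0%N * m 2%N 1%N - m 1%N 1%N * m 2%N 0%N).
Proof.
move=> m.
have me (i j : 'I_3) : M i j = m i j by rewrite /m !inord_val.
rewrite (expand_det_row _ ord0) !big_ord_recl big_ord0 /cofactor.
rewrite !(expand_det_row _ ord0) !big_ord_recl !big_ord0 /cofactor !det_mx11 !mxE !me /=.
rewrite /bump /=; ring.
Qed.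

Definition plane_mx (R : pzRingType) (i : 'I_3) : 'M[R]_(2, 3) :=
  \matrix_(l, j) (j == lift i l)%:R.
Arguments plane_mx {R}.

Section Plane.
Context {R : realType}.
Implicit Types (i j : 'I_3) (z : 'rV[R]_3) (u : 'rV[R]_2).

Lemma plane_sheetE i u : plane_sheet i u = u *m plane_mx i.
Proof.
apply/rowP => j; rewrite !mxE; case: unliftP => [l ->|->].
  rewrite (bigD1 l) //= mxE eqxx mulr1 big1 ?addr0 // => l' ll'.
  by rewrite mxE (inj_eq (@lift_inj _ _)) eq_sym (negPf ll') mulr0.
by rewrite big1 // => l _; rewrite mxE (negPf (neq_lift _ _)) mulr0.
Qed.

Lemma plane_mx_trE i z l : (z *m (plane_mx i)^T) 0 l = z 0 (lift i l).
Proof.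
rewrite mxE (bigD1 (lift i l)) //= !mxE eqxx mulr1 big1 ?addr0 // => j jl.
by rewrite !mxE (negPf jl) mulr0.
Qed.

Lemma plane_mxE i u j : (u *m plane_mx i) 0 j = if unlift i j is Some l then u 0 l else 0.
Proof. by rewrite -plane_sheetE mxE. Qed.

Lemma plane_mxK i u : u *m plane_mx i *m (plane_mx i)^T = u.
Proof. by apply/rowP => l; rewrite plane_mx_trE plane_mxE liftK. Qed.

Lemma plane_mx0 i u : (u *m plane_mx i) 0 i = 0.
Proof. by rewrite plane_mxE unlift_none. Qed.

Lemma plane_mx_trK i z : z 0 i = 0 -> z *m (plane_mx i)^T *m plane_mx i = z.
Proof.
move=> zi; apply/rowP => j; rewrite plane_mxE.
by case: unliftP => [l ->|->]; rewrite ?plane_mx_trE.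
Qed.

Lemma cube_plane_tr i z : cube R 3 z -> cube R 2 (z *m (plane_mx i)^T).
Proof. by move=> cz l; rewrite plane_mx_trE. Qed.

Lemma det_col_plane_mx i z :
  \det (col_mx z (plane_mx i) : 'M[R]_3) = (-1) ^+ i * z 0 i.
Proof.
have r0 : (inord 0 : 'I_(1 + 2)) = lshift 2 ord0 by apply/val_inj; rewrite /= inordK.
have r1 : (inord 1 : 'I_(1 + 2)) = rshift 1 ord0 by apply/val_inj; rewrite /= inordK.
have r2 : (inord 2 : 'I_(1 + 2)) = rshift 1 ord_max by apply/val_inj; rewrite /= inordK.
rewrite det3E /= r0 r1 r2 !(@col_mxEu R 1 2) !(@col_mxEd R 1 2) !mxE.
rewrite -!val_eqE /= /bump.
case: i => -[|[|[|//]]] i3; rewrite /= -?r0 -?r1 -?r2 ?inordK //=.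
- rewrite (_ : inord 0 = Ordinal i3); first by ring.
  by apply/val_inj; rewrite /= inordK.
- rewrite (_ : inord 1 = Ordinal i3); first by ring.
  by apply/val_inj; rewrite /= inordK.
- rewrite (_ : inord 2 = Ordinal i3); first by ring.
  by apply/val_inj; rewrite /= inordK.
Qed.

End Plane.

Lemma proj_height_inj (R : realType) (x x' : 'rV[R]_4) :
  proj x = proj x' -> height x = height x' -> x = x'.
Proof.
move=> e eh; apply/rowP => j; have [j3|] := ltnP j 3; last first.
  move=> j3; rewrite /height in eh; have -> : j = ord_max; last by [].
  by apply/val_inj/eqP; rewrite eqn_leq j3 -ltnS ltn_ord.
have pE (w : 'rV[R]_4) : proj w 0 (Ordinal j3) = w 0 j.
  rewrite mxE (bigD1 j) //= mxE eqxx j3 mulr1 big1 ?addr0 // => k kj.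
  by rewrite mxE /= (negPf (_ : val k != val j)) ?mulr0.
by rewrite -!pE e.
Qed.

(** Coordinates near a point where the diagram consists of [n] coordinate
    planes; [sheet i z] is the point of the surface over a point [z] of the
    [i]-th plane, and [side i] records whether the co-orientation of this plane
    is opposite to the [i]-th coordinate direction. The sheets are indexed by
    all three coordinates, whatever [n] is; the indices from [n] on carry no
    sheet. *)
Record plane_chart (R : realType) (S : oriented_closed_surface R) (n : nat) :=
  PlaneChart {
  dom : set 'rV[R]_3;
  co : 'rV[R]_3 -> 'rV[R]_3;
  pt : 'rV[R]_3 -> 'rV[R]_3;
  sheet : 'I_3 -> 'rV[R]_3 -> 'rV[R]_4;
  side : 'I_3 -> bool;
  orient : bool;
  dom_open : open dom;
  co_cube : forall q, dom q -> cube R 3 (co q) /\ pt (co q) = q;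
  pt_dom : forall z, cube R 3 z -> dom (pt z) /\ co (pt z) = z;
  co_diff : forall q, dom q -> differentiable co q;
  pt_diff : forall z, cube R 3 z -> differentiable pt z;
  sheetP : forall (i : 'I_3) z, (i < n)%N -> cube R 3 z -> z 0 i = 0 ->
    carrier S (sheet i z) /\ proj (sheet i z) = pt z;
  sheet_cover : forall x, carrier S x -> dom (proj x) -> exists i : 'I_3,
    [/\ (i < n)%N, co (proj x) 0 i = 0 & x = sheet i (co (proj x))];
  sheet_inj : forall (i j : 'I_3) z, (i < n)%N -> (j < n)%N -> cube R 3 z ->
    z 0 i = 0 -> z 0 j = 0 -> sheet i z = sheet j z -> i = j;
  sheet_order : forall (i j : 'I_3) z z', (i < n)%N -> (j < n)%N ->
    cube R 3 z -> z 0 i = 0 -> z 0 j = 0 ->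
    cube R 3 z' -> z' 0 i = 0 -> z' 0 j = 0 ->
    height (sheet i z) < height (sheet j z) ->
    height (sheet i z') < height (sheet j z');
  sheet_conormal : forall (i : 'I_3) z, (i < n)%N -> cube R 3 z -> z 0 i = 0 ->
    forall v, conormal S (sheet i z) v <-> exists2 a, 0 < a &
      v = ((-1) ^+ side i * a) *: (col i (jac co (pt z)))^T;
  pt_orient : forall z, cube R 3 z -> 0 < (-1) ^+ orient * \det (jac pt z)
}.

Lemma cube_open (R : realType) n : open (cube R n).
Proof.
have -> : cube R n = ball (0 : 'rV[R]_n) 1.
  apply/seteqP; split=> u; rewrite -ball_normE /= sub0r normrN.
    by move=> cu; apply/mx_norm_ltP => // i j; rewrite ord1.
  by move=> /mx_norm_ltP h j; apply: h.
exact: ball_open.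
Qed.

Section Diffeomorphism.
Context {R : realType} n (W : set 'rV[R]_n) (h g : 'rV[R]_n -> 'rV[R]_n).
Hypothesis sh : smooth_on W h.
Hypothesis sg : smooth_on (cube R n) g.
Hypothesis hg : forall q, W q -> cube R n (h q) /\ g (h q) = q.
Hypothesis gh : forall z, cube R n z -> W (g z) /\ h (g z) = z.

Lemma jac_invK z : cube R n z -> jac g z *m jac h (g z) = 1%:M.
Proof.
move=> cz; have [Wg _] := gh cz; apply: jacobian_left_inverse.
- exact: (sg [::] cz).
- exact: (sh [::] Wg).
- near=> w; apply: (proj2 (gh _)); near: w; apply: open_nbhs_nbhs; split => //; exact: cube_open.
Unshelve. all: by end_near. Qed.

Lemma det_jac_sign : exists b : bool, forall z, cube R n z ->
  0 < (-1) ^+ b * \det (jac g z).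
Proof.
have nz z : cube R n z -> \det (jac g z) != 0.
  move=> cz; rewrite -unitfE -unitmxE; have := mulmx1_unit (jac_invK cz).
  by case.
exists (~~ (0 < \det (jac g 0))) => z cz.
have c0 := @cube0 R n.
have e : (0 < \det (jac g 0)) = (0 < \det (jac g z)).
  apply: (constant_sign (f := fun z => \det (jac g z)) (@cube_connected R n)) => //.
  move=> w cw; apply: (@cvg_det _ _ (nbhs w)).
  exact: jacobian_continuous (@cube_open R n) sg cw.
rewrite e; have := nz z cz; case: (ltgtP 0 (\det (jac g z))) => //= dz _.
  by rewrite expr0 mul1r.
by rewrite expr1 mulN1r oppr_gt0.
Qed.

End Diffeomorphism.

Section Sheets.
Context {R : realType} (S : oriented_closed_surface R).
Context (W : set 'rV[R]_3) (h g : 'rV[R]_3 -> 'rV[R]_3).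
Context (phi : 'rV[R]_2 -> 'rV[R]_4).
Hypothesis sh : smooth_on W h.
Hypothesis sg : smooth_on (cube R 3) g.
Hypothesis hg : forall q, W q -> cube R 3 (h q) /\ g (h q) = q.
Hypothesis gh : forall z, cube R 3 z -> W (g z) /\ h (g z) = z.
Hypothesis pphi : local_parametrization S (cube R 2) phi.

Let oriented_phi : exists b : bool, forall u, cube R 2 u -> orientation_sign S phi u b :=
  orientation_sign_constant pphi (@cube_connected R 2).

(** The projected sheet is [g \o m], which determines its tangent planes. *)
Lemma jac_sheet (m : 'rV[R]_2 -> 'rV[R]_3) u :
  (forall u, cube R 2 u -> W (proj (phi u)) /\ h (proj (phi u)) = m u) ->
  cube R 2 u -> differentiable m u ->
  jac phi u *m pid_mx 3 = jac m u *m jac g (m u).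
Proof.
move=> pm cu dm; have dphi := param_differentiable pphi cu.
have [Wu mu] := pm u cu; have [cm gm] := hg Wu; rewrite mu in cm gm.
have dg : differentiable g (m u) := sg [::] cm.
have [dp jp] := mulmx_diff (pid_mx 3 : 'M[R]_(4, 3)) (phi u).
rewrite -[in LHS]jp -(jacobian_comp dphi dp) -(jacobian_comp dm dg).
apply: near_jacobian; last 2 first.
- exact: differentiable_comp.
- exact: differentiable_comp.
near=> w; rewrite /=.
have cw : cube R 2 w.
  by near: w; apply: open_nbhs_nbhs; split => //; exact: cube_open.
by have [Ww mw] := pm w cw; rewrite -mw; have [_ ->] := hg Ww.
Unshelve. all: by end_near. Qed.

(** The differential of the [i]-th coordinate vanishes on the [i]-th sheet, so
    it is a conormal up to a nonzero factor. The sign of this factor is composed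
    of the orientation signs of [phi] and of the coordinates, both constant on
    the cube, and of the position [i] of the omitted coordinate. *)
Lemma plane_conormal (i : 'I_3) :
  (forall u, cube R 2 u ->
     W (proj (phi u)) /\ h (proj (phi u)) = plane_sheet i u) ->
  exists s : bool, forall z, cube R 3 z -> z 0 i = 0 ->
    forall v, conormal S (phi (z *m (plane_mx i)^T)) v <-> exists2 a, 0 < a &
      v = ((-1) ^+ s * a) *: (col i (jac h (g z)))^T.
Proof.
move=> pm; have [b hb] := oriented_phi.
have [d hd] := det_jac_sign sh sg gh.
exists (b (+) d (+) odd i) => z cz zi v.
set u := z *m _; have cu : cube R 2 u by exact: cube_plane_tr.
have uz : u *m plane_mx i = z by exact: plane_mx_trK.
have pm' w : cube R 2 w -> W (proj (phi w)) /\ h (proj (phi w)) = w *m plane_mx i.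
  by move=> /pm; rewrite plane_sheetE.
have [dm jm] := mulmx_diff (plane_mx i : 'M[R]_(2, 3)) u.
have := jac_sheet pm' cu dm; rewrite jm uz.
have AH := jac_invK sh sg gh cz; have HA := mulmx1C AH.
have {hd} := hd z cz.
move: (jac g z) (jac h (g z)) AH HA => A H AH HA hd eG.
have := conormalP pphi cu (hb u cu) v; rewrite eG => ->.
have detH (w : 'rV[R]_3) : \det (col_mx w (plane_mx i *m A) : 'M[R]_3) =
    (-1) ^+ i * (w *m H) 0 i * \det A.
  rewrite -det_col_plane_mx -(det_mulmx (col_mx (w *m H) (plane_mx i) : 'M[R]_3)).
  by rewrite [X in _ = \det X](@mul_col_mx _ 1 2 3 3) -mulmxA HA mulmx1.
(* [C] is the differential of the [i]-th coordinate, and every vector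
   orthogonal to the sheet is a multiple [l *: C] of it. *)
set C := (col i H)^T.
have CE : C = delta_mx 0 i *m H^T by rewrite /C tr_col rowE.
have CC : 0 < (C *m H) 0 i.
  have C0 : C != 0.
    apply/eqP => C0; have : C *m A^T = 0 by rewrite C0 mul0mx.
    rewrite CE -mulmxA -trmx_mul AH trmx1 mulmx1 => /rowP /(_ i).
    by rewrite !mxE !eqxx => /eqP; rewrite oner_eq0.
  have -> : (C *m H) 0 i = \sum_j (C 0 j) ^+ 2.
    by rewrite mxE; apply: eq_bigr => j _; rewrite !mxE expr2.
  rewrite lt_neqAle sumr_ge0 ?andbT => [|j _]; last exact: sqr_ge0.
  rewrite eq_sym; apply: contra C0 => /eqP s0; apply/eqP/rowP => j.
  apply/eqP; rewrite [X in _ == X]mxE -sqrf_eq0.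
  have /eqP := s0; rewrite psumr_eq0 => [/allP|k _]; last exact: sqr_ge0.
  by move=> /(_ j); rewrite mem_index_enum => /(_ isT).
have sgn (l : R) : (0 < (-1) ^+ b * \det (col_mx (l *: C) (plane_mx i *m A) : 'M[R]_3)) =
    (0 < (-1) ^+ (b (+) d (+) odd i) * l).
  rewrite detH -scalemxAl [X in _ * X * _]mxE !signr_addb signr_odd.
  have dA : \det A = (-1) ^+ d * ((-1) ^+ d * \det A) by rewrite mulrA -signr_addb addbb mul1r.
  rewrite dA; set m := (-1) ^+ d * \det A.
  have -> : (-1) ^+ b * ((-1) ^+ i * (l * (C *m H) 0 i) * ((-1) ^+ d * m)) =
    ((-1) ^+ b * (-1) ^+ d * (-1) ^+ i * l) * ((C *m H) 0 i * m) by ring.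
  by rewrite pmulr_lgt0 // mulr_gt0.
split=> [[vG dv]|[a a0 ->]].
  have [l vl] : exists l, v = l *: C.
    exists ((v *m A^T) 0 i).
    have e : v *m A^T = (v *m A^T) 0 i *: delta_mx 0 i.
      apply/rowP => j; rewrite !mxE eqxx; case: (unliftP i j) => [k ->|->].
        have := vG; rewrite trmx_mul mulmxA => /rowP /(_ k).
        rewrite plane_mx_trE [X in _ = X]mxE mxE => ->.
        by rewrite [lift _ _ == _]eq_sym (negPf (neq_lift _ _)) mulr0.
      by rewrite eqxx mulr1.
    by rewrite CE scalemxAl -e -mulmxA -trmx_mul HA trmx1 mulmx1.
  exists ((-1) ^+ (b (+) d (+) odd i) * l).
    by rewrite -sgn -vl.
  by rewrite mulrA -signr_addb addbb mul1r.
split; last by rewrite sgn mulrA -signr_addb addbb mul1r.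
rewrite -scalemxAl CE trmx_mul -!mulmxA (mulmxA H^T) -trmx_mul AH trmx1 mul1mx.
rewrite (_ : _ *m _ = 0) ?scaler0 //; apply/rowP => k.
by rewrite plane_mx_trE !mxE eqxx /= [lift _ _ == _]eq_sym (negPf (neq_lift _ _)).
Qed.

End Sheets.

Lemma height_continuous (R : realType) : continuous (@height R).
Proof. by move=> x; exact: coord_continuous. Qed.

(** The order of two sheets does not change along the connected set where they
    meet, because sheets of equal height over the same point coincide. *)
Lemma plane_chart_exists (R : realType) (S : oriented_closed_surface R)
    (y : 'rV[R]_3) (n : nat) : (0 < n <= 3)%N ->
  local_form S y (fun i : 'I_n => @plane_sheet R (inord i)) ->
  exists ch : plane_chart S n, dom ch y /\ co ch y = 0.
Proof.
move=> n03 [W [h [phi [[oW _ sh [g [sg hg gh]]] [Wy hy] pphi mphi cov]]]].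
pose psi (i : 'I_3) := if insub (val i) is Some j then phi j else fun=> 0.
have psiE (i : 'I_3) : (i < n)%N -> exists j : 'I_n,
    [/\ psi i = phi j, inord j = i & val j = i].
  move=> i_n; exists (Ordinal i_n); rewrite /psi insubT; split=> //.
  by apply/val_inj; rewrite /= inordK.
have ppsi (i : 'I_3) : (i < n)%N -> local_parametrization S (cube R 2) (psi i).
  by move=> /psiE[j [-> _ _]].
have mpsi (i : 'I_3) u : (i < n)%N -> cube R 2 u ->
    W (proj (psi i u)) /\ h (proj (psi i u)) = plane_sheet i u.
  by move=> /psiE[j [-> {2}<- _]]; exact: mphi.
have psi_inj (i j : 'I_3) u u' : (i < n)%N -> (j < n)%N -> cube R 2 u ->
    cube R 2 u' -> psi i u = psi j u' -> i = j.
  move=> /[dup] i_n /psiE[i' [ei _ vi]] /psiE[j' [ej _ vj]] cu cu' e.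
  have [Wu _] := mpsi i u i_n cu.
  have [k [_ ku]] := cov _ (param_mem (ppsi i i_n) cu) Wu.
  apply/val_inj; rewrite /= -vi -vj; congr val.
  rewrite -(ku i') ?(ku j') //; first by exists u'; rewrite // -ej -e.
  by exists u; rewrite // -ei.
have /choice[s hs] (i : 'I_3) : exists s : bool, (i < n)%N ->
    forall z, cube R 3 z -> z 0 i = 0 ->
    forall v, conormal S (psi i (z *m (plane_mx i)^T)) v <-> exists2 a, 0 < a &
      v = ((-1) ^+ s * a) *: (col i (jac h (g z)))^T.
  have [i_n|] := boolP (i < n)%N; last by exists false.
  have [s hs] := plane_conormal sh sg hg gh (ppsi i i_n) (fun u => mpsi i u i_n).
  by exists s.
have [d hd] := det_jac_sign sh sg gh.
pose sh_ i (z : 'rV[R]_3) := psi i (z *m (plane_mx i)^T).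
have shP (i : 'I_3) z : (i < n)%N -> cube R 3 z -> z 0 i = 0 ->
    carrier S (sh_ i z) /\ proj (sh_ i z) = g z.
  move=> i_n cz zi; have cu := cube_plane_tr i cz; split.
    exact: param_mem (ppsi i i_n) cu.
  have [Wp e] := mpsi i _ i_n cu; have [_ ge] := hg _ Wp.
  by rewrite /sh_ -ge e plane_sheetE plane_mx_trK.
have sh_inj (i j : 'I_3) z : (i < n)%N -> (j < n)%N -> cube R 3 z ->
    z 0 i = 0 -> z 0 j = 0 -> sh_ i z = sh_ j z -> i = j.
  by move=> i_n j_n cz zi zj; apply: psi_inj => //; exact: cube_plane_tr.
have sh_cont (i : 'I_3) z : (i < n)%N -> cube R 3 z ->
    {for z, continuous (fun z => height (sh_ i z))}.
  move=> i_n cz; apply: (continuous_comp (f := sh_ i) (g := @height R)); last first.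
    exact: height_continuous.
  apply: (continuous_comp (f := fun z : 'rV[R]_3 => z *m (plane_mx i)^T)).
    exact: mulmx_continuous.
  by apply: differentiable_continuous; apply: param_differentiable (ppsi i i_n) _;
    exact: cube_plane_tr.
have sh_order (i j : 'I_3) z z' : (i < n)%N -> (j < n)%N ->
    cube R 3 z -> z 0 i = 0 -> z 0 j = 0 ->
    cube R 3 z' -> z' 0 i = 0 -> z' 0 j = 0 ->
    height (sh_ i z) < height (sh_ j z) -> height (sh_ i z') < height (sh_ j z').
  move=> i_n j_n cz zi zj cz' z'i z'j.
  rewrite -subr_gt0 -[height (sh_ i z') < _]subr_gt0.
  have [<-|ij] := eqVneq i j; first by rewrite !subrr.
  pose A := [set z : 'rV[R]_3 | [/\ cube R 3 z, z 0 i = 0 & z 0 j = 0]].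
  rewrite (@constant_sign R _ A (fun z => height (sh_ j z) - height (sh_ i z)) _ _ _ z z') //.
  - apply: (@star_connected _ _ _ 0) => w t [cw wi wj] t01.
    rewrite add0r subr0; split=> [k||]; rewrite ?mxE ?wi ?wj ?mulr0 //.
    rewrite normrM; apply: le_lt_trans (cw k).
    by rewrite ler_piMl // ger0_norm; case/andP: t01.
  - by move=> w [cw wi wj]; exact: (cvgB (sh_cont j w j_n cw) (sh_cont i w i_n cw)).
  move=> w [cw wi wj]; rewrite subr_eq0; apply: contra ij => /eqP e.
  apply/eqP; apply: (sh_inj i j w) => //; apply: proj_height_inj => //.
  by rewrite (shP i w i_n cw wi).2 (shP j w j_n cw wj).2.
have sh_cover x : carrier S x -> W (proj x) -> exists i : 'I_3,
    [/\ (i < n)%N, h (proj x) 0 i = 0 & x = sh_ i (h (proj x))].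
  move=> Sx Wx; have [j [[u cu ux] _]] := cov x Sx Wx.
  have j3 : (j < 3)%N by apply: leq_trans (ltn_ord j) _; case/andP: n03.
  have ej : psi (inord j) = phi j.
    have ej : val (inord j : 'I_3) = j by exact: inordK.
    by rewrite /psi ej (_ : insub (j : nat) = Some j) //; exact: valK.
  have j_n : ((inord j : 'I_3) < n)%N by rewrite inordK.
  exists (inord j); have [_] := mpsi (inord j) u j_n cu.
  rewrite ej ux plane_sheetE => hx; split=> //.
    by rewrite hx plane_mx0.
  by rewrite /sh_ hx plane_mxK ej.
exists (@PlaneChart R S n W h g sh_ s d oW hg gh (fun q => sh [::] q)
  (fun q => sg [::] q) shP sh_cover sh_inj sh_order (fun i z i_n => hs i i_n z) hd).
by split.
Qed.

Definition normal_plane_chart (R : realType) (S : oriented_closed_surface R) n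
    (ch : plane_chart S n) :=
  (forall i, side ch i = false) /\
  forall (i j : 'I_3) z, (i < j < n)%N -> cube R 3 z -> z 0 i = 0 -> z 0 j = 0 ->
    height (sheet ch i z) < height (sheet ch j z).

(** A permutation that maximizes [\sum_i i * f (s i)] sorts [f], because
    exchanging two values in the wrong order would increase this sum. *)
Lemma sorting_perm (R : realFieldType) n (f : 'I_3 -> R) :
  (forall i j : 'I_3, (i < n)%N -> (j < n)%N -> f i = f j -> i = j) ->
  exists s : 'S_3, (forall i : 'I_3, (s i < n)%N = (i < n)%N) /\
    forall i j : 'I_3, (i < j < n)%N -> f (s i) < f (s j).
Proof.
move=> finj.
pose P (s : 'S_3) := [forall i : 'I_3, (i < n)%N ==> (s i < n)%N].
pose wt (s : 'S_3) := \sum_(i < 3) (i : nat)%:R * f (s i).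
have P1 : P 1%g by apply/forallP => i; rewrite perm1; apply/implyP.
case: (Order.TotalTheory.arg_maxP wt P1) => s /forallP Ps smax.
exists s; split=> [i|i j /andP[ij j_n]].
  apply/idP/idP; last exact: implyP (Ps i).
  pose A := [set i : 'I_3 | (i < n)%N]%SET.
  have sA : (s @: A = A)%SET.
    apply/eqP; rewrite eqEcard card_imset ?leqnn ?andbT; last exact: perm_inj.
    apply/fintype.subsetP => _ /imsetP[k + ->]; rewrite !inE; exact: implyP (Ps k).
  move=> si; have : s i \in A by rewrite inE.
  by rewrite -sA (mem_imset _ _ perm_inj) inE.
have i_n := ltn_trans ij j_n.
have sij : s i != s j by rewrite (inj_eq perm_inj) -val_eqE neq_ltn ij.
rewrite ltNge; apply/negP => fij.
have {fij} fij : f (s j) < f (s i).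
  rewrite lt_neqAle fij andbT; apply: contra sij => /eqP e; apply/eqP/esym.
  by apply: finj e; apply: implyP (Ps _) _.
have /smax : P (tperm i j * s)%g.
  apply/forallP => k; apply/implyP => k_n; rewrite permM.
  by case: tpermP => [_|_|_ _]; apply: implyP (Ps _) _.
apply/negP; rewrite -ltNge /wt.
have ji : j != i by rewrite -val_eqE neq_ltn ij orbT.
rewrite (bigD1 i) //= (bigD1 j) //= [ltRHS](bigD1 i) //= [X in _ < _ + X](bigD1 j) //=.
rewrite !permM tpermL tpermR !addrA.
rewrite [X in _ < _ + X](eq_bigr (fun k : 'I_3 => (k : nat)%:R * f (s k))); last first.
  by move=> k /andP[ki kj]; rewrite permM tpermD // eq_sym.
rewrite ltrD2r.
have : 0 < ((j : nat)%:R - (i : nat)%:R) * (f (s i) - f (s j)).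
  by rewrite mulr_gt0 ?subr_gt0 // ltr_nat.
move: (f (s i)) (f (s j)) => a b; lra.
Qed.

Section Normalize.
Context {R : realType} (S : oriented_closed_surface R) (n : nat).
Variables (ch : plane_chart S n) (s : 'S_3).
Hypothesis sn : forall i : 'I_3, (s i < n)%N = (i < n)%N.
Hypothesis hs : forall i j : 'I_3, (i < j < n)%N ->
  height (sheet ch (s i) 0) < height (sheet ch (s j) 0).

(** The signed permutation matrix that renumbers the coordinates by [s] and
    reverses those opposite to the co-orientation. *)
Let M : 'M[R]_3 := \matrix_(j, i) (if j == s i then (-1) ^+ side ch j else 0).

Let mulM (z : 'rV[R]_3) i : (z *m M) 0 i = (-1) ^+ side ch (s i) * z 0 (s i).
Proof.
rewrite mxE (bigD1 (s i)) //= mxE eqxx mulrC big1 ?addr0 // => j ji.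
by rewrite mxE (negPf ji) mulr0.
Qed.

Let mulMT (z : 'rV[R]_3) i : (z *m M^T) 0 (s i) = (-1) ^+ side ch (s i) * z 0 i.
Proof.
rewrite mxE (bigD1 i) //= !mxE eqxx mulrC big1 ?addr0 // => j ji.
by rewrite !mxE (inj_eq perm_inj) eq_sym (negPf ji) mulr0.
Qed.

Let MTM : M^T *m M = 1%:M.
Proof.
apply/matrixP => i j; rewrite mxE (bigD1 (s i)) //= !mxE eqxx (inj_eq perm_inj).
rewrite big1 ?addr0 => [|k ki]; last by rewrite !mxE (negPf ki) mul0r.
by case: eqVneq => _; rewrite ?mulr0 // -signr_addb addbb.
Qed.

Let MMT : M *m M^T = 1%:M. Proof. exact: mulmx1C MTM. Qed.

Let cubeM z : cube R 3 z -> cube R 3 (z *m M).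
Proof. by move=> cz j; rewrite mulM normrM normr_sign mul1r. Qed.

Let cubeMT z : cube R 3 z -> cube R 3 (z *m M^T).
Proof.
by move=> cz j; rewrite -(permKV s j) mulMT normrM normr_sign mul1r.
Qed.

Let coM q := co ch q *m M.
Let invM z := pt ch (z *m M^T).
Let sheetM i z := sheet ch (s i) (z *m M^T).

Let zeroM (z : 'rV[R]_3) i : z 0 i = 0 -> (z *m M^T) 0 (s i) = 0.
Proof. by move=> zi; rewrite mulMT zi mulr0. Qed.

Let jac_coM q : dom ch q -> jac coM q = jac (co ch) q *m M.
Proof.
move=> dq; have [dm jm] := mulmx_diff M (co ch q).
by rewrite -[in RHS]jm -(jacobian_comp (co_diff dq) dm).
Qed.

Let jac_invM z : cube R 3 z -> jac invM z = M^T *m jac (pt ch) (z *m M^T).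
Proof.
move=> cz; have [dm jm] := mulmx_diff M^T z.
by rewrite -[X in X *m _]jm -(jacobian_comp dm (pt_diff ch (cubeMT cz))).
Qed.

Lemma normalize_plane_chart : exists ch' : plane_chart S n,
  [/\ normal_plane_chart ch', dom ch' = dom ch &
      forall q, co ch q = 0 -> co ch' q = 0].
Proof.
have p1 : open (dom ch) by exact: dom_open.
have p2 q : dom ch q -> cube R 3 (coM q) /\ invM (coM q) = q.
  move=> /co_cube[cq iq]; split; first exact: cubeM.
  by rewrite /invM /coM -mulmxA MMT mulmx1.
have p3 z : cube R 3 z -> dom ch (invM z) /\ coM (invM z) = z.
  move=> cz; have [di ci] := pt_dom ch (cubeMT cz); split=> //.
  by rewrite /coM ci -mulmxA MTM mulmx1.
have p4 q : dom ch q -> differentiable coM q.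
  move=> dq; have [dm _] := mulmx_diff M (co ch q).
  exact: differentiable_comp (co_diff dq) dm.
have p5 z : cube R 3 z -> differentiable invM z.
  move=> cz; have [dm _] := mulmx_diff M^T z.
  exact: differentiable_comp dm (pt_diff ch (cubeMT cz)).
have p6 (i : 'I_3) z : (i < n)%N -> cube R 3 z -> z 0 i = 0 ->
    carrier S (sheetM i z) /\ proj (sheetM i z) = invM z.
  by move=> i_n cz zi; apply: sheetP; [rewrite sn|exact: cubeMT|exact: zeroM].
have p7 x : carrier S x -> dom ch (proj x) -> exists i : 'I_3,
    [/\ (i < n)%N, coM (proj x) 0 i = 0 & x = sheetM i (coM (proj x))].
  move=> Sx dx; have [i [i_n ci ex]] := sheet_cover Sx dx.
  pose j := (s^-1)%g i; have sj : s j = i by rewrite permKV.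
  exists j; rewrite /sheetM /coM -mulmxA MMT mulmx1 mulM sj ci mulr0; by split=> //; rewrite -sn sj.
have p8 (i j : 'I_3) z : (i < n)%N -> (j < n)%N -> cube R 3 z ->
    z 0 i = 0 -> z 0 j = 0 -> sheetM i z = sheetM j z -> i = j.
  move=> i_n j_n cz zi zj e; apply: (@perm_inj _ s).
  by apply: sheet_inj e; [by rewrite sn|by rewrite sn|exact: cubeMT|exact: zeroM|exact: zeroM].
have p9 (i j : 'I_3) z z' : (i < n)%N -> (j < n)%N ->
    cube R 3 z -> z 0 i = 0 -> z 0 j = 0 ->
    cube R 3 z' -> z' 0 i = 0 -> z' 0 j = 0 ->
    height (sheetM i z) < height (sheetM j z) ->
    height (sheetM i z') < height (sheetM j z').
  move=> i_n j_n cz zi zj cz' z'i z'j.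
  apply: sheet_order; rewrite ?sn //; try exact: cubeMT; exact: zeroM.
have p10 (i : 'I_3) z : (i < n)%N -> cube R 3 z -> z 0 i = 0 ->
    forall v, conormal S (sheetM i z) v <-> exists2 a, 0 < a &
      v = ((-1) ^+ false * a) *: (col i (jac coM (invM z)))^T.
  move=> i_n cz zi v.
  rewrite (sheet_conormal ch (_ : (s i < n)%N) (cubeMT cz) (zeroM zi)) ?sn //.
  have [di _] := p3 z cz; rewrite jac_coM // expr0.
  suff -> : col i (jac (co ch) (invM z) *m M) =
      (-1) ^+ side ch (s i) *: col (s i) (jac (co ch) (invM z)).
    split=> -[a a0 ->]; exists a => //.
      by rewrite mul1r linearZ /= scalerA mulrC.
    by rewrite mul1r linearZ /= scalerA mulrC.
  apply/colP => k; rewrite !mxE (bigD1 (s i)) //= mxE eqxx mulrC big1 ?addr0 //.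
  by move=> j ji; rewrite mxE (negPf ji) mulr0.
have [d hd] : exists d : bool, forall z, cube R 3 z ->
    0 < (-1) ^+ d * \det (jac invM z).
  have : \det M != 0.
    rewrite -unitfE -unitmxE; by have := mulmx1_unit MMT; case.
  move=> dM; exists (orient ch (+) (\det M < 0)) => z cz.
  have := pt_orient ch (cubeMT cz); rewrite jac_invM // det_mulmx det_tr signr_addb.
  move: dM; move: (\det M) (\det (jac _ _)) => m x m0 x0.
  have -> : (-1) ^+ orient ch * (-1) ^+ (m < 0)%R * (m * x) =
    ((-1) ^+ orient ch * x) * ((-1) ^+ (m < 0)%R * m) :> R by ring.
  rewrite pmulr_rgt0 //; move: m0.
  case: (ltgtP m 0) => //= h _; first by rewrite expr1 mulN1r oppr_gt0.
  by rewrite expr0 mul1r.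
exists (@PlaneChart R S n (dom ch) coM invM sheetM (fun=> false) d
  p1 p2 p3 p4 p5 p6 p7 p8 p9 p10 hd); split=> //; last first.
  by move=> q q0; rewrite /= /coM q0 mul0mx.
split=> // i j z /andP[ij j_n] cz zi zj /=.
apply: (p9 i j 0 z) => //; rewrite ?(ltn_trans ij) ?mxE //; first exact: cube0.
by rewrite /sheetM mul0mx; apply: hs; rewrite ij.
Qed.

End Normalize.

Lemma normal_plane_chart_exists (R : realType) (S : oriented_closed_surface R)
    (y : 'rV[R]_3) (n : nat) : (0 < n <= 3)%N ->
  local_form S y (fun i : 'I_n => @plane_sheet R (inord i)) ->
  exists ch : plane_chart S n, [/\ normal_plane_chart ch, dom ch y & co ch y = 0].
Proof.
move=> n03 /(plane_chart_exists n03)[ch [dy cy]].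
have c0 := @cube0 R 3.
have [|s [sn hs]] := @sorting_perm R n (fun i => height (sheet ch i 0)).
  move=> i j i_n j_n e; have := @sheet_inj _ _ _ ch i j 0 i_n j_n c0; rewrite !mxE; apply=> //.
  apply: proj_height_inj e.
  by rewrite (sheetP ch i_n c0 _).2 ?(sheetP ch j_n c0 _).2 ?mxE.
have [ch' [nch' dE cE]] := normalize_plane_chart sn hs.
by exists ch'; rewrite dE; split=> //; exact: cE.
Qed.

(** * Regions near a point are octants *)

Section Octants.
Context {R : realType} (S : oriented_closed_surface R) (n : nat).
Variable ch : plane_chart S n.
Hypothesis nch : normal_plane_chart ch.
Implicit Types (i j : 'I_3) (z w q : 'rV[R]_3) (o : 'I_3 -> bool).

(** Coordinates that do not belong to a sheet are unconstrained, so for small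
    [n] this is a quarter or a half of the cube rather than an octant. *)
Definition octant o : set 'rV[R]_3 := [set z | cube R 3 z /\
  forall i, (i < n)%N -> 0 < (-1) ^+ (~~ o i) * z 0 i].

Definition octant_center o : 'rV[R]_3 := \row_i ((-1) ^+ (~~ o i) / 2).

Definition octant_region o : set 'rV[R]_3 :=
  connected_component (~` (@proj R @` S)) (pt ch (octant_center o)).

Lemma octant_centerP o : octant o (octant_center o).
Proof.
split=> [j|i _]; rewrite mxE; first by rewrite normrM normr_sign mul1r ger0_norm; lra.
by rewrite mulrA -signr_addb addbb mul1r; lra.
Qed.

Lemma octant_connected o : connected (octant o).
Proof.
have [cc oc] := octant_centerP o.
apply: (@star_connected _ _ _ (octant_center o)) => z t [cz oz] /andP[t0 t1].
set c := octant_center o in cc oc *.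
have E k : (c + t *: (z - c)) 0 k = (1 - t) * c 0 k + t * z 0 k.
  by rewrite !mxE; ring.
split=> [k|i i_n]; rewrite E.
  apply: le_lt_trans (ler_normD _ _) _; rewrite !normrM.
  rewrite (ger0_norm t0) ger0_norm ?subr_ge0 //.
  by have := cc k; have := cz k; move: (`|z 0 k|) (`|c 0 k|) => a b; case: (leP a b); nra.
rewrite mulrDr !(mulrCA ((-1) ^+ _)).
have := oc i i_n; have := oz i i_n.
move: (_ * z 0 i) (_ * c 0 i) => a b; case: (leP a b); nra.
Qed.

Lemma octant_free o z : octant o z -> (~` (@proj R @` S)) (pt ch z).
Proof.
move=> [cz oz] [x Sx px]; have [dz coz] := pt_dom ch cz.
have [|i [i_n zi _]] := @sheet_cover _ _ _ ch x Sx; first by rewrite px.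
by have := oz i i_n; rewrite px coz in zi; rewrite zi mulr0 ltxx.
Qed.

Lemma pt_continuous z : cube R 3 z -> {for z, continuous (pt ch)}.
Proof. by move=> cz; apply: differentiable_continuous; exact: pt_diff. Qed.

Lemma jac_ptK z : cube R 3 z ->
  jac (pt ch) z *m jac (co ch) (pt ch z) = 1%:M.
Proof.
move=> cz; have [dz _] := pt_dom ch cz.
apply: jacobian_left_inverse; [exact: pt_diff|exact: co_diff|].
near=> w; apply: (proj2 (pt_dom ch _)); near: w.
by apply: open_nbhs_nbhs; split=> //; exact: cube_open.
Unshelve. all: by end_near. Qed.

Lemma conormal_sheet i z v : (i < n)%N -> cube R 3 z -> z 0 i = 0 ->
  conormal S (sheet ch i z) v <->
    exists2 a, 0 < a & v = a *: (col i (jac (co ch) (pt ch z)))^T.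
Proof.
move=> i_n cz zi; rewrite (sheet_conormal ch i_n cz zi) (nch.1 i) expr0.
by split=> -[a a0 ->]; exists a => //; rewrite mul1r.
Qed.
Lemma pt_image_connected (A : set 'rV[R]_3) :
  connected A -> A `<=` cube R 3 -> connected (pt ch @` A).
Proof.
move=> cA Ac; apply: connected_continuous_connected => //.
by apply: continuous_in_subspaceT => z /set_mem /Ac; exact: pt_continuous.
Qed.

Lemma octant_regionP o z : octant o z -> octant_region o (pt ch z).
Proof.
move=> oz; apply: (@connected_component_max _ _ (pt ch @` octant o)).
- by exists (octant_center o) => //; exact: octant_centerP.
- by move=> _ [w ow <-]; exact: octant_free ow.
- by apply: pt_image_connected; [exact: octant_connected|move=> w []].
- by exists z.
Qed.

Lemma region_octant o : region S (octant_region o).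
Proof.
by exists (pt ch (octant_center o)) => //; exact: octant_free (octant_centerP o).
Qed.

Lemma region_unique (r r' : set 'rV[R]_3) p : region S r -> region S r' ->
  r p -> r' p -> r = r'.
Proof.
move=> [z _ ->] [z' _ ->] zp z'p.
by rewrite (same_connected_component zp) (same_connected_component z'p).
Qed.

Lemma eq_octant_region o o' : (forall i, (i < n)%N -> o i = o' i) ->
  octant_region o = octant_region o'.
Proof.
move=> eo; apply: (@region_unique _ _ (pt ch (octant_center o)));
  [exact: region_octant|exact: region_octant| |].
  by apply: octant_regionP; exact: octant_centerP.
apply: octant_regionP; have [c h] := octant_centerP o; split=> // i i_n.
by rewrite -eo //; exact: h.
Qed.

Lemma differentiable_coord_sign (f : 'rV[R]_3 -> 'rV[R]_3) q w i (b : bool) :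
  differentiable f q -> 0 < (-1) ^+ b * (w *m jac f q) 0 i ->
  \forall t \near 0^'+, 0 < (-1) ^+ b * (f (q + t *: w) 0 i - f q 0 i).
Proof.
move=> df; case: b; rewrite ?expr0 ?expr1 => h; last first.
  rewrite mul1r in h; have := differentiable_coord_incr df h.
  by apply: filterS => t; rewrite mul1r subr_gt0.
have [dm jm] := mulmx_diff (- 1%:M : 'M[R]_3) (f q).
have dg := differentiable_comp df dm.
have := @differentiable_coord_incr R 3 3 _ q w i dg.
rewrite (jacobian_comp df dm) jm mulmxN mulmx1 mulmxN mxE.
rewrite mulN1r in h; move=> /(_ h); apply: filterS => t /=.
by rewrite !mulmxN !mulmx1 !mxE ltrN2 mulN1r opprB subr_gt0.
Qed.

(** Starting at [pt ch z] in the direction [w], a vanishing coordinate takes the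
    sign of its derivative along [w], and the others keep their sign. *)
Lemma near_octant o z w : cube R 3 z ->
  (forall i, (i < n)%N -> z 0 i = 0 ->
    0 < (-1) ^+ (~~ o i) * (w *m jac (co ch) (pt ch z)) 0 i) ->
  (forall i, (i < n)%N -> z 0 i != 0 -> 0 < (-1) ^+ (~~ o i) * z 0 i) ->
  \forall t \near 0^'+, octant_region o (pt ch z + t *: w).
Proof.
move=> cz h0 h1; have [dz cpz] := pt_dom ch cz.
have dco := co_diff dz.
have cvw : pt ch z + t *: w @[t --> 0^'+] --> pt ch z.
  rewrite -[X in _ --> X]addr0; apply: cvgD; first exact: cvg_cst.
  exact: cvg_scale_right0.
have nd : \forall t \near 0^'+, dom ch (pt ch z + t *: w) :=
  cvw _ (open_nbhs_nbhs (conj (dom_open (p := ch)) dz)).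
have ni i : \forall t \near 0^'+, (i < n)%N ->
    0 < (-1) ^+ (~~ o i) * co ch (pt ch z + t *: w) 0 i.
  have [i_n|i_n] := boolP (i < n)%N; last by apply: nearW.
  have [zi|zi] := eqVneq (z 0 i) 0.
    have := differentiable_coord_sign dco (h0 i i_n zi).
    by apply: filterS => t; rewrite cpz zi subr0.
  have cvi : (-1) ^+ (~~ o i) * co ch (pt ch z + t *: w) 0 i @[t --> 0^'+] -->
      (-1) ^+ (~~ o i) * z 0 i.
    apply: cvgM; first exact: cvg_cst.
    apply: cvg_entry; rewrite -[X in _ --> X]cpz.
    exact: (cvg_comp _ _ cvw (differentiable_continuous dco)).
  have h := cvgr_gt _ cvi _ (h1 i i_n zi).
  by near=> t; move=> _; near: t; exact: h.
have na := @filter_forall _ _ _ _ (at_right_proper_filter 0) ni.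
near=> t.
have dt : dom ch (pt ch z + t *: w) by near: t.
have st : forall i : 'I_3, (i < n)%N ->
    0 < (-1) ^+ (~~ o i) * co ch (pt ch z + t *: w) 0 i.
  by near: t; exact: na.
have [ct et] := co_cube dt; rewrite -et; apply: octant_regionP; split=> // i i_n.
Unshelve. all: by end_near. Qed.

(** In a normal chart the sides of the sheets are signs of coordinates. Any
    prescribed signs are realized by a direction, the image of a vector of
    signs under the derivative of [pt ch]. *)
Lemma region_nearE o z sides : cube R 3 z ->
  (forall i, (i < n)%N -> z 0 i = 0 -> (sheet ch i z, o i) \in sides) ->
  (forall i, (i < n)%N -> z 0 i != 0 -> o i = (0 < z 0 i)) ->
  (forall p, p \in sides -> exists i,
     [/\ (i < n)%N, z 0 i = 0 & p = (sheet ch i z, o i)]) ->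
  forall r, region_near S (pt ch z) sides r <-> r = octant_region o.
Proof.
move=> cz in_sides oz sidesP r.
have hz i : (i < n)%N -> z 0 i != 0 -> 0 < (-1) ^+ (~~ o i) * z 0 i.
  move=> i_n zi; rewrite oz //; case: (ltgtP 0 (z 0 i)) zi => //= h _.
    by rewrite expr0 mul1r.
  by rewrite expr1 mulN1r oppr_gt0.
have dot i (w : 'rV[R]_3) a : (w *m (a *: (col i (jac (co ch) (pt ch z)))^T)^T) 0 0 =
    a * (w *m jac (co ch) (pt ch z)) 0 i.
  rewrite linearZ /= trmxK -scalemxAr mxE; congr (_ * _).
  by rewrite !mxE; apply: eq_bigr => k _; rewrite !mxE.
split=> [[rr [w [ws rw]]]|->].
  have h0 i : (i < n)%N -> z 0 i = 0 ->
      0 < (-1) ^+ (~~ o i) * (w *m jac (co ch) (pt ch z)) 0 i.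
    move=> i_n zi; have [v /(conormal_sheet v i_n cz zi)[a a0 ->]] := ws _ (in_sides i i_n zi).
    rewrite /= dot; case: (o i); rewrite ?expr0 ?expr1 ?mul1r ?mulN1r.
      by rewrite pmulr_rgt0.
    by rewrite pmulr_rlt0 // oppr_gt0.
  have [t [rt ot]] := filter_ex (filterI rw (near_octant cz h0 hz)).
  exact: (region_unique rr (@region_octant o) rt ot).
split; first exact: region_octant.
pose sg : 'rV[R]_3 := \row_i (-1) ^+ (~~ o i).
have wJ : sg *m jac (pt ch) z *m jac (co ch) (pt ch z) = sg.
  by rewrite -mulmxA jac_ptK // mulmx1.
exists (sg *m jac (pt ch) z); split.
  move=> p /sidesP[i [i_n zi ->]] /=.
  exists (1 *: (col i (jac (co ch) (pt ch z)))^T).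
    by apply/conormal_sheet => //; exists 1.
  rewrite dot wJ mxE mul1r; case: (o i) => /=; first by rewrite expr0 ltr01.
  by rewrite expr1 ltrN10.
apply: near_octant => // i i_n zi.
by rewrite wJ mxE -signr_addb addbb ltr01.
Qed.

Lemma preimageP z x : cube R 3 z -> carrier S x -> proj x = pt ch z ->
  exists i, [/\ (i < n)%N, z 0 i = 0 & x = sheet ch i z].
Proof.
move=> cz Sx px; have [dz cpz] := pt_dom ch cz.
have [|i [i_n zi ex]] := @sheet_cover _ _ _ ch x Sx; first by rewrite px.
by exists i; rewrite px cpz in zi ex.
Qed.

Lemma height_lt_sheet i j z : (i < n)%N -> (j < n)%N -> cube R 3 z ->
  z 0 i = 0 -> z 0 j = 0 -> height (sheet ch i z) < height (sheet ch j z) ->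
  (i < j)%N.
Proof.
move=> i_n j_n cz zi zj h; rewrite ltnNge leq_eqVlt; apply/negP => /orP[/eqP e|ji].
  by move: h; rewrite (val_inj e) ltxx.
have := nch.2 j i z; rewrite ji i_n => /(_ isT cz zj zi) /(lt_trans h).
by rewrite ltxx.
Qed.

Lemma double_point_sheets z xB xT : cube R 3 z ->
  double_point S (pt ch z) xB xT -> exists i j,
    [/\ (i < j < n)%N, z 0 i = 0, z 0 j = 0,
        xB = sheet ch i z /\ xT = sheet ch j z &
        forall k : 'I_3, (k < n)%N -> z 0 k = 0 -> k = i \/ k = j].
Proof.
move=> cz [hBT e].
have [SB pB] : (carrier S `&` @proj R @^-1` [set pt ch z]) xB by rewrite e; left.
have [ST pT] : (carrier S `&` @proj R @^-1` [set pt ch z]) xT by rewrite e; right.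
have [i [i_n zi eB]] := preimageP cz SB pB.
have [j [j_n zj eT]] := preimageP cz ST pT.
exists i, j; split=> //.
  by rewrite j_n andbT; apply: (@height_lt_sheet i j z) => //; rewrite -eB -eT.
move=> k k_n zk; have [Sk pk] := sheetP ch k_n cz zk.
have : [set xB; xT] (sheet ch k z) by rewrite -e.
rewrite eB eT => -[/esym ek|/esym ek]; [left|right].
  exact/esym/(sheet_inj i_n k_n cz zi zk ek).
exact/esym/(sheet_inj j_n k_n cz zj zk ek).
Qed.

Lemma sheets_double_point z i j : cube R 3 z -> (i < j < n)%N -> z 0 i = 0 ->
  z 0 j = 0 -> (forall k : 'I_3, (k < n)%N -> z 0 k = 0 -> k = i \/ k = j) ->
  double_point S (pt ch z) (sheet ch i z) (sheet ch j z).
Proof.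
move=> cz /[dup] ijn /andP[ij j_n] zi zj zk; have i_n := ltn_trans ij j_n.
split; first exact: nch.2.
apply/seteqP; split=> [x [Sx px]|x [->|->]]; last 2 first.
- exact: (sheetP ch i_n cz zi).
- exact: (sheetP ch j_n cz zj).
have [k [k_n z_k ->]] := preimageP cz Sx px.
by have [->|->] := zk k k_n z_k; [left|right].
Qed.

Lemma triple_point_sheets z xB xM xT : cube R 3 z ->
  triple_point S (pt ch z) xB xM xT ->
  [/\ (2 < n)%N, z = 0 & [/\ xB = sheet ch (inord 0) 0,
      xM = sheet ch (inord 1) 0 & xT = sheet ch (inord 2) 0]].
Proof.
move=> cz [hBM hMT e].
have P x : [set xB; xM; xT] x -> exists i,
    [/\ (i < n)%N, z 0 i = 0 & x = sheet ch i z].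
  by rewrite -e => -[Sx px]; exact: preimageP.
have [i [i_n zi eB]] : _ := P xB (or_introl (or_introl erefl)).
have [j [j_n zj eM]] : _ := P xM (or_introl (or_intror erefl)).
have [k [k_n zk eT]] : _ := P xT (or_intror erefl).
have ij : (i < j)%N by apply: (@height_lt_sheet i j z) => //; rewrite -eB -eM.
have jk : (j < k)%N by apply: (@height_lt_sheet j k z) => //; rewrite -eM -eT.
have k3 := ltn_ord k.
have ek : (k = 2 :> nat) by lia.
have ej : (j = 1 :> nat) by lia.
have ei : (i = 0 :> nat) by lia.
have Ei : inord 0 = i by apply/val_inj; rewrite /= inordK.
have Ej : inord 1 = j by apply/val_inj; rewrite /= inordK.
have Ek : inord 2 = k by apply/val_inj; rewrite /= inordK.
have z0 : z = 0.
  apply/rowP => l; rewrite mxE; have l3 := ltn_ord l.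
  have [->//|li] := eqVneq l i; have [->//|lj] := eqVneq l j.
  rewrite (_ : l = k) //; apply/val_inj; move: li lj; rewrite -!val_eqE /=; lia.
by rewrite Ei Ej Ek -z0; split=> //; lia.
Qed.

Lemma sheets_triple_point : (2 < n)%N ->
  triple_point S (pt ch 0) (sheet ch (inord 0) 0) (sheet ch (inord 1) 0)
    (sheet ch (inord 2) 0).
Proof.
move=> n2; have c0 := @cube0 R 3.
have z0 i : (0 : 'rV[R]_3) 0 i = 0 by rewrite mxE.
have Sx i : (i < n)%N -> (carrier S `&` @proj R @^-1` [set pt ch 0]) (sheet ch i 0).
  by move=> i_n; exact: (sheetP ch i_n c0 (z0 i)).
split; [by apply: nch.2; rewrite // !inordK //; lia..|].
apply/seteqP; split=> [x [Sx' px]|x [[->|->]|->]]; last 3 first.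
- by apply: Sx; rewrite inordK //; lia.
- by apply: Sx; rewrite inordK //; lia.
- by apply: Sx; rewrite inordK.
have [k [k_n _ ->]] := preimageP c0 Sx' px.
have -> : k = inord (val k) by rewrite inord_val.
by case: k {k_n} => -[|[|[|//]]] k3 /=; [left; left|left; right|right].
Qed.

End Octants.

(** * Colors of the edges at double and triple points *)

Definition flip2 (o : 'I_3 -> bool) (i j : 'I_3) (b b' : bool) : 'I_3 -> bool :=
  fun k => if k == i then b else if k == j then b' else o k.

(** The booleans refer to the lower and to the upper sheet, in this order; the
    ascending path is [false false], [true false], [true true]. *)
Definition double_region (R : realType) (S : oriented_closed_surface R)
    (q : 'rV[R]_3) (b b' : bool) : set 'rV[R]_3 :=
  xget set0 [set r | exists xB xT, double_point S q xB xT /\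
    region_near S q [:: (xB, b); (xT, b')] r].

Lemma xget_set1E (C : choiceType) (x0 a : C) (P : set C) :
  (forall x, P x <-> x = a) -> xget x0 P = a.
Proof. by move=> h; case: xgetP => [x _ /h //|/(_ a)]; case; exact/h. Qed.

Section Colors.
Context {R : realType} (S : oriented_closed_surface R) (n : nat).
Variable ch : plane_chart S n.
Hypothesis nch : normal_plane_chart ch.
Implicit Types (i j : 'I_3) (z w q : 'rV[R]_3) (o : 'I_3 -> bool).

(** With three sheets this is a half axis, on the side given by [o]; with two
    sheets the remaining coordinate is unconstrained and it is a whole axis. *)
Definition on_axis z i j o := [/\ (i < j < n)%N, cube R 3 z, z 0 i = 0, z 0 j = 0 &
  forall k : 'I_3, (k < n)%N -> k != i -> k != j -> 0 < (-1) ^+ (~~ o k) * z 0 k].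

Lemma on_axis_zero z i j o : on_axis z i j o ->
  forall k : 'I_3, (k < n)%N -> z 0 k = 0 -> k = i \/ k = j.
Proof.
move=> [_ _ _ _ h] k k_n zk.
have [->|ki] := eqVneq k i; [by left|right].
by apply/eqP/negPn/negP => kj; have := h k k_n ki kj; rewrite zk mulr0 ltxx.
Qed.

Lemma on_axis_double z i j o : on_axis z i j o ->
  double_point S (pt ch z) (sheet ch i z) (sheet ch j z).
Proof.
move=> /[dup] /on_axis_zero h [ijn cz zi zj _].
exact: sheets_double_point.
Qed.

Lemma on_axis_region z i j o b b' : on_axis z i j o -> forall r,
  region_near S (pt ch z) [:: (sheet ch i z, b); (sheet ch j z, b')] r <->
  r = octant_region ch (flip2 o i j b b').
Proof.
move=> az; have az0 := on_axis_zero az; case: az => /andP[ij j_n] cz zi zj oz.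
have ji : (j == i) = false by rewrite -val_eqE gtn_eqF.
apply: region_nearE => //.
- move=> k k_n zk; have [->|->] := az0 k k_n zk; rewrite /flip2.
    by rewrite eqxx inE eqxx.
  by rewrite ji eqxx !inE eqxx orbT.
- move=> k k_n zk; rewrite /flip2.
  have ki : k != i by apply: contraNneq zk => ->; rewrite zi.
  have kj : k != j by apply: contraNneq zk => ->; rewrite zj.
  rewrite (negPf ki) (negPf kj); have := oz k k_n ki kj.
  case: (o k); rewrite /= ?expr0 ?expr1 ?mul1r ?mulN1r; first by move=> ->.
  by rewrite oppr_gt0 => /ltW; rewrite leNgt => /negPf.
- move=> p; rewrite !inE => /orP[/eqP ->|/eqP ->]; [exists i|exists j].
    by rewrite /flip2 eqxx; split=> //; exact: ltn_trans ij j_n.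
  by rewrite /flip2 eqxx ji.
Qed.

Lemma on_axis_double_region z i j o b b' : on_axis z i j o ->
  double_region S (pt ch z) b b' = octant_region ch (flip2 o i j b b').
Proof.
move=> az; have az0 := on_axis_zero az.
have [ijn cz zi zj _] := az.
apply: xget_set1E => r.
split=> [[xB [xT [dp]]]|->]; last first.
  exists (sheet ch i z), (sheet ch j z); split; first exact: on_axis_double az.
  exact/(on_axis_region b b' az).
have [i' [j' [/andP[ij' j_n'] zi' zj' [-> ->] _]]] := double_point_sheets nch cz dp.
suff [-> ->] : i' = i /\ j' = j by move/(on_axis_region b b' az).
have := az0 i' (ltn_trans ij' j_n') zi'; have := az0 j' j_n' zj'.
have /andP[ij _] := ijn.
case=> ej'; case=> ei'; rewrite ei' ej' ?ltnn // in ij' *.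
by have := ltn_trans ij ij'; rewrite ltnn.
Qed.

Lemma on_axis_half i j o : (i < j < n)%N -> exists z, on_axis z i j o.
Proof.
move=> ijn; exists (\row_k (if (k == i) || (k == j) then 0 else (-1) ^+ (~~ o k) / 2)).
split=> //; rewrite ?mxE ?eqxx ?orbT //.
  move=> k; rewrite mxE; case: ifP => _; rewrite ?normr0 ?ltr01 //.
  by rewrite normrM normr_sign mul1r ger0_norm; lra.
move=> k _ /negPf ki /negPf kj; rewrite mxE ki kj /= mulrA -signr_addb addbb.
by rewrite mul1r; lra.
Qed.

(** The coloring rule, read off at any point of the half-axis selected by [o];
    the octants [flip2 o i j b b'] are the four quadrants around it. *)
Lemma octant_coloring (X : Type) (T : X -> X -> X -> X) (c : set 'rV[R]_3 -> X)
    i j o : KTQ_coloring S T c -> (i < j < n)%N ->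
  let x b b' := c (octant_region ch (flip2 o i j b b')) in
  x false true = T (x false false) (x true false) (x true true).
Proof.
move=> hc ijn x; have [z az] := on_axis_half o ijn.
have dp : double_points S (pt ch z).
  by exists (sheet ch i z), (sheet ch j z); exact: on_axis_double az.
apply: (hc (connected_component (double_points S) (pt ch z))).
  by exists (pt ch z).
exists (pt ch z), (sheet ch i z), (sheet ch j z); split.
- exact: connected_component_refl.
- exact: on_axis_double az.
- by split; exact/(on_axis_region _ _ az).
Qed.

End Colors.

(** The value zero away from the double points allows sums of such functions to
    be compared as functions on the whole space. *)
Definition edge_color (k : comNzRingType) (X : choiceType) (T : X -> X -> X -> X)
    (R : realType) (S : oriented_closed_surface R) (c : set 'rV[R]_3 -> X)
    (q : 'rV[R]_3) : normal_chain k T 1 :=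
  if `[< double_points S q >] then
    to_normal_chain T (@basis_chain k X 1 [tuple
      c (double_region S q false false); c (double_region S q true false);
      c (double_region S q true true)])
  else 0.

Lemma det_rows3 (R : comPzRingType) (u v w : 'rV[R]_3) :
  let e (x : 'rV[R]_3) i := x 0 (inord i) in
  \det (col_mx u (col_mx v w) : 'M[R]_3) =
    e u 0%N * (e v 1%N * e w 2%N - e v 2%N * e w 1%N)
    - e u 1%N * (e v 0%N * e w 2%N - e v 2%N * e w 0%N)
    + e u 2%N * (e v 0%N * e w 1%N - e v 1%N * e w 0%N).
Proof.
move=> e.
have r0 : (inord 0 : 'I_(1 + (1 + 1))) = lshift 2 ord0 by apply/val_inj; rewrite /= inordK.
have r1 : (inord 1 : 'I_(1 + (1 + 1))) = rshift 1 (lshift 1 ord0).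
  by apply/val_inj; rewrite /= inordK.
have r2 : (inord 2 : 'I_(1 + (1 + 1))) = rshift 1 (rshift 1 ord0).
  by apply/val_inj; rewrite /= inordK.
pose M := col_mx u (col_mx v w) : 'M[R]_3.
have m0 j : M (inord 0) j = u 0 j by rewrite r0 [LHS](@col_mxEu R 1 2).
have m1 j : M (inord 1) j = v 0 j.
  by rewrite r1 [LHS](@col_mxEd R 1 2) [LHS](@col_mxEu R 1 1).
have m2 j : M (inord 2) j = w 0 j.
  by rewrite r2 [LHS](@col_mxEd R 1 2) [LHS](@col_mxEd R 1 1).
by rewrite -/M det3E /= !m0 !m1 !m2.
Qed.

Section Triple.
Context {R : realType} (S : oriented_closed_surface R) (n : nat).
Variable ch : plane_chart S n.
Hypothesis nch : normal_plane_chart ch.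
Variables (k : comNzRingType) (X : choiceType) (T : X -> X -> X -> X).
Variable c : set 'rV[R]_3 -> X.
Implicit Types (i j : 'I_3) (z w q : 'rV[R]_3) (o : 'I_3 -> bool).

Lemma edge_colorE z i j o : on_axis n z i j o ->
  edge_color k T S c (pt ch z) =
  to_normal_chain T (@basis_chain k X 1 [tuple
      c (octant_region ch (flip2 o i j false false));
      c (octant_region ch (flip2 o i j true false));
      c (octant_region ch (flip2 o i j true true))]).
Proof.
move=> az; rewrite /edge_color asboolT; last first.
  by exists (sheet ch i z), (sheet ch j z); exact: on_axis_double az.
by rewrite !(on_axis_double_region nch _ _ az).
Qed.

Definition bits (b0 b1 b2 : bool) : 'I_3 -> bool := fun i => nth false [:: b0; b1; b2] i.

Hypothesis n3 : (2 < n)%N.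

Lemma det_co_sign z : cube R 3 z ->
  0 < (-1) ^+ orient ch * \det (jac (co ch) (pt ch z)).
Proof.
move=> cz; have := pt_orient ch cz; have := congr1 determinant (jac_ptK ch cz).
set J := jac (co ch) _; rewrite det_mulmx det1.
move: (\det J) (\det _) => x y yx y0.
have : 0 < ((-1) ^+ orient ch * y) * ((-1) ^+ orient ch * x).
  by rewrite mulrACA -signr_addb addbb mul1r yx.
by rewrite pmulr_rgt0.
Qed.

Lemma ascending_path_triple (m : 'I_4) :
  ascending_path S (pt ch 0) m =
  octant_region ch (bits (0 < m) (1 < m) (2 < m))%N.
Proof.
have c0 := @cube0 R 3.
have key : forall r, region_near S (pt ch 0) [:: (sheet ch (inord 0) 0, (0 < m)%N);
    (sheet ch (inord 1) 0, (1 < m)%N); (sheet ch (inord 2) 0, (2 < m)%N)] r <->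
    r = octant_region ch (bits (0 < m) (1 < m) (2 < m))%N.
  apply: region_nearE => //.
  - move=> i _ _; rewrite /bits !inE.
    by case: i => -[|[|[|//]]] i3 /=; apply/or3P;
      [apply: Or31|apply: Or32|apply: Or33]; apply/eqP; congr (sheet ch _ _, _);
      apply/val_inj; rewrite /= inordK.
  - by move=> i _; rewrite mxE eqxx.
  - move=> p; rewrite !inE /bits => /or3P[] /eqP ->;
      [exists (inord 0)|exists (inord 1)|exists (inord 2)];
      rewrite !inordK //= mxE; split=> //; exact: leq_trans n3.
apply: xget_set1E => r; split=> [[xB [xM [xT [tp]]]]|->]; last first.
  exists (sheet ch (inord 0) 0), (sheet ch (inord 1) 0), (sheet ch (inord 2) 0).
  by split; [exact: sheets_triple_point|exact/key].
by have [_ _ [-> -> ->]] := triple_point_sheets nch c0 tp; move/key.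
Qed.

(** The conormals are the differentials of the three coordinates, but listed
    from top to bottom, which is an odd permutation: a positive triple point is
    one with orientation-reversing coordinates. *)
Lemma positive_triple_pointE :
  positive_triple_point S (pt ch 0) <-> orient ch.
Proof.
have c0 := @cube0 R 3.
have z0 i : (0 : 'rV[R]_3) 0 i = 0 by rewrite mxE.
have in0 : ((inord 0 : 'I_3) < n)%N by rewrite inordK // (leq_trans _ n3).
have in1 : ((inord 1 : 'I_3) < n)%N by rewrite inordK // (leq_trans _ n3).
have in2 : ((inord 2 : 'I_3) < n)%N by rewrite inordK.
set J := jac (co ch) (pt ch 0).
have detC a b d : \det (col_mx (a *: (col (inord 2) J)^T)
    (col_mx (b *: (col (inord 1) J)^T) (d *: (col (inord 0) J)^T)) : 'M[R]_3) =
    (a * b * d) * - \det J.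
  rewrite det_rows3 det3E /= !mxE; ring.
have dJ : 0 < (-1) ^+ orient ch * \det J := det_co_sign c0.
split=> [[xB [xM [xT [vB [vM [vT [tp cB cM cT d]]]]]]]|od].
  have [_ _ [eB eM eT]] := triple_point_sheets nch c0 tp.
  rewrite eB in cB; rewrite eM in cM; rewrite eT in cT.
  have [a a0 ea] := (conormal_sheet nch vT in2 c0 (z0 _)).1 cT.
  have [b b0 eb] := (conormal_sheet nch vM in1 c0 (z0 _)).1 cM.
  have [e e0 ee] := (conormal_sheet nch vB in0 c0 (z0 _)).1 cB.
  move: d; rewrite ea eb ee detC pmulr_rgt0 ?mulr_gt0 // => d.
  by move: dJ d; case: (orient ch); rewrite //= expr0 mul1r oppr_gt0 => dJ /(lt_trans dJ); rewrite ltxx.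
exists (sheet ch (inord 0) 0), (sheet ch (inord 1) 0), (sheet ch (inord 2) 0).
exists (1 *: (col (inord 0) J)^T), (1 *: (col (inord 1) J)^T), (1 *: (col (inord 2) J)^T).
split; first exact: sheets_triple_point.
- by apply/conormal_sheet => //; exists 1.
- by apply/conormal_sheet => //; exists 1.
- by apply/conormal_sheet => //; exists 1.
by rewrite detC !mul1r; move: dJ; rewrite od expr1 mulN1r.
Qed.

Lemma triple_point_signE :
  triple_point_sign S (pt ch 0) = (-1) ^+ (~~ orient ch) :> int.
Proof.
rewrite /triple_point_sign; case: asboolP => [/positive_triple_pointE ->|h].
  by rewrite expr0.
suff -> : orient ch = false by rewrite expr1.
by apply/negP => /positive_triple_pointE.
Qed.

End Triple.

(** * Step functions of one variable *)

Section StepFunctions.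
Context {R : realType} {A : zmodType}.
Implicit Types (f : R -> A) (E : seq R) (a b t : R).

Lemma locally_constant_itv f a b :
  (forall t, a < t < b -> \forall s \near t, f s = f t) ->
  forall s t, a < s < b -> a < t < b -> f s = f t.
Proof.
move=> lf s t hs ht.
have := @connected_locally_constant R `]a, b[%classic (fun x => f x = f t).
move=> /(_ _ _ t s); apply => //=; rewrite ?in_itv //=.
  by apply/connected_intervalP => x y /=; rewrite !in_itv /= => /andP[ax xb]
    /andP[ay yb] z /andP[xz zy]; rewrite in_itv /= (lt_le_trans ax) ?(le_lt_trans zy).
move=> x; rewrite in_itv /= => /lf; apply: filterS => y -> _ //.
Qed.

Lemma near_right_avoids E t : \forall s \near t^'+, s \notin E.
Proof.
elim: E => [|e E IH]; first by apply: nearW => s; rewrite in_nil.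
have : \forall s \near t^'+, s != e.
  have [et|te] := leP e t.
    by near=> s; rewrite gt_eqF // (le_lt_trans et) //; near: s; exact: nbhs_right_gt.
  by near=> s; rewrite lt_eqF //; near: s; exact: nbhs_right_lt.
by move: IH; apply: filterS2 => s sE se; rewrite inE negb_or se.
Unshelve. all: by end_near. Qed.

Lemma near_left_avoids E t : \forall s \near t^'-, s \notin E.
Proof.
elim: E => [|e E IH]; first by apply: nearW => s; rewrite in_nil.
have : \forall s \near t^'-, s != e.
  have [te|et] := leP t e.
    by near=> s; rewrite lt_eqF // (lt_le_trans _ te) //; near: s; exact: nbhs_left_lt.
  by near=> s; rewrite gt_eqF //; near: s; exact: nbhs_left_gt.
by move: IH; apply: filterS2 => s sE se; rewrite inE negb_or se.
Unshelve. all: by end_near. Qed.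

Lemma near_right_interval (t : R) (P : set R) : (\forall s \near t^'+, P s) ->
  exists2 d, 0 < d & forall s, t < s < t + d -> P s.
Proof.
move=> [d /= d0 h]; exists d => // s /andP[ts st]; apply: h => //=.
by rewrite ler0_norm ?subr_le0 1?ltW // opprB ltrBlDl.
Qed.

Lemma near_left_interval (t : R) (P : set R) : (\forall s \near t^'-, P s) ->
  exists2 d, 0 < d & forall s, t - d < s < t -> P s.
Proof.
move=> [d /= d0 h]; exists d => // s /andP[ts st]; apply: h => //=.
by rewrite ger0_norm ?subr_ge0 1?ltW // ltrBlDl -ltrBlDr.
Qed.

Definition step_on f E a b :=
  forall t, a < t < b -> t \notin E -> \forall s \near t, f s = f t.

Lemma step_right f E a b t : step_on f E a b -> a <= t < b ->
  exists v, \forall s \near t^'+, f s = v.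
Proof.
move=> sf /andP[a_t tb].
have : \forall s \near t^'+, s < b /\ s \notin E.
  by apply: filterI; [exact: nbhs_right_lt|exact: near_right_avoids].
move=> /near_right_interval[d d0 h].
have hm : t < t + d / 2 < t + d by lra.
exists (f (t + d / 2)).
near=> s; apply: (@locally_constant_itv f t (t + d)) => //.
  move=> u tu; have [ub uE] := h u tu; apply: sf => //.
  by case/andP: tu => tu _; rewrite (le_lt_trans a_t).
apply/andP; split; near: s; first exact: nbhs_right_gt.
by apply: nbhs_right_lt; lra.
Unshelve. all: by end_near. Qed.

Lemma step_left f E a b t : step_on f E a b -> a < t <= b ->
  exists v, \forall s \near t^'-, f s = v.
Proof.
move=> sf /andP[a_t tb].
have : \forall s \near t^'-, a < s /\ s \notin E.
  by apply: filterI; [exact: nbhs_left_gt|exact: near_left_avoids].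
move=> /near_left_interval[d d0 h].
have hm : t - d < t - d / 2 < t by lra.
exists (f (t - d / 2)).
near=> s; apply: (@locally_constant_itv f (t - d) t) => //.
  move=> u tu; have [ub uE] := h u tu; apply: sf => //.
  by case/andP: tu => _ ut; rewrite ub (lt_le_trans ut).
apply/andP; split; near: s; last exact: nbhs_left_lt.
by apply: nbhs_left_gt; lra.
Unshelve. all: by end_near. Qed.

Lemma seq_max (x : R) (E : seq R) : x \in E ->
  exists2 m, m \in E & forall t, t \in E -> t <= m.
Proof.
elim: E x => [//|e E IH] x _; have [E0|] := eqVneq E [::].
  by exists e; rewrite ?mem_head // => t; rewrite E0 inE => /eqP ->.
case: E IH => [//|y E] IH _; have [m mE hm] := IH y (mem_head _ _).
have [em|me] := leP e m.
  exists m; first by rewrite inE mE orbT.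
  by move=> t; rewrite inE => /orP[/eqP ->|/hm].
exists e; first exact: mem_head.
by move=> t; rewrite inE => /orP[/eqP ->|/hm tm] //; apply: le_trans tm (ltW me).
Qed.

(** By induction on the number of break points: to the right of the last break
    point the function is constant, and that break point may be taken as the
    new end of the interval. *)
Lemma step_telescope f E a b va vb (rv lv : R -> A) : a < b -> uniq E ->
  (forall t, t \in E -> a < t < b) -> step_on f E a b ->
  (\forall s \near a^'+, f s = va) -> (\forall s \near b^'-, f s = vb) ->
  (forall t, t \in E -> (\forall s \near t^'+, f s = rv t) /\
     (\forall s \near t^'-, f s = lv t)) ->
  \sum_(t <- E) (rv t - lv t) = vb - va.
Proof.
have [m] := ubnP (size E); elim: m E b vb => // m IH E b vb sE ab uE Eab sf fa fb fE.
have const x y vx vy : x < y -> a <= x -> y <= b ->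
    (forall t, t \in E -> ~~ (x < t < y)) -> (\forall s \near x^'+, f s = vx) ->
    (\forall s \near y^'-, f s = vy) -> vx = vy.
  move=> xy ax yb hE fx fy.
  have lc t : x < t < y -> \forall s \near t, f s = f t.
    move=> txy; apply: sf; first by lra.
    by apply/negP => /hE; rewrite txy.
  have hx : \forall s \near x^'+, f s = vx /\ s < y.
    by apply: filterI => //; exact: nbhs_right_lt.
  have hy : \forall s \near y^'-, f s = vy /\ x < s.
    by apply: filterI => //; exact: nbhs_left_gt.
  have [d d0 hd] := near_right_interval hx.
  have [e e0 he] := near_left_interval hy.
  have hd2 : x < x + d / 2 < x + d by lra.
  have he2 : y - e < y - e / 2 < y by lra.
  have [<- ?] := hd _ hd2; have [<- ?] := he _ he2.
  by apply: (locally_constant_itv lc); lra.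
have [E0|] := eqVneq E [::].
  rewrite E0 big_nil (const a b va vb) ?subrr //.
  by rewrite E0.
rewrite -size_eq0 -lt0n -has_predT => /hasP[x xE _].
have [t tE tmax] := seq_max xE.
have [fr fl] := fE t tE; have /andP[a_t tb] := Eab t tE.
have erv : rv t = vb.
  apply: (const t b) => //; first exact: ltW.
  by move=> s /tmax; rewrite leNgt => /negPf ->.
rewrite (perm_big _ (perm_to_rem tE)) /= big_cons erv.
rewrite (IH (rem t E) t (lv t)) ?rem_uniq //.
- by rewrite addrA subrK.
- rewrite size_rem //; case: (E) sE tE => //= ? ? /ltnSE //.
- move=> s; rewrite mem_rem_uniq // !inE => /andP[st sE'].
  by case/andP: (Eab s sE') => -> _; rewrite lt_neqAle st tmax.
- move=> s /andP[a_s st] sE'; apply: sf; first by rewrite a_s (lt_trans st).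
  by apply: contra sE' => sE'; rewrite mem_rem_uniq // !inE sE' lt_eqF.
- by move=> s /mem_rem; exact: fE.
Qed.

End StepFunctions.

(** * Jumps along the double curves *)

Lemma det_rows3_mul (R : comPzRingType) (u v w : 'rV[R]_3) (M : 'M[R]_3) :
  \det (col_mx (u *m M) (col_mx (v *m M) (w *m M)) : 'M[R]_3) =
  \det (col_mx u (col_mx v w) : 'M[R]_3) * \det M.
Proof.
by rewrite -(det_mulmx (col_mx u (col_mx v w) : 'M[R]_3)) (@mul_col_mx _ 1 2 3 3) (@mul_col_mx _ 1 1 3 3).
Qed.

(** Moving from the double point [q] to [p] is a move along ([b = false]) or
    against ([b = true]) the orientation of the double curve given by the
    product of the conormals of the upper and the lower sheet. *)
Definition on_end (R : realType) (S : oriented_closed_surface R)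
    (q : 'rV[R]_3) (b : bool) (p : 'rV[R]_3) : Prop :=
  exists xB xT vB vT, [/\ double_point S q xB xT, conormal S xB vB, conormal S xT vT &
    0 < (-1) ^+ b * \det (col_mx vT (col_mx vB (p - q)) : 'M[R]_3)].

Section Jumps.
Context {R : realType} {A : zmodType} (S : oriented_closed_surface R).
Implicit Types (H : 'rV[R]_3 -> A) (q p : 'rV[R]_3).

(** The value of [H] on the double curve just before or just after [q]; it is
    meaningful when [H] is constant on either side of [q]. *)
Definition end_value H q (b : bool) : A :=
  xget 0 [set a | \forall p \near q, double_points S p -> on_end S q b p -> H p = a].

Definition jump H q : A := end_value H q false - end_value H q true.

Section Axis.
Context (n : nat) (ch : plane_chart S n).
Hypothesis nch : normal_plane_chart ch.
Variables (i j k : 'I_3) (o : 'I_3 -> bool).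
Hypothesis (ki : k != i) (kj : k != j).

(** Whether the coordinate direction of the [k]-th axis is opposite to the
    orientation of the double curve. With [i < j] the other two indices, the
    permutation [(j, i, k)] of upper sheet, lower sheet and axis is even only
    for [k = 1]. *)
Definition reversed : bool := orient ch (+) (k != 1%N :> nat).

Definition axis_pt (t : R) : 'rV[R]_3 := pt ch (t *: delta_mx 0 k).

Lemma det_axis z v : on_axis n z i j o -> let J := jac (co ch) (pt ch z) in
  \det (col_mx (col j J)^T (col_mx (col i J)^T v) : 'M[R]_3) =
  (-1) ^+ (k != 1%N :> nat) * (v *m (jac (pt ch) z)^T) 0 k * \det J.
Proof.
move=> [/andP[ij _] cz _ _ _] J; set B := jac (pt ch) z.
have BJ : B *m J = 1%:M by exact: jac_ptK.
have colB (l : 'I_3) : (col l J)^T *m B^T = delta_mx 0 l.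
  by rewrite -trmx_mul colE mulmxA BJ mul1mx trmx_delta.
have dBJ : \det B * \det J = 1 by rewrite -det_mulmx BJ det1.
have := det_rows3_mul (col j J)^T (col i J)^T v B^T.
rewrite !colB det_tr => e; rewrite -[LHS]mulr1 -[X in _ * X = _]dBJ mulrA -e.
congr (_ * _); rewrite det_rows3 /=; move: (v *m B^T) => u.
have E (l m : 'I_3) : (delta_mx 0 l : 'rV[R]_3) 0 m = (m == l :> nat)%:R.
  by rewrite mxE eqxx.
rewrite !E !inordK //.
have U (l : 'I_3) : u 0 l = u 0 (inord l) by rewrite inord_val.
rewrite (U k); move: ij ki kj; rewrite -!val_eqE /=.
by case: (i) => -[|[|[|//]]] ? /=; case: (j) => -[|[|[|//]]] ? //=;
  case: (k) => -[|[|[|//]]] ? //= _ _ _; ring.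
Qed.

(** The side of [pt ch z] on which [p] lies is measured by the scalar product of
    [p - pt ch z] with the tangent vector of the axis. *)
Lemma on_end_axis z b p : on_axis n z i j o ->
  on_end S (pt ch z) b p <->
  0 < (-1) ^+ (b (+) reversed) * ((p - pt ch z) *m (jac (pt ch) z)^T) 0 k.
Proof.
move=> az; have az0 := on_axis_zero az; have [ijn cz zi zj _] := az.
have [ij j_n] := andP ijn; have i_n := ltn_trans ij j_n.
have key (a d : R) : 0 < a -> 0 < d ->
    (0 < (-1) ^+ b * \det (col_mx (a *: (col j (jac (co ch) (pt ch z)))^T)
      (col_mx (d *: (col i (jac (co ch) (pt ch z)))^T) (p - pt ch z)) : 'M[R]_3)) =
    (0 < (-1) ^+ (b (+) reversed) * ((p - pt ch z) *m (jac (pt ch) z)^T) 0 k).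
  move=> a0 d0; have dJ := det_co_sign ch cz.
  have sc (u v w : 'rV[R]_3) : \det (col_mx (a *: u) (col_mx (d *: v) w) : 'M[R]_3) =
      a * d * \det (col_mx u (col_mx v w) : 'M[R]_3).
    by rewrite !det_rows3 !mxE; ring.
  rewrite sc det_axis //.
  move: (\det _) (_ 0 k) dJ => J u dJ; rewrite /reversed !signr_addb.
  have -> : (-1) ^+ b * (a * d * ((-1) ^+ (k != 1%N :> nat) * u * J)) =
      (-1) ^+ b * ((-1) ^+ orient ch * (-1) ^+ (k != 1%N :> nat)) * u *
      (a * d * ((-1) ^+ orient ch * J)).
    have s2 : (-1) ^+ orient ch * (-1) ^+ orient ch = 1 :> R by rewrite -signr_addb addbb.
    by move: s2; move: ((-1) ^+ orient ch) => s s2; transitivity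
      ((s * s) * ((-1) ^+ b * (a * d * ((-1) ^+ (k != 1%N :> nat) * u * J))));
      [rewrite s2 mul1r | ring].
  by rewrite pmulr_lgt0 //; apply: mulr_gt0 => //; exact: mulr_gt0.
split=> [[xB [xT [vB [vT [dp cB cT d]]]]]|h].
  have [i' [j' [/andP[ij' j_n'] zi' zj' [eB eT] _]]] := double_point_sheets nch cz dp.
  have ei' : i' = i /\ j' = j.
    have := az0 i' (ltn_trans ij' j_n') zi'; have := az0 j' j_n' zj'.
    case=> ej'; case=> ei'; rewrite ei' ej' ?ltnn // in ij' *.
    by have := ltn_trans ij ij'; rewrite ltnn.
  move: ei' eB eT => [-> ->] eB eT; rewrite eB in cB; rewrite eT in cT.
  have [a a0 ea] := (conormal_sheet nch vT j_n cz zj).1 cT.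
  have [e e0 ee] := (conormal_sheet nch vB i_n cz zi).1 cB.
  by rewrite ea ee key in d.
exists (sheet ch i z), (sheet ch j z), (1 *: (col i (jac (co ch) (pt ch z)))^T),
  (1 *: (col j (jac (co ch) (pt ch z)))^T); split.
- exact: on_axis_double az.
- by apply/conormal_sheet => //; exists 1.
- by apply/conormal_sheet => //; exists 1.
- by rewrite key.
Qed.

Let e : 'rV[R]_3 := delta_mx 0 k.

Lemma near_axis_pt t : cube R 3 (t *: e) -> {for t, continuous axis_pt}.
Proof.
move=> ct; apply: (continuous_comp (f := fun t : R => t *: e) (g := pt ch)).
  by apply: cvgZr_tmp; exact: cvg_id.
exact: pt_continuous.
Qed.

Let along t p := ((p - axis_pt t) *m (jac (pt ch) (t *: e))^T) 0 k.

(** The derivative at [t] is the squared length of the tangent vector of the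
    axis. *)
Lemma axis_increasing t : cube R 3 (t *: e) ->
  (\forall s \near t^'+, 0 < along t (axis_pt s)) /\
  (\forall s \near t^'-, along t (axis_pt s) < 0).
Proof.
move=> ct; set z := t *: e; set B := jac (pt ch) z.
have dpt := pt_diff ch ct.
have [dm jm] := mulmx_diff B^T (pt ch z).
have dg := differentiable_comp dpt dm.
have jg := jacobian_comp dpt dm; rewrite jm in jg.
have Bk : 0 < (e *m (B *m B^T)) 0 k.
  have -> : (e *m (B *m B^T)) 0 k = \sum_l (B k l) ^+ 2.
    by rewrite -rowE !mxE; apply: eq_bigr => l _; rewrite !mxE expr2.
  rewrite lt_neqAle sumr_ge0 ?andbT => [|l _]; last exact: sqr_ge0.
  rewrite eq_sym; apply/eqP => s0.
  have rB : row k B = 0.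
    apply/rowP => l; apply/eqP; rewrite !mxE -sqrf_eq0.
    have /eqP := s0; rewrite psumr_eq0 => [/allP|m _]; last exact: sqr_ge0.
    by move=> /(_ l); rewrite mem_index_enum => /(_ isT).
  have := congr1 (row k) (jac_ptK ch ct); rewrite row_mul rB mul0mx => /rowP /(_ k).
  by rewrite !mxE eqxx => /eqP; rewrite eq_sym oner_eq0.
have E s : along t (axis_pt (t + s)) =
    (pt ch (z + s *: e) *m B^T) 0 k - (pt ch z *m B^T) 0 k.
  by rewrite /along /axis_pt -/e scalerDl mulmxBl !mxE.
split.
  have := @differentiable_coord_sign R _ z e k false dg.
  rewrite jg expr0 mul1r => /(_ Bk) /near_right_interval[d d0 h].
  have nr : \forall s \near t^'+, t < s < t + d.
    near=> s; apply/andP; split; near: s; first exact: nbhs_right_gt.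
    by apply: nbhs_right_lt; lra.
  near=> s; have -> : s = t + (s - t) by rewrite addrC subrK.
  rewrite E; have /= := h (s - t); rewrite ?expr0 mul1r; apply.
  by have : t < s < t + d by [near: s; exact: nr]; lra.
have := @differentiable_coord_sign R _ z (- e) k true dg.
have NB : (- e *m (B *m B^T)) 0 k = - (e *m (B *m B^T)) 0 k by rewrite mulNmx mxE.
rewrite jg expr1 NB mulN1r opprK => /(_ Bk) /near_right_interval[d d0 h].
have nl : \forall s \near t^'-, t - d < s < t.
  near=> s; apply/andP; split; near: s; last exact: nbhs_left_lt.
  by apply: nbhs_left_gt; lra.
near=> s; have -> : s = t + (s - t) by rewrite addrC subrK.
rewrite E; have /= := h (t - s); rewrite ?expr1 mulN1r oppr_gt0 scalerN -scaleNr opprB.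
by apply; have : t - d < s < t by [near: s; exact: nl]; lra.
Unshelve. all: by end_near. Qed.

(** The coordinates that do not vanish at [t *: e] do not vanish nearby, so the
    two sheets through a nearby double point are the [i]-th and the [j]-th. *)
Lemma near_double_point t d : 0 < d -> on_axis n (t *: e) i j o ->
  \forall p \near axis_pt t, double_points S p ->
    exists2 s, `|s - t| < d & p = axis_pt s.
Proof.
move=> d0 az; have [ijn cz zi zj _] := az; have az0 := on_axis_zero az.
have [dz cpz] := pt_dom ch cz.
have cco : co ch p @[p --> axis_pt t] --> t *: e.
  by rewrite -cpz; exact: differentiable_continuous (co_diff dz).
have n1 : \forall p \near axis_pt t, dom ch p.
  exact: open_nbhs_nbhs (conj (dom_open (p := ch)) dz).
have n2 : \forall p \near axis_pt t, `|co ch p 0 k - t| < d.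
  have h : co ch p 0 k @[p --> axis_pt t] --> t.
    have := @cvg_entry _ _ _ (nbhs_filter (axis_pt t)) _ _ _ _ 0 k cco.
    by rewrite !mxE !eqxx mulr1.
  have /cvgrPdist_lt /(_ _ d0) := h.
  by apply: filterS => p; rewrite distrC.
have nl (l : 'I_3) : \forall p \near axis_pt t, (l < n)%N ->
    (t *: e) 0 l != 0 -> co ch p 0 l != 0.
  have [zl|zl] := eqVneq ((t *: e) 0 l) 0; first by
    apply: (@filterE _ _ (nbhs_filter (axis_pt t))) => p _; rewrite ?zl ?eqxx.
  have h := @cvg_entry _ _ _ (nbhs_filter (axis_pt t)) _ _ _ _ 0 l cco.
  have h2 : \forall p \near axis_pt t, co ch p 0 l != 0 := cvgr_neq0 _ h zl.
  by near=> p => _ _; near: p; exact: h2.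
have n3 := @filter_forall _ _ _ _ (nbhs_filter (axis_pt t)) nl.
near=> p => -[xB [xT dp]].
have dpt : dom ch p by near: p.
have [cp ep] := co_cube dpt; rewrite -ep in dp.
have [i' [j' [/andP[ij' j_n'] zi' zj' _ _]]] := double_point_sheets nch cp dp.
have sub (l : 'I_3) : (l < n)%N -> co ch p 0 l = 0 -> l = i \/ l = j.
  move=> l_n pl; apply: az0 => //; apply/eqP; apply: contraT => zl.
  have h : forall l : 'I_3, (l < n)%N -> (t *: e) 0 l != 0 -> co ch p 0 l != 0.
    by near: p.
  by have := h l l_n zl; rewrite pl eqxx.
have [ei ej] : i' = i /\ j' = j.
  have /andP[ij _] := ijn.
  have := sub i' (ltn_trans ij' j_n') zi'; have := sub j' j_n' zj'.
  case=> ej'; case=> ei'; rewrite ei' ej' ?ltnn // in ij' *.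
  by have := ltn_trans ij ij'; rewrite ltnn.
exists (co ch p 0 k); first by near: p.
rewrite /axis_pt -{1}ep; congr (pt ch _); apply/rowP => l; rewrite !mxE eqxx /=.
have [->|lk] := eqVneq l k; first by rewrite mulr1.
rewrite mulr0; have [->|li] := eqVneq l i; first by rewrite -ei.
have [->|lj] := eqVneq l j; first by rewrite -ej.
have ij : i != j by case/andP: ijn => ij _; rewrite -val_eqE ltn_eqF.
move: lk li lj ij ki kj; rewrite -!val_eqE /=.
have := ltn_ord l; have := ltn_ord i; have := ltn_ord j; have := ltn_ord k; lia.
Unshelve. all: by end_near. Qed.

(** The value is unique because the double points on the relevant side of the
    axis accumulate at [axis_pt t]. *)
Lemma end_value_axis H t b vr vl :
  (\forall s \near t, on_axis n (s *: e) i j o) ->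
  (\forall s \near t^'+, H (axis_pt s) = vr) ->
  (\forall s \near t^'-, H (axis_pt s) = vl) ->
  end_value H (axis_pt t) b = if b (+) reversed then vl else vr.
Proof.
move=> nax hr hl; have az := nbhs_singleton nax; have [ijn cz _ _ _] := az.
have [incr decr] := axis_increasing cz.
have oE := on_end_axis b _ az.
have [d1 d10 h1] := near_right_interval (filterI hr incr).
have [d2 d20 h2] := near_left_interval (filterI hl decr).
have d0 : 0 < Num.min d1 d2 by rewrite lt_min d10 d20.
have nP := near_double_point d0 az.
set v := if _ then _ else _.
have nv : \forall p \near axis_pt t, double_points S p -> on_end S (axis_pt t) b p -> H p = v.
  near=> p => dp /oE.
  have : double_points S p -> exists2 s, `|s - t| < Num.min d1 d2 & p = axis_pt s.
    by near: p.
  move=> /(_ dp)[s]; rewrite lt_min !ltr_norml => /andP[/andP[s1 s2] /andP[s3 s4]] ->.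
  rewrite -/(along t (axis_pt s)) /v.
  case: (ltgtP t s) => [ts|st|<-].
  - have /h1[-> u0] : t < s < t + d1 by rewrite ts /=; lra.
    by case: (b (+) reversed) => //; rewrite expr1 mulN1r oppr_gt0 => /(lt_trans u0); rewrite ltxx.
  - have /h2[-> u0] : t - d2 < s < t by rewrite st andbT; lra.
    by case: (b (+) reversed) => //; rewrite expr0 mul1r => /(lt_trans u0); rewrite ltxx.
  - by rewrite /along subrr mul0mx mxE mulr0 ltxx.
apply: xget_set1E => a; split=> [na|-> //].
have cA := near_axis_pt cz.
pose Q s := [/\ on_axis n (s *: e) i j o,
    double_points S (axis_pt s) -> on_end S (axis_pt t) b (axis_pt s) -> H (axis_pt s) = a &
    double_points S (axis_pt s) -> on_end S (axis_pt t) b (axis_pt s) -> H (axis_pt s) = v].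
have nav : \forall s \near t, Q s.
  have na' := cA _ na; have nv' := cA _ nv.
  by near=> s; split; near: s.
have dbl s : on_axis n (s *: e) i j o -> double_points S (axis_pt s).
  by move=> axs; exists (sheet ch i (s *: e)), (sheet ch j (s *: e)); exact: on_axis_double axs.
have navl : \forall s \near t^'-, Q s by exact: cvg_within nav.
have navr : \forall s \near t^'+, Q s by exact: cvg_within nav.
case br : (b (+) reversed).
  have [s [[axs ha hv] us]] := filter_ex (filterI navl decr).
  have oe : on_end S (axis_pt t) b (axis_pt s).
    by apply/oE; rewrite br expr1 mulN1r oppr_gt0.
  by rewrite -(ha (dbl s axs) oe) (hv (dbl s axs) oe).
have [s [[axs ha hv] us]] := filter_ex (filterI navr incr).
have oe : on_end S (axis_pt t) b (axis_pt s).
  by apply/oE; rewrite br expr0 mul1r.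
by rewrite -(ha (dbl s axs) oe) (hv (dbl s axs) oe).
Unshelve. all: by end_near. Qed.

Lemma jump_axis H t vr vl :
  (\forall s \near t, on_axis n (s *: e) i j o) ->
  (\forall s \near t^'+, H (axis_pt s) = vr) ->
  (\forall s \near t^'-, H (axis_pt s) = vl) ->
  jump H (axis_pt t) = if reversed then vl - vr else vr - vl.
Proof.
by move=> h1 h2 h3; rewrite /jump !(end_value_axis _ h1 h2 h3) /=; case: reversed.
Qed.

End Axis.
End Jumps.

Definition step_off (R : realType) (A : Type) (S : set 'rV[R]_4) (H : 'rV[R]_3 -> A)
    (Q : seq 'rV[R]_3) :=
  forall q, double_points S q -> q \notin Q ->
    \forall p \near q, double_points S p -> H p = H q.

(** The box is smaller than the chart, so that a function supported in it
    vanishes near the ends of the axes. *)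
Definition box (R : realType) (S : oriented_closed_surface R) n
    (ch : plane_chart S n) : set 'rV[R]_3 :=
  [set q | dom ch q /\ forall l, `|co ch q 0 l| <= 1 / 2].

Lemma double_axis (R : realType) (S : oriented_closed_surface R) n
    (ch : plane_chart S n) (q : 'rV[R]_3) : normal_plane_chart ch ->
  double_points S q -> dom ch q ->
  exists i j k : 'I_3, [/\ (i < j < n)%N, k != i /\ k != j, -1 < co ch q 0 k < 1,
    q = axis_pt ch k (co ch q 0 k) & (k < n)%N -> co ch q 0 k != 0].
Proof.
move=> nch [xB [xT dp]] dq; have [cq eq] := co_cube dq; rewrite -eq in dp.
have [i [j [/andP[ij j_n] zi zj _ az]]] := double_point_sheets nch cq dp.
have [k [ki kj]] : exists k : 'I_3, k != i /\ k != j.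
  have i3 := ltn_ord i; have j3 := ltn_ord j.
  exists (inord (3 - i - j)); rewrite -!val_eqE /= inordK; last by lia.
  by split; lia.
exists i, j, k; split=> //; first by rewrite ij.
- by have := cq k; rewrite ltr_norml.
- rewrite -{1}eq /axis_pt; congr (pt ch _); apply/rowP => l; rewrite !mxE eqxx /=.
  have [->|lk] := eqVneq l k; first by rewrite mulr1.
  rewrite mulr0; have [->|li] := eqVneq l i; first exact: zi.
  have [->|lj] := eqVneq l j; first exact: zj.
  move: lk li lj ij ki kj; rewrite -!val_eqE /=.
  have := ltn_ord l; have := ltn_ord i; have := ltn_ord j; have := ltn_ord k; lia.
- by move=> k_n; apply/eqP => /(az k k_n)[/eqP|/eqP]; rewrite ?(negPf ki) ?(negPf kj).
Qed.

Section Totals.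
Context {R : realType} {A : zmodType} (S : oriented_closed_surface R).
Context (n : nat) (ch : plane_chart S n).
Hypothesis nch : normal_plane_chart ch.
Variables (H : 'rV[R]_3 -> A) (Q : seq 'rV[R]_3).
Hypothesis uQ : uniq Q.
Hypothesis sH : step_off S H Q.

Let e (k : 'I_3) : 'rV[R]_3 := delta_mx 0 k.

Lemma axis_cube k t : -1 < t < 1 -> cube R 3 (t *: e k).
Proof.
move=> t1 l; rewrite !mxE eqxx /=; case: eqP => _; rewrite ?mulr1 ?mulr0 ?normr0 //.
by rewrite ltr_norml.
Qed.

Lemma axis_pt_co k t : -1 < t < 1 ->
  dom ch (axis_pt ch k t) /\ co ch (axis_pt ch k t) = t *: e k.
Proof. by move=> /(axis_cube k); exact: pt_dom. Qed.

Lemma axis_pt_inj k k' t t' : -1 < t < 1 -> -1 < t' < 1 -> t != 0 ->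
  axis_pt ch k t = axis_pt ch k' t' -> k = k' /\ t = t'.
Proof.
move=> t1 t1' t0 /(congr1 (co ch)).
rewrite (axis_pt_co k t1).2 (axis_pt_co k' t1').2 => /rowP /(_ k).
rewrite !mxE !eqxx /= mulr1; case: eqP => [-> tt|_]; first by rewrite tt mulr1.
by move/eqP; rewrite mulr0 (negPf t0).
Qed.

Definition arc k (a b : R) (q : 'rV[R]_3) : bool :=
  `[< exists2 t, a < t < b & q = axis_pt ch k t >].

(** The jumps on an arc of an axis are, up to the orientation of the axis, the
    jumps of a step function of the coordinate, and they telescope. *)
Lemma arc_total i j k o a b va vb : k != i -> k != j -> -1 <= a -> a < b -> b <= 1 ->
  (forall t, a < t < b -> on_axis n (t *: e k) i j o) ->
  (\forall s \near a^'+, H (axis_pt ch k s) = va) ->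
  (\forall s \near b^'-, H (axis_pt ch k s) = vb) ->
  \sum_(q <- Q | arc k a b q) jump S H q =
    if reversed ch k then va - vb else vb - va.
Proof.
move=> ki kj a1 ab b1 ax ha hb.
pose f t := H (axis_pt ch k t).
have in1 t : a < t < b -> -1 < t < 1 by move=> ?; lra.
pose E := [seq co ch q 0 k | q <- Q & arc k a b q].
have coE t : a < t < b -> co ch (axis_pt ch k t) 0 k = t.
  by move=> /in1 t1; rewrite (axis_pt_co k t1).2 !mxE !eqxx mulr1.
have EP t : a < t < b -> (t \in E) = (axis_pt ch k t \in Q).
  move=> tab; apply/mapP/idP => [[q]|tQ].
    by rewrite mem_filter => /andP[/asboolP[s sab ->] sQ]; rewrite coE // => ->.
  exists (axis_pt ch k t); last by rewrite coE.
  by rewrite mem_filter tQ andbT; apply/asboolP; exists t.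
have Eab t : t \in E -> a < t < b.
  by move=> /mapP[q]; rewrite mem_filter => /andP[/asboolP[s sab ->] sQ] ->; rewrite coE.
have uE : uniq E.
  rewrite map_inj_in_uniq ?filter_uniq // => p q; rewrite !mem_filter.
  move=> /andP[/asboolP[s sab ->] _] /andP[/asboolP[t tab ->] _].
  by rewrite !coE // => ->.
have dbl t : a < t < b -> double_points S (axis_pt ch k t).
  move=> /ax axt; exists (sheet ch i (t *: e k)), (sheet ch j (t *: e k)).
  exact: on_axis_double axt.
have near_ab t : a < t < b -> \forall s \near t, a < s < b.
  move=> /andP[at_ tb]; near=> s; apply/andP; split; near: s.
    exact: lt_nbhsr.
  exact: lt_nbhsl.
have sf : step_on f E a b.
  move=> t tab; rewrite EP // => tQ; have [_ ct _ _ _] := ax t tab.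
  have := near_axis_pt ct (sH (dbl t tab) tQ).
  move=> hn; near=> s.
  have sab : a < s < b by near: s; exact: near_ab.
  by apply: (_ : double_points S (axis_pt ch k s) -> H (axis_pt ch k s) = f t);
    [near: s; exact: hn|exact: dbl].
have germ t : a < t < b -> exists v : A * A, (\forall s \near t^'+, f s = v.1) /\
    (\forall s \near t^'-, f s = v.2).
  move=> tab; have [] := @step_right _ _ f E a b t sf; first by lra.
  move=> v1 h1; have [] := @step_left _ _ f E a b t sf; first by lra.
  by move=> v2 h2; exists (v1, v2).
have /choice[v hv] t : exists v : A * A, a < t < b ->
    (\forall s \near t^'+, f s = v.1) /\ (\forall s \near t^'-, f s = v.2).
  have [/germ[v hv]|_] := boolP (a < t < b); first by exists v.
  by exists (0, 0).
have tel := step_telescope ab uE Eab sf ha hb (fun t tE => hv t (Eab t tE)).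
have -> : \sum_(q <- Q | arc k a b q) jump S H q =
    \sum_(t <- E) (if reversed ch k then (v t).2 - (v t).1 else (v t).1 - (v t).2).
  rewrite big_map big_filter; apply: eq_bigr => q /asboolP[t tab ->].
  rewrite coE //; have [h1 h2] := hv t tab.
  apply: (jump_axis nch (o := o) ki kj _ h1 h2).
  by apply: filterS (near_ab t tab) => s; exact: ax.
case: reversed; last exact: tel.
by rewrite -[RHS]opprB -tel -sumrN; apply: eq_bigr => t _; rewrite opprB.
Unshelve. all: by end_near. Qed.

Hypothesis supH : forall q, ~ box ch q -> H q = 0.

Lemma axis_vanish k t : -1 < t < 1 -> 1 / 2 < `|t| -> H (axis_pt ch k t) = 0.
Proof.
move=> t1 t2; apply: supH => -[_ /(_ k)].
by rewrite (axis_pt_co k t1).2 !mxE !eqxx mulr1 leNgt t2.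
Qed.

Lemma axis_vanish_right k : \forall s \near (1 : R)^'-, H (axis_pt ch k s) = 0.
Proof.
have h : \forall s \near (1 : R)^'-, 1 / 2 < s < 1.
  near=> s; apply/andP; split; near: s; last exact: nbhs_left_lt.
  by apply: nbhs_left_gt; lra.
apply: filterS h => s hs; apply: axis_vanish; first by lra.
by rewrite ger0_norm; lra.
Unshelve. all: by end_near. Qed.

Lemma axis_vanish_left k : \forall s \near (-1 : R)^'+, H (axis_pt ch k s) = 0.
Proof.
have h : \forall s \near (-1 : R)^'+, -1 < s < - (1 / 2).
  near=> s; apply/andP; split; near: s; first exact: nbhs_right_gt.
  by apply: nbhs_right_lt; lra.
apply: filterS h => s hs; apply: axis_vanish; first by lra.
by rewrite ltr0_norm; lra.
Unshelve. all: by end_near. Qed.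

(** The double points form a single axis, and [H] vanishes near both its
    ends. *)
Lemma total_jump2 : n = 2%N ->
  \sum_(q <- Q | `[< double_points S q >] && `[< dom ch q >]) jump S H q = 0.
Proof.
move=> n2; pose i : 'I_3 := inord 0; pose j : 'I_3 := inord 1; pose k : 'I_3 := inord 2.
have ki : k != i by rewrite -val_eqE /= !inordK.
have kj : k != j by rewrite -val_eqE /= !inordK.
have ax t : -1 < t < 1 -> on_axis n (t *: e k) i j (fun=> true).
  move=> t1; split.
  - by rewrite n2 !inordK.
  - exact: axis_cube.
  - by rewrite !mxE eq_sym (negPf ki) andbF mulr0.
  - by rewrite !mxE eq_sym (negPf kj) andbF mulr0.
  move=> l l2; rewrite -!val_eqE /= !inordK //; lia.
have l11 : -1 < 1 :> R by lra.
have E := arc_total ki kj (lexx _) l11 (lexx _) ax (axis_vanish_left k) (axis_vanish_right k).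
rewrite subrr if_same in E; rewrite -[RHS]E; apply: eq_bigl => q; apply/andP/asboolP.
  move=> [/asboolP dq /asboolP dmq].
  have [i' [j' [k' [/andP[ij' j2] [ki' kj'] t1 eq _]]]] := double_axis nch dq dmq.
  have ek : k' = k.
    apply/val_inj; rewrite /= inordK //; move: ij' j2 ki' kj'; rewrite n2 -!val_eqE /=.
    have := ltn_ord k'; lia.
  by exists (co ch q 0 k'); rewrite // {1}eq ek.
move=> [t t1 ->]; split; apply/asboolP; last exact: (axis_pt_co k t1).1.
exists (sheet ch i (t *: e k)), (sheet ch j (t *: e k)).
exact: on_axis_double (ax t t1).
Qed.

End Totals.

(** The two coordinate planes whose intersection is the [k]-th axis. *)
Definition lower (k : 'I_3) : 'I_3 := if k == inord 0 then inord 1 else inord 0.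
Definition upper (k : 'I_3) : 'I_3 := if k == inord 2 then inord 1 else inord 2.

Lemma lower_upperP k : [/\ (lower k < upper k < 3)%N, k != lower k & k != upper k].
Proof.
rewrite /lower /upper -!val_eqE /= !inordK //.
by case: k => -[|[|[|//]]] k3 /=; rewrite !inordK.
Qed.

Lemma half_axis (R : realType) (k : 'I_3) (b : bool) t :
  (if b then 0 < t < 1 else -1 < t < 0) ->
  on_axis 3 (t *: delta_mx 0 k : 'rV[R]_3) (lower k) (upper k) (fun=> b).
Proof.
have [lu kl ku] := lower_upperP k => tb.
have t1 : -1 < t < 1 by move: tb; case: b; lra.
split=> //.
- exact: axis_cube.
- by rewrite !mxE eq_sym (negPf kl) andbF mulr0.
- by rewrite !mxE eq_sym (negPf ku) andbF mulr0.
move=> l _ ll lu'; have -> : l = k.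
  apply/val_inj; move: ll lu' kl ku lu; rewrite -!val_eqE /=.
  have := ltn_ord l; have := ltn_ord k; lia.
rewrite !mxE !eqxx mulr1; case: b tb => tb; rewrite ?expr0 ?expr1 ?mul1r ?mulN1r; lra.
Qed.

Section TripleTotal.
Context {R : realType} {A : zmodType} (S : oriented_closed_surface R).
Context (ch : plane_chart S 3).
Hypothesis nch : normal_plane_chart ch.
Variables (H : 'rV[R]_3 -> A) (Q : seq 'rV[R]_3).
Hypothesis uQ : uniq Q.
Hypothesis sH : step_off S H Q.
Hypothesis supH : forall q, ~ box ch q -> H q = 0.

Let ends (b : bool) : R * R := if b then (0, 1) else (-1, 0).
Let harc (kb : 'I_3 * bool) := arc ch kb.1 (ends kb.2).1 (ends kb.2).2.

Let endsP b t : (ends b).1 < t < (ends b).2 ->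
  [/\ -1 < t < 1, t != 0, b = (0 < t) &
   if b then 0 < t < 1 else -1 < t < 0].
Proof.
case: b => /= /andP[t0 t1].
  by split; rewrite ?t0 ?t1 ?gt_eqF //; lra.
by split; rewrite ?t0 ?t1 ?lt_eqF //; [lra | apply/esym/negbTE; rewrite -leNgt ltW].
Qed.

(** The double points form six open half axes. On each of them [H] vanishes near
    the outer end, and has the value [v k b] near the triple point. *)
Lemma total_jump3 (v : 'I_3 -> bool -> A) :
  (forall k, \forall s \near (0 : R)^'+, H (axis_pt ch k s) = v k true) ->
  (forall k, \forall s \near (0 : R)^'-, H (axis_pt ch k s) = v k false) ->
  \sum_(q <- Q | `[< double_points S q >] && `[< dom ch q >]) jump S H q =
  \sum_k (if reversed ch k then v k true - v k false else v k false - v k true).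
Proof.
move=> hr hl.
transitivity (\sum_(kb : 'I_3 * bool) \sum_(q <- Q | harc kb q) jump S H q); last first.
  rewrite -(pair_bigA _ (fun k b => \sum_(q <- Q | harc (k, b) q) jump S H q)) /=.
  apply: eq_bigr => k _; rewrite big_bool /harc /=.
  have [lu kl ku] := lower_upperP k.
  rewrite (arc_total nch uQ sH kl ku _ ltr01 (lexx _) (fun t => @half_axis R k true t)
    (hr k) (axis_vanish_right supH k)); last by lra.
  rewrite (arc_total nch uQ sH kl ku (lexx _) _ _ (fun t => @half_axis R k false t)
    (axis_vanish_left supH k) (hl k)); [|by lra..].
  by case: reversed; rewrite subr0 sub0r // addrC.
under [RHS]eq_bigr do rewrite big_mkcond /=.
rewrite exchange_big /= big_mkcond /=; apply: eq_bigr => q _.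
case: ifPn => [/andP[/asboolP dq /asboolP dmq]|nq].
  have [i [j [k [_ _ t1 eq t0]]]] := double_axis nch dq dmq.
  have {}t0 := t0 (ltn_ord k); move: (co ch q 0 k) t1 eq t0 => t t1 eq t0.
  rewrite (bigD1 (k, 0 < t)) //= ifT; last first.
    apply/asboolP; exists t => //; move: t0 t1; rewrite /ends.
    by case: (ltgtP 0 t) => //= h _; rewrite h ?andbT // => /andP[].
  rewrite big1 ?addr0 // => -[k' b'] /= ne; case: ifP => // /asboolP[t' /= tb' eq'].
  have [t1' t0' eb' _] := endsP tb'.
  have [ek et] := axis_pt_inj t1 t1' t0 (etrans (esym eq) eq').
  by move: ne; rewrite ek et eb' eqxx.
rewrite big1 // => -[k b] _; case: ifP => // /asboolP[t /= tb eq].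
have [t1 _ _ tb'] := endsP tb; case/negP: nq; rewrite eq.
apply/andP; split; apply/asboolP; last exact: (axis_pt_co ch k t1).1.
have ax := half_axis k tb'.
exists (sheet ch (lower k) (t *: delta_mx 0 k)), (sheet ch (upper k) (t *: delta_mx 0 k)).
exact: on_axis_double ax.
Qed.

End TripleTotal.

(** * Branch points *)

Section Whitney.
Context {R : realType}.

Definition vec3 (a b c : R) : 'rV[R]_3 := \row_j [:: a; b; c]`_j.
Definition vec2 (a b : R) : 'rV[R]_2 := \row_j [:: a; b]`_j.

Let whitney := @whitney_umbrella R.

Lemma whitneyE (u : 'rV[R]_2) : whitney u =
  u 0 0 *: vec3 1 0 0 + (u 0 0 * u 0 1) *: vec3 0 1 0 + (u 0 1 * u 0 1) *: vec3 0 0 1.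
Proof.
apply/rowP => -[[|[|[|//]]] ?]; rewrite !mxE /=; ring.
Qed.

Lemma whitney_differentiable u : differentiable whitney u.
Proof.
have -> : whitney = fun u : 'rV[R]_2 =>
    u 0 0 *: vec3 1 0 0 + (u 0 0 * u 0 1) *: vec3 0 1 0 + (u 0 1 * u 0 1) *: vec3 0 0 1.
  by apply/funext => w; rewrite whitneyE.
have d0 := @differentiable_coord R 1 2 u 0 0.
have d1 := @differentiable_coord R 1 2 u 0 1.
apply: differentiableD; first apply: differentiableD.
- exact: differentiableZl.
- by apply: differentiableZl; exact: differentiableM.
- by apply: differentiableZl; exact: differentiableM.
Qed.

Lemma jac_whitney (s t : R) :
  jac whitney (vec2 s t) = col_mx (vec3 1 t 0) (vec3 0 s (2 * t)).
Proof.
have dw := whitney_differentiable (vec2 s t).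
have row0 : vec2 1 0 *m jac whitney (vec2 s t) = vec3 1 t 0.
  rewrite -derive_jac //; apply: cvg_lim => //.
  apply: cvg_near_cst; near=> h; have h0 : h != 0 by near: h; exact: nbhs_dnbhs_neq.
  by rewrite !whitneyE; apply/rowP => -[[|[|[|//]]] ?]; rewrite !mxE /=; field.
have row1 : vec2 0 1 *m jac whitney (vec2 s t) = vec3 0 s (2 * t).
  rewrite -derive_jac //; apply: cvg_lim => //.
  have lm : vec3 0 s (2 * t) + h *: vec3 0 0 1 @[h --> 0^'] --> vec3 0 s (2 * t).
    have e0 : vec3 0 s (2 * t) = vec3 0 s (2 * t) + 0 *: vec3 0 0 1 by rewrite scale0r addr0.
    rewrite [X in _ --> X]e0; apply: cvgD; first exact: cvg_cst.
    by apply: cvgZr_tmp; exact: cvg_within.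
  apply: cvg_trans lm; apply: near_eq_cvg; near=> x.
  have x0 : x != 0 by near: x; exact: nbhs_dnbhs_neq.
  by rewrite !whitneyE; apply/rowP => -[[|[|[|//]]] ?]; rewrite !mxE /=; field.
have rE (M : 'M[R]_(2, 3)) i : row i M = delta_mx 0 i *m M by exact: rowE.
apply/row_matrixP => i; rewrite rE.
case: i => -[|[|//]] i2.
  have -> : delta_mx 0 (Ordinal i2) = vec2 1 0.
    by apply/rowP => -[[|[|//]] ?]; rewrite !mxE.
  rewrite row0; apply/rowP => j; rewrite [RHS]mxE.
  have -> : (Ordinal i2 : 'I_(1 + 1)) = lshift 1 (ord0 : 'I_1) by exact/val_inj.
  by rewrite (@col_mxEu R 1 1 3).
have -> : delta_mx 0 (Ordinal i2) = vec2 0 1.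
  by apply/rowP => -[[|[|//]] ?]; rewrite !mxE.
rewrite row1; apply/rowP => j; rewrite [RHS]mxE.
have -> : (Ordinal i2 : 'I_(1 + 1)) = rshift 1 (ord0 : 'I_1) by exact/val_inj.
by rewrite (@col_mxEd R 1 1 3).
Unshelve. all: by end_near. Qed.

End Whitney.

Section WhitneyChart.
Context {R : realType} (S : oriented_closed_surface R).
Context (W : set 'rV[R]_3) (h g : 'rV[R]_3 -> 'rV[R]_3).
Context (phi : 'rV[R]_2 -> 'rV[R]_4).
Hypothesis oW : open W.
Hypothesis sh : smooth_on W h.
Hypothesis sg : smooth_on (cube R 3) g.
Hypothesis hg : forall q, W q -> cube R 3 (h q) /\ g (h q) = q.
Hypothesis gh : forall z, cube R 3 z -> W (g z) /\ h (g z) = z.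
Hypothesis pphi : local_parametrization S (cube R 2) phi.
Hypothesis pm : forall u, cube R 2 u ->
  W (proj (phi u)) /\ h (proj (phi u)) = whitney_umbrella u.
Hypothesis cov : forall x, carrier S x -> W (proj x) ->
  exists2 u, cube R 2 u & phi u = x.

Lemma cube_vec2 (s t : R) : `|s| < 1 -> `|t| < 1 -> cube R 2 (vec2 s t).
Proof. by move=> s1 t1 -[[|[|//]] ?]; rewrite mxE. Qed.

Lemma cube_vec3 (a b c : R) : `|a| < 1 -> `|b| < 1 -> `|c| < 1 -> cube R 3 (vec3 a b c).
Proof. by move=> a1 b1 c1 -[[|[|[|//]]] ?]; rewrite mxE. Qed.

Lemma whitney_axis (t : R) : whitney_umbrella (vec2 0 t) = vec3 0 0 (t * t).
Proof. by rewrite whitneyE; apply/rowP => -[[|[|[|//]]] ?]; rewrite !mxE /=; ring. Qed.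

Lemma mul_norm_lt1 (t : R) : `|t| < 1 -> `|t * t| < 1.
Proof.
move=> t1; rewrite normrM.
exact: le_lt_trans (ler_piMl (normr_ge0 t) (ltW t1)) t1.
Qed.

(** At the point [(0, t)] the umbrella has the tangent vectors [(1, t, 0)] and
    [(0, 0, 2 t)], hence the normal [(t, -1, 0)]. Its orientation relatively to
    the tangent vectors depends on the sign of [t]. Therefore the second
    component of the conormals changes sign between the two sheets, given by [t]
    and by [- t], that meet in the double line. *)
Lemma whitney_conormal : exists kappa : bool, forall t : R, `|t| < 1 -> t != 0 ->
  exists2 v, conormal S (phi (vec2 0 t)) v &
    0 < (-1) ^+ kappa * t * (v *m (jac g (vec3 0 0 (t * t)))^T) 0 (inord 1).
Proof.
have [b hb] := orientation_sign_constant pphi (@cube_connected R 2).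
have [d hd] := det_jac_sign sh sg gh.
exists (~~ (b (+) d)) => t t1 t0.
have cu : cube R 2 (vec2 0 t) by apply: cube_vec2; rewrite ?normr0.
set z := vec3 0 0 (t * t).
have cz : cube R 3 z by apply: cube_vec3; rewrite ?normr0 // mul_norm_lt1.
have := jac_sheet sg hg pphi pm cu (whitney_differentiable _).
rewrite jac_whitney whitney_axis -/z.
have AH := jac_invK sh sg gh cz; have HA := mulmx1C AH.
have {hd} := hd z cz.
move: (jac g z) (jac h (g z)) AH HA => A H AH HA hd eG.
(* [w] is the normal [(t, -1, 0)] scaled so that its second component [w1] has
   the required sign. *)
pose kappa := ~~ (b (+) d); pose w1 := (-1) ^+ kappa * t.
pose w := vec3 (- (t * w1)) w1 0.
have wA : w *m H^T *m A^T = w by rewrite -mulmxA -trmx_mul AH trmx1 mulmx1.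
exists (w *m H^T); last first.
  rewrite wA mxE /= inordK // /w1 mulrACA -signr_addb addbb mul1r.
  by rewrite -expr2 lt_neqAle sqr_ge0 eq_sym sqrf_eq0 t0.
apply/(conormalP pphi cu (hb _ cu)); rewrite eG; split.
  rewrite trmx_mul mulmxA wA (@tr_col_mx R 1 1 3) (@mul_mx_row R 1 3 1 1).
  have E0 : w *m (vec3 1 t 0)^T = 0.
    apply/rowP => l; rewrite !mxE !big_ord_recl big_ord0 !mxE /=; ring.
  have E1 : w *m (vec3 0 0 (2 * t))^T = 0.
    apply/rowP => l; rewrite !mxE !big_ord_recl big_ord0 !mxE /=; ring.
  by rewrite E0 E1 (@row_mx0 R 1 1 1).
set x := w *m H^T *m H.
have vx : w *m H^T = x *m A by rewrite /x -[RHS]mulmxA HA mulmx1.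
have -> : \det (col_mx (w *m H^T) (col_mx (vec3 1 t 0) (vec3 0 0 (2 * t)) *m A) : 'M[R]_3) =
    2 * t * (t * x 0 (inord 0) - x 0 (inord 1)) * \det A.
  rewrite (@mul_col_mx R 1 1 3 3) vx det_rows3_mul; congr (_ * _).
  rewrite det_rows3 /= !mxE !inordK //=; ring.
pose n := vec3 t (-1) 0; pose nH := n *m H^T.
have wn : w = - w1 *: n.
  by apply/rowP => -[[|[|[|//]]] ?]; rewrite !mxE /=; ring.
have -> : t * x 0 (inord 0) - x 0 (inord 1) = - w1 * \sum_k nH 0 k ^+ 2.
  have -> : t * x 0 (inord 0) - x 0 (inord 1) = (x *m n^T) 0 0.
    rewrite [RHS]mxE !big_ord_recl big_ord0 ![n^T _ _]mxE ![n _ _]mxE /=.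
    have -> : (inord 0 : 'I_3) = ord0 by apply/val_inj; rewrite /= inordK.
    have -> : (inord 1 : 'I_3) = lift ord0 ord0 by apply/val_inj; rewrite /= inordK.
    by ring.
  rewrite /x wn -!scalemxAl [LHS]mxE; congr (_ * _).
  have -> : n *m H^T *m H *m n^T = nH *m nH^T by rewrite /nH trmx_mul trmxK !mulmxA.
  by rewrite mxE; apply: eq_bigr => k _; rewrite [nH^T _ _]mxE expr2.
have c0 : 0 < \sum_k nH 0 k ^+ 2.
  rewrite lt_neqAle sumr_ge0 ?andbT => [|k _]; last exact: sqr_ge0.
  rewrite eq_sym; apply/eqP => s0.
  have nH0 : nH = 0.
    apply/rowP => k; apply/eqP; rewrite [X in _ == X]mxE -sqrf_eq0.
    have /eqP := s0; rewrite psumr_eq0 => [/allP|l _]; last exact: sqr_ge0.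
    by move=> /(_ k); rewrite mem_index_enum => /(_ isT).
  have : nH *m A^T = 0 by rewrite nH0 mul0mx.
  rewrite /nH -mulmxA -trmx_mul AH trmx1 mulmx1 => /rowP /(_ (inord 1)).
  by rewrite !mxE /= inordK //= => /eqP; rewrite oppr_eq0 oner_eq0.
move: (\sum_k _) c0 (\det A) hd => c c0 a a0.
have -> : (-1) ^+ b * (2 * t * (- w1 * c) * a) =
   ((-1) ^+ b * (-1) ^+ d * - (-1) ^+ kappa) * (2 * (t * t) * c * ((-1) ^+ d * a)).
  have s2 : (-1) ^+ d * (-1) ^+ d = 1 :> R by rewrite -signr_addb addbb.
  rewrite /w1; move: s2; move: ((-1) ^+ d) => s s2.
  transitivity ((s * s) * ((-1) ^+ b * (2 * t * (- ((-1) ^+ kappa * t) * c) * a))).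
    by rewrite s2 mul1r.
  by ring.
have -> : (-1) ^+ b * (-1) ^+ d * - (-1) ^+ kappa = 1 :> R.
  rewrite /kappa -signr_addb; case: (b (+) d) => /=; rewrite ?expr0 ?expr1; ring.
have tt : 0 < t * t by rewrite -expr2 lt_neqAle sqr_ge0 eq_sym sqrf_eq0 t0.
by rewrite mul1r; do 3![apply: mulr_gt0 => //].
Qed.

(** The umbrella [(s, s t, t^2)] identifies two parameters only if [s = 0] and
    their values of [t] are opposite. *)
Lemma whitney_pair q xB xT : W q -> carrier S xB -> carrier S xT ->
  proj xB = q -> proj xT = q -> height xB < height xT -> exists t,
  [/\ `|t| < 1, t != 0, h q = vec3 0 0 (t * t) &
      xB = phi (vec2 0 t) /\ xT = phi (vec2 0 (- t))].
Proof.
move=> Wq SB ST pB pT hBT.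
have WB : W (proj xB) by rewrite pB.
have WT : W (proj xT) by rewrite pT.
have [u cu eu] := cov SB WB; have [u' cu' eu'] := cov ST WT.
have [_ mu] := pm cu; have [_ mu'] := pm cu'.
rewrite eu pB in mu; rewrite eu' pT in mu'.
have uE (w : 'rV[R]_2) : w = vec2 (w 0 0) (w 0 1).
  apply/rowP => -[[|[|//]] ?]; rewrite !mxE /=; congr (w _ _); exact/val_inj.
have e0 : u 0 0 = u' 0 0.
  by have := congr1 (fun z : 'rV[R]_3 => z 0 (inord 0)) (etrans (esym mu) mu');
    rewrite !mxE inordK.
have e1 : u 0 0 * u 0 1 = u' 0 0 * u' 0 1.
  by have := congr1 (fun z : 'rV[R]_3 => z 0 (inord 1)) (etrans (esym mu) mu');
    rewrite !mxE inordK.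
have e2 : u 0 1 ^+ 2 = u' 0 1 ^+ 2.
  by have := congr1 (fun z : 'rV[R]_3 => z 0 (inord 2)) (etrans (esym mu) mu');
    rewrite !mxE inordK.
have ne : u 0 1 != u' 0 1.
  apply: contraTneq hBT => e01; rewrite -eu -eu' (uE u) (uE u') e0 e01 ltxx //.
have em : u' 0 1 = - u 0 1.
  have /eqP := e2; rewrite eqf_sqr (negPf ne) /= => /eqP ->.
  by rewrite opprK.
have t0 : u 0 1 != 0 by apply: contra ne => /eqP u0; rewrite em u0 oppr0.
have s0 : u 0 0 = 0.
  have /eqP : u 0 0 * (u 0 1 - u' 0 1) = 0 by rewrite mulrBr e1 e0 subrr.
  by rewrite mulf_eq0 subr_eq0 (negPf ne) orbF => /eqP.
exists (u 0 1); split=> //.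
  by rewrite mu (uE u) s0 whitney_axis !mxE.
by rewrite -eu -eu' {1}(uE u) (uE u') -e0 s0 em.
Qed.

Lemma double_pointE q xB xT : double_point S q xB xT ->
  [/\ carrier S xB, carrier S xT, proj xB = q, proj xT = q & height xB < height xT].
Proof.
move=> [hBT e].
have [SB pB] : (carrier S `&` @proj R @^-1` [set q]) xB by rewrite e; left.
by have [ST pT] : (carrier S `&` @proj R @^-1` [set q]) xT by rewrite e; right.
Qed.

Lemma whitney_double q xB xT : W q -> double_point S q xB xT -> exists t,
  [/\ `|t| < 1, t != 0, h q = vec3 0 0 (t * t) &
      xB = phi (vec2 0 t) /\ xT = phi (vec2 0 (- t))].
Proof. by move=> Wq /double_pointE[SB ST pB pT]; exact: whitney_pair. Qed.

Lemma whitney_no_triple q : W q -> ~ triple_points S q.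
Proof.
move=> Wq [xB [xM [xT [hBM hMT e]]]].
have P x : [set xB; xM; xT] x -> carrier S x /\ proj x = q.
  by rewrite -e => -[Sx px].
have [SB pB] : _ := P xB (or_introl (or_introl erefl)).
have [SM pM] : _ := P xM (or_introl (or_intror erefl)).
have [ST pT] : _ := P xT (or_intror erefl).
have [t [t1 _ _ [eB eM]]] := whitney_pair Wq SB SM pB pM hBM.
have [t' [t1' _ _ [eM' eT]]] := whitney_pair Wq SM ST pM pT hMT.
have inj : {in cube R 2 &, injective phi} by case: pphi.
have /inj : phi (vec2 0 (- t)) = phi (vec2 0 t') by rewrite -eM -eM'.
rewrite !inE => /(_ _ _)/rowP /(_ (inord 1)).
rewrite !mxE !inordK //= => e'; suff : height xT = height xB.
  by have := lt_trans hBM hMT => + e2; rewrite e2 ltxx.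
by rewrite eT eB -e' ?opprK //; apply: cube_vec2; rewrite ?normr0 ?normrN.
Qed.

(** The region that surrounds the pinch point; the point that selects it has
    negative third coordinate. *)
Definition umbrella_outside : set 'rV[R]_3 := connected_component
  (~` (@proj R @` S)) (g (vec3 0 0 (- (1 / 2)))).

(** On the umbrella the second coordinate is bounded by the first one, and the
    third is nonnegative. This part of the complement is star-shaped around
    [(0, 0, -1/2)], hence connected, and it contains the quadrants on both sides
    of the double line in the direction of the second coordinate. *)
Let below := [set z : 'rV[R]_3 | cube R 3 z /\
  (`|z 0 (inord 0)| < `|z 0 (inord 1)| \/ z 0 (inord 2) < 0)].

Let below_c : below (vec3 0 0 (- (1 / 2))).
Proof.
split; last by right; rewrite mxE inordK //=; lra.
by apply: cube_vec3; rewrite ?normr0 // normrN ger0_norm; lra.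
Qed.

Lemma below_connected : connected below.
Proof.
apply: (@star_connected _ _ _ (vec3 0 0 (- (1 / 2)))) => z t [cz hz] /andP[t0 t1].
set c := vec3 _ _ _.
have E k : (c + t *: (z - c)) 0 k = (1 - t) * c 0 k + t * z 0 k.
  by rewrite !mxE; ring.
have [cc _] := below_c; split=> [k|].
  rewrite E; apply: le_lt_trans (ler_normD _ _) _; rewrite !normrM.
  rewrite (ger0_norm t0) ger0_norm ?subr_ge0 //.
  by have := cc k; have := cz k; rewrite -/c; move: (`|z 0 k|) (`|c 0 k|) => a b;
    case: (leP a b); nra.
rewrite !E; have -> : c 0 (inord 0) = 0 by rewrite mxE inordK.
have -> : c 0 (inord 1) = 0 by rewrite mxE inordK.
have -> : c 0 (inord 2) = - (1 / 2) by rewrite mxE inordK.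
rewrite !mulr0 !add0r !normrM.
case: hz => [hz|hz].
  have [->|tn0] := eqVneq t 0; first by right; rewrite subr0 mul0r; lra.
  by left; rewrite ltr_pM2l // normr_gt0.
right; move: (z 0 (inord 2)) hz => a a0; nra.
Qed.

Lemma below_free z : below z -> (~` (@proj R @` S)) (g z).
Proof.
move=> [cz hz] [x Sx px]; have [Wg hgz] := gh cz.
have Wx : W (proj x) by rewrite px.
have [u cu eu] := cov Sx Wx.
have [_ mu] := pm cu; rewrite eu px hgz in mu.
move: hz; rewrite mu !mxE !inordK //= => -[|]; last first.
  by rewrite ltNge sqr_ge0.
by rewrite normrM ltNge ler_piMr // ltW // cu.
Qed.

Lemma below_region z : below z -> umbrella_outside (g z).
Proof.
move=> bz; apply: (@connected_component_max _ _ (g @` below)).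
- by exists (vec3 0 0 (- (1 / 2))).
- by move=> _ [w ow <-]; exact: below_free ow.
- apply: connected_continuous_connected below_connected _.
  apply: continuous_in_subspaceT => w /set_mem[cw _].
  by apply: differentiable_continuous; exact: (sg [::] cw).
- by exists z.
Qed.

(** Moving from a point of the double line in either direction of the second
    coordinate leads to [below], on opposite sides of the two sheets by
    [whitney_conormal]. So the second and the fourth region at the edge are the
    same. *)
Lemma umbrella_outside_near q xB xT b : W q -> double_point S q xB xT ->
  region_near S q [:: (xB, b); (xT, ~~ b)] umbrella_outside.
Proof.
move=> Wq dp; have [t [t1 t0 hq [eB eT]]] := whitney_double Wq dp.
have [kappa hk] := whitney_conormal.
split; first by exists (g (vec3 0 0 (- (1 / 2)))) => //; exact: below_free below_c.
set z := vec3 0 0 (t * t) in hq.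
have cz : cube R 3 z by rewrite -hq; exact: (hg Wq).1.
have qz : q = g z by rewrite -hq; rewrite (hg Wq).2.
set A := jac g z.
pose tau := (-1) ^+ kappa * t.
have tau0 : tau != 0 by rewrite mulf_neq0 // signr_eq0.
(* The sign of the second coordinate of a direction that points to the side [b]
   of the lower sheet; it then points to the side [~~ b] of the upper one. *)
have [si [si2 sin sit]] : exists si : R, [/\ si * si = 1, `|si| = 1 &
    if b then 0 < si * tau else si * tau < 0].
  exists ((-1) ^+ (b (+) (0 < tau))); split.
  - by rewrite -signr_addb addbb.
  - exact: normr_sign.
  move: tau0; case: (ltgtP 0 tau) => //= h0 _; case: (b);
    by rewrite /= ?expr0 ?expr1 ?mul1r ?mulN1r ?oppr_gt0 ?oppr_lt0.
pose w : 'rV[R]_3 := (si *: delta_mx 0 (inord 1)) *m A.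
have wv (v : 'rV[R]_3) : (w *m v^T) 0 0 = si * (v *m A^T) 0 (inord 1).
  rewrite /w -!scalemxAl mxE -rowE; congr (_ * _).
  by rewrite !mxE; apply: eq_bigr => k _; rewrite !mxE mulrC.
exists w; split.
  move=> p; rewrite !inE => /orP[/eqP ->|/eqP ->] /=.
    have [v cv hv] := hk t t1 t0; exists v; first by rewrite eB.
    rewrite wv; move: hv; rewrite -/z -/A -/tau; move: (_ 0 (inord 1)) => m tm.
    have : 0 < (si * m) * (si * tau) by rewrite mulrACA si2 mul1r mulrC.
    by case: (b) sit => st /=; [rewrite pmulr_lgt0 | rewrite nmulr_lgt0].
  have [|| v cv hv] := hk (- t); rewrite ?normrN ?oppr_eq0 //.
  exists v; first by rewrite eT.
  rewrite wv; move: hv; rewrite mulrNN -/z -/A mulrN mulNr oppr_gt0 -/tau.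
  move: (_ 0 (inord 1)) => m tm.
  have : (si * m) * (si * tau) < 0 by rewrite mulrACA si2 mul1r mulrC.
  by case: (b) sit => st /=; [rewrite pmulr_llt0 | rewrite nmulr_llt0].
have dh : differentiable h q := sh [::] Wq.
have wH : w *m jac h q = si *: delta_mx 0 (inord 1).
  by rewrite /w qz -mulmxA (jac_invK sh sg gh cz) mulmx1.
(* For [ep = 1] and [ep = -1] this bounds the first coordinate by the second
   one near the starting point of the direction [w]. *)
have key (ep : R) : \forall s \near 0^'+,
    0 < si * h (q + s *: w) 0 (inord 1) + ep * h (q + s *: w) 0 (inord 0).
  pose N : 'M[R]_3 := \matrix_(k, l) (if k == inord 1 then si else
    if k == inord 0 then ep else 0).
  have mulN (x : 'rV[R]_3) : (x *m N) 0 0 = si * x 0 (inord 1) + ep * x 0 (inord 0).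
    have i0 : (inord 0 : 'I_3) = ord0 by apply/val_inj; rewrite /= inordK.
    have i1 : (inord 1 : 'I_3) = lift ord0 ord0 by apply/val_inj; rewrite /= inordK.
    rewrite mxE !big_ord_recl big_ord0 ![N _ _]mxE i0 i1 /=; ring.
  have [dm jm] := mulmx_diff N (h q).
  have df := differentiable_comp dh dm.
  have := @differentiable_coord_sign R _ q w 0 false df.
  have wN : (w *m (jac h q *m N)) 0 0 = 1.
    rewrite mulmxA wH mulN !mxE !eqxx -val_eqE /= !inordK //= !mulr0 addr0 mulr1.
    exact: si2.
  rewrite (jacobian_comp dh dm) jm wN expr0 mul1r => /(_ ltr01); apply: filterS => s.
  have z0 : z 0 (inord 0) = 0 by rewrite mxE inordK.
  have z1 : z 0 (inord 1) = 0 by rewrite mxE inordK.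
  by rewrite /= !mulN hq z0 z1 !mulr0 addr0 subr0 ?mul1r.
have nW : \forall s \near 0^'+, W (q + s *: w).
  have cv : q + s *: w @[s --> 0^'+] --> q.
    rewrite -[X in _ --> X]addr0; apply: cvgD; first exact: cvg_cst.
    exact: cvg_scale_right0.
  exact: cv _ (open_nbhs_nbhs (conj oW Wq)).
have kp := key 1; have km := key (-1).
near=> s; have Ws : W (q + s *: w) by near: s.
have [cs gs] := hg Ws; rewrite -gs; apply: below_region; split=> //; left.
have : 0 < si * h (q + s *: w) 0 (inord 1) + 1 * h (q + s *: w) 0 (inord 0) by near: s.
have : 0 < si * h (q + s *: w) 0 (inord 1) + -1 * h (q + s *: w) 0 (inord 0) by near: s.
move: (h _ 0 (inord 1)) (h _ 0 (inord 0)) => x1 x0 e1 e2.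
apply: lt_le_trans (_ : si * x1 <= _); first by rewrite ltr_norml; lra.
by apply: le_trans (ler_norm _) _; rewrite normrM sin mul1r.
Unshelve. all: by end_near. Qed.

End WhitneyChart.

Lemma whitney_local_form (R : realType) (S : oriented_closed_surface R) (y : 'rV[R]_3) :
  local_form S y (fun _ : 'I_1 => @whitney_umbrella R) ->
  exists (W : set 'rV[R]_3) (h g : 'rV[R]_3 -> 'rV[R]_3)
    (phi : 'rV[R]_2 -> 'rV[R]_4),
    [/\ [/\ open W, smooth_on W h, smooth_on (cube R 3) g, W y & h y = 0],
      forall q, W q -> cube R 3 (h q) /\ g (h q) = q,
      forall z, cube R 3 z -> W (g z) /\ h (g z) = z,
      local_parametrization S (cube R 2) phi &
      (forall u, cube R 2 u -> W (proj (phi u)) /\ h (proj (phi u)) = whitney_umbrella u) /\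
      (forall x, carrier S x -> W (proj x) -> exists2 u, cube R 2 u & phi u = x)].
Proof.
move=> [W [h [phi [[oW _ sh [g [sg hg gh]]] [Wy hy] pphi mphi cov]]]].
exists W, h, g, (phi ord0); split=> //; split; first exact: mphi.
by move=> x Sx Wx; have [j [[u cu ux] _]] := cov x Sx Wx; exists u => //; move: ux; rewrite (ord1 j).
Qed.

(** * Functions on the double curves of a diagram *)

Section Generic.
Context {R : realType} (D : oriented_diagram R).
Implicit Types (q y : 'rV[R]_3).

Lemma double_point_image q : double_points D q -> (@proj R @` D) q.
Proof. by move=> [xB [xT /double_pointE[SB _ pB _ _]]]; exists xB. Qed.

Lemma triple_point_image q : triple_points D q -> (@proj R @` D) q.
Proof.
move=> [xB [xM [xT [_ _ e]]]].
have [SB pB] : (carrier D `&` @proj R @^-1` [set q]) xB by rewrite e; left; left.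
by exists xB.
Qed.

(** The center of a Whitney umbrella has one preimage, and the center of a chart
    with [n] sheets has [n] preimages. *)
Lemma double_point_chart q : double_points D q ->
  exists ch : plane_chart D 2, [/\ normal_plane_chart ch, dom ch q & co ch q = 0].
Proof.
move=> dq; have c0 := @cube0 R 3; have [xB [xT dp]] := dq.
have [[n n03 lf]|lf] := surface_generic (double_point_image dq); last first.
  have [W [h [g [phi [[oW sh sg Wq hq] hg gh pphi [pm cov]]]]]] := whitney_local_form lf.
  have [t [_ t0 + _]] := whitney_double pm cov Wq dp.
  rewrite hq => /rowP /(_ (inord 2)); rewrite !mxE inordK //= => /eqP.
  by rewrite eq_sym mulf_eq0 (negPf t0).
have [ch [nch dmq cq]] := normal_plane_chart_exists n03 lf.
have eq : pt ch 0 = q by rewrite -cq; exact: (co_cube dmq).2.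
rewrite -eq in dp.
have [i [j [/andP[ij j_n] _ _ _ az]]] := double_point_sheets nch c0 dp.
have n2 : n = 2%N.
  have n_gt1 : (1 < n)%N by apply: leq_ltn_trans j_n; apply: leq_ltn_trans ij.
  case: n n03 n_gt1 {lf ch nch dmq cq eq dp} j_n az => [|[|[|[|//]]]] //= _ _ _ az.
  have h (k : 'I_3) : k = i \/ k = j by apply: az => //; rewrite mxE.
  exfalso; have [] := h (inord (3 - i - j)) => /(congr1 val) /=; rewrite inordK;
    have := ltn_ord j; lia.
by move: ch nch dmq cq {eq dp az j_n lf n03}; rewrite n2 => ch; exists ch.
Qed.

Variables (k : comNzRingType) (X : choiceType) (T : X -> X -> X -> X).
Variable c : set 'rV[R]_3 -> X.

Let F := edge_color k T D c.

Lemma edge_color_out q : ~ double_points D q -> F q = 0.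
Proof. by move=> dq; rewrite /F /edge_color asboolF. Qed.

Let i0 : 'I_3 := inord 0.
Let i1 : 'I_3 := inord 1.
Let i2 : 'I_3 := inord 2.

Let ki : i2 != i0. Proof. by rewrite -val_eqE /= !inordK. Qed.
Let kj : i2 != i1. Proof. by rewrite -val_eqE /= !inordK. Qed.

Lemma full_axis t : `|t| < 1 ->
  on_axis 2 (t *: delta_mx 0 i2 : 'rV[R]_3) i0 i1 (fun=> true).
Proof.
rewrite ltr_norml => t1; split.
- by rewrite /i0 /i1 !inordK.
- exact: axis_cube.
- by rewrite !mxE eq_sym (negPf ki) andbF mulr0.
- by rewrite !mxE eq_sym (negPf kj) andbF mulr0.
by move=> l l2; rewrite -!val_eqE /= !inordK //; lia.
Qed.

Let near_full_axis : \forall s \near (0 : R),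
  on_axis 2 (s *: delta_mx 0 i2 : 'rV[R]_3) i0 i1 (fun=> true).
Proof.
have : \forall s \near (0 : R), `|s| < 1.
  exists 1 => /=; first exact: ltr01.
  by move=> s /=; rewrite sub0r normrN.
by apply: filterS => s; exact: full_axis.
Qed.

Let axis0 (ch : plane_chart D 2) q : dom ch q -> co ch q = 0 -> axis_pt ch i2 0 = q.
Proof. by move=> dq cq; rewrite /axis_pt scale0r -cq; exact: (co_cube dq).2. Qed.

Lemma edge_color_locally_constant q : double_points D q ->
  \forall p \near q, double_points D p -> F p = F q.
Proof.
move=> dq; have [ch [nch dmq cq]] := double_point_chart dq.
have eq := axis0 dmq cq.
have := near_double_point nch ki kj ltr01 (full_axis (t := 0) _).
rewrite normr0 eq => /(_ ltr01); apply: filterS => p h /h[s s1 ->].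
rewrite subr0 in s1; rewrite -eq.
rewrite /F (edge_colorE nch k T c (full_axis s1)).
by rewrite (edge_colorE nch k T c (full_axis _)) // normr0.
Qed.

Section Jump.
Variable A : zmodType.
Implicit Types (H : 'rV[R]_3 -> A).

(** The break points of [H] on the axis are finite in number, so that [H] is
    constant immediately to the left and to the right of the center. *)
Lemma step_germs H Q q (ch : plane_chart D 2) : normal_plane_chart ch ->
  step_off D H Q -> dom ch q -> co ch q = 0 ->
  exists vr vl, (\forall s \near (0 : R)^'+, H (axis_pt ch i2 s) = vr) /\
    (\forall s \near (0 : R)^'-, H (axis_pt ch i2 s) = vl).
Proof.
move=> nch sH dmq cq.
pose f s := H (axis_pt ch i2 s).
have coE t : -1 < t < 1 -> co ch (axis_pt ch i2 t) 0 i2 = t.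
  by move=> t1; rewrite (axis_pt_co ch i2 t1).2 !mxE !eqxx mulr1.
pose E := [seq co ch p 0 i2 | p <- Q].
have sf : step_on f E (-1) 1.
  move=> t t1 tE.
  have t1' : `|t| < 1 by rewrite ltr_norml.
  have tQ : axis_pt ch i2 t \notin Q.
    by apply: contra tE => tQ; apply/mapP; exists (axis_pt ch i2 t); rewrite ?coE.
  have dbl s : `|s| < 1 -> double_points D (axis_pt ch i2 s).
    move=> s1; exists (sheet ch i0 (s *: delta_mx 0 i2)), (sheet ch i1 (s *: delta_mx 0 i2)).
    exact: (on_axis_double nch (full_axis s1)).
  have hn := near_axis_pt (axis_cube i2 t1) (sH _ (dbl t t1') tQ).
  have n1 : \forall s \near t, -1 < s < 1.
    move/andP: t1 => [ta tb]; near=> s; apply/andP; split; near: s.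
      exact: lt_nbhsr.
    exact: lt_nbhsl.
  near=> s; have s1 : -1 < s < 1 by near: s.
  apply: (_ : double_points D (axis_pt ch i2 s) -> H (axis_pt ch i2 s) = f t).
    by near: s; exact: hn.
  by apply: dbl; rewrite ltr_norml.
have [vr hr] := @step_right _ _ f E (-1) 1 0 sf ltac:(lra).
have [vl hl] := @step_left _ _ f E (-1) 1 0 sf ltac:(lra).
by exists vr, vl.
Unshelve. all: by end_near. Qed.

Lemma jumpD H H' Q q : double_points D q -> step_off D H Q -> step_off D H' Q ->
  jump D (fun p => H p + H' p) q = jump D H q + jump D H' q.
Proof.
move=> dq sH sH'; have [ch [nch dmq cq]] := double_point_chart dq.
have [vr [vl [hr hl]]] := step_germs nch sH dmq cq.
have [vr' [vl' [hr' hl']]] := step_germs nch sH' dmq cq.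
rewrite -(axis0 dmq cq).
rewrite (jump_axis nch ki kj near_full_axis hr hl).
rewrite (jump_axis nch ki kj near_full_axis hr' hl').
rewrite (@jump_axis _ _ _ _ _ nch i0 i1 i2 (fun=> true) ki kj
  (fun p => H p + H' p) 0 (vr + vr') (vl + vl') near_full_axis); last 2 first.
- by apply: filterS2 hr hr' => s -> ->.
- by apply: filterS2 hl hl' => s -> ->.
by case: reversed; rewrite opprD addrACA.
Qed.

Lemma jump_const H q : double_points D q ->
  (\forall p \near q, double_points D p -> H p = H q) -> jump D H q = 0.
Proof.
move=> dq hH; have [ch [nch dmq cq]] := double_point_chart dq.
have eq := axis0 dmq cq.
have c0 : cube R 3 (0 *: delta_mx 0 i2) by rewrite scale0r; exact: cube0.
have hn : \forall s \near (0 : R), H (axis_pt ch i2 s) = H q.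
  have h1 : axis_pt ch i2 s @[s --> (0 : R)] --> axis_pt ch i2 0 := near_axis_pt c0.
  rewrite eq in h1.
  have := h1 _ hH => h2.
  near=> s; apply: (_ : double_points D (axis_pt ch i2 s) -> H (axis_pt ch i2 s) = H q).
    by near: s; exact: h2.
  have ax : on_axis 2 (s *: delta_mx 0 i2 : 'rV[R]_3) i0 i1 (fun=> true) by near: s.
  exists (sheet ch i0 (s *: delta_mx 0 i2)), (sheet ch i1 (s *: delta_mx 0 i2)).
  exact: (on_axis_double nch ax).
have hnr : \forall s \near (0 : R)^'+, H (axis_pt ch i2 s) = H q by exact: cvg_within hn.
have hnl : \forall s \near (0 : R)^'-, H (axis_pt ch i2 s) = H q by exact: cvg_within hn.
rewrite -{1}eq (jump_axis nch ki kj near_full_axis hnr hnl).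
by rewrite subrr if_same.
Unshelve. all: by end_near. Qed.

End Jump.

Hypothesis hc : KTQ_coloring D T c.

Lemma double_region_unique q xB xT b b' r : double_points D q ->
  double_point D q xB xT -> region_near D q [:: (xB, b); (xT, b')] r ->
  r = double_region D q b b'.
Proof.
move=> dq dp rn; have [ch [nch dmq cq]] := double_point_chart dq.
have ax : on_axis 2 (0 *: delta_mx 0 i2 : 'rV[R]_3) i0 i1 (fun=> true).
  by apply: full_axis; rewrite normr0.
have eq : pt ch (0 *: delta_mx 0 i2) = q by exact: axis0.
have az0 := on_axis_zero ax; have [ijn cz _ _ _] := ax.
rewrite -eq in dp rn *.
rewrite (on_axis_double_region nch _ _ ax).
have [i' [j' [/andP[ij' j_n'] zi' zj' [eB eT] _]]] := double_point_sheets nch cz dp.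
have [ei ej] : i' = i0 /\ j' = i1.
  have /andP[ij _] := ijn.
  have := az0 i' (ltn_trans ij' j_n') zi'; have := az0 j' j_n' zj'.
  case=> ej'; case=> ei'; rewrite ei' ej' ?ltnn // in ij' *.
  by have := ltn_trans ij ij'; rewrite ltnn.
by move: rn; rewrite eB eT ei ej => /(on_axis_region nch _ _ ax).
Qed.

(** If the second and the fourth region coincide, as they do near a branch
    point, then the coloring rule makes the colored path degenerate. *)
Lemma edge_color_whitney q : double_points D q ->
  double_region D q false true = double_region D q true false -> F q = 0.
Proof.
move=> dq e; have [ch [nch dmq cq]] := double_point_chart dq.
have ax : on_axis 2 (0 *: delta_mx 0 i2 : 'rV[R]_3) i0 i1 (fun=> true).
  by apply: full_axis; rewrite normr0.
have eq : pt ch (0 *: delta_mx 0 i2) = q by exact: axis0.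
have [ijn _ _ _ _] := ax.
have /= col := octant_coloring nch (fun=> true) hc ijn.
rewrite -eq in e; rewrite !(on_axis_double_region nch _ _ ax) in e.
by rewrite /F -eq (edge_colorE nch k T c ax) degenerate_basis3 // -col e.
Qed.

End Generic.

(** * Boxes and their contributions *)

Section Box.
Context {R : realType} (G : set 'rV[R]_3) (W : set 'rV[R]_3).
Context (h g : 'rV[R]_3 -> 'rV[R]_3).
Hypothesis oW : open W.
Hypothesis hg : forall q, W q -> cube R 3 (h q) /\ g (h q) = q.
Hypothesis gh : forall z, cube R 3 z -> W (g z) /\ h (g z) = z.
Hypothesis ch : forall q, W q -> {for q, continuous h}.
Hypothesis cg : forall z, cube R 3 z -> {for z, continuous g}.
Hypothesis ax : forall q, W q -> G q ->
  exists k : 'I_3, h q = h q 0 k *: delta_mx 0 k.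

Definition coordinate_box : set 'rV[R]_3 :=
  [set q | W q /\ forall l, `|h q 0 l| <= 1 / 2].

(** The points where an axis meets the boundary of the box. *)
Definition box_ends : seq 'rV[R]_3 :=
  [seq g (s *: delta_mx 0 k) | k <- enum 'I_3, s <- [:: 1 / 2; - (1 / 2)]].

Lemma coordinate_box_closed : closed coordinate_box.
Proof.
pose C := [set z : 'rV[R]_3 | forall l, `[- (1 / 2), 1 / 2]%classic (z 0 l)].
have CE z : C z <-> forall l, `|z 0 l| <= 1 / 2.
  by split=> h1 l; have := h1 l; rewrite /= in_itv /= ler_norml.
have Cc z : C z -> cube R 3 z.
  by move=> /CE h1 l; apply: le_lt_trans (h1 l) _; lra.
have -> : coordinate_box = g @` C.
  apply/seteqP; split=> [q [Wq hq]|_ [z Cz <-]].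
    by exists (h q); [apply/CE|exact: (hg Wq).2].
  by have [Wg hgz] := gh (Cc z Cz); split=> // l; rewrite hgz; apply/CE: l.
apply: compact_closed; first exact: norm_hausdorff.
apply: continuous_compact.
  by apply: continuous_in_subspaceT => z /set_mem /Cc; exact: cg.
exact: (@rV_compact R 3 (fun=> `[- (1 / 2), 1 / 2]%classic) (fun=> @segment_compact _ _ _)).
Qed.

Lemma near_coordinate_box q : W q -> (forall l, `|h q 0 l| < 1 / 2) ->
  \forall p \near q, coordinate_box p.
Proof.
move=> Wq hq.
have nW : \forall p \near q, W p by exact: open_nbhs_nbhs (conj oW Wq).
have nl (l : 'I_3) : \forall p \near q, `|h p 0 l| < 1 / 2.
  have cl : `|h p 0 l| @[p --> q] --> `|h q 0 l|.
    have e : h p 0 l @[p --> q] --> h q 0 l :=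
      @cvg_entry _ _ _ (nbhs_filter q) _ _ h _ 0 l (ch Wq).
    exact: (cvg_norm e).
  by apply: (cvgr_lt _ cl); exact: hq.
have na := @filter_forall _ _ _ _ (nbhs_filter q) nl.
have : \forall p \near q, W p /\ forall l, `|h p 0 l| < 1 / 2 by exact: filterI.
by apply: filterS => p [Wp hp]; split=> // l; apply: ltW.
Qed.

(** The double curves lie on the axes, which meet the boundary of the box only
    at their ends. *)
Lemma coordinate_box_step q : G q -> q \notin box_ends ->
  \forall p \near q, G p -> (coordinate_box p <-> coordinate_box q).
Proof.
move=> Gq qE; have [Wq|Wq] := pselect (W q); last first.
  have nB : ~ coordinate_box q by case.
  have : \forall p \near q, ~ coordinate_box p.
    apply: open_nbhs_nbhs; split=> //.
    exact: (closed_openC coordinate_box_closed).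
  by apply: filterS => p hp _; split.
have [k hk] := ax Wq Gq; set t := h q 0 k in hk.
have hl l : `|h q 0 l| <= `|t|.
  by rewrite hk !mxE eqxx /=; case: eqP => _; rewrite ?mulr1 // mulr0 normr0.
case: (ltgtP `|t| (1 / 2)) => [t2|t2|t2].
- have := near_coordinate_box Wq (fun l => le_lt_trans (hl l) t2).
  apply: filterS => p Bp _; split=> // _; split=> // l.
  exact: ltW (le_lt_trans (hl l) t2).
- have nB : ~ coordinate_box q by case=> _ /(_ k); rewrite leNgt t2.
  have : \forall p \near q, ~ coordinate_box p.
    apply: open_nbhs_nbhs; split=> //.
    exact: (closed_openC coordinate_box_closed).
  by apply: filterS => p hp _; split.
- case/negP: qE; apply/allpairsP.
  exists (k, t); rewrite /= mem_enum !inE -hk (hg Wq).2; split=> //.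
  have /eqP := t2; rewrite eqr_norml => /andP[/orP[/eqP ->|/eqP ->] _].
    by rewrite eqxx.
  by rewrite eqxx orbT.
Qed.

End Box.

Lemma plane_box (R : realType) (S : oriented_closed_surface R) n
    (ch : plane_chart S n) : normal_plane_chart ch ->
  [/\ closed (box ch), box ch `<=` dom ch,
      forall y, dom ch y -> co ch y = 0 -> \forall p \near y, box ch p &
      exists E : seq 'rV[R]_3, forall q, double_points S q -> q \notin E ->
        \forall p \near q, double_points S p -> (box ch p <-> box ch q)].
Proof.
move=> nch.
have c1 q : dom ch q -> {for q, continuous (co ch)}.
  by move=> dq; exact: differentiable_continuous (co_diff dq).
have c2 z : cube R 3 z -> {for z, continuous (pt ch)} by exact: pt_continuous.
have ax q : dom ch q -> double_points S q ->
    exists k : 'I_3, co ch q = co ch q 0 k *: delta_mx 0 k.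
  move=> dq /double_axis - /(_ n ch nch dq)[i [j [k [_ _ t1 eq _]]]].
  by exists k; rewrite {1}eq (axis_pt_co ch k t1).2.
split.
- exact: (coordinate_box_closed (@co_cube _ _ _ ch) (pt_dom ch) c2).
- by move=> q [].
- move=> y dy cy; apply: (near_coordinate_box (@dom_open _ _ _ ch) c1 dy) => l.
  by rewrite cy mxE normr0; lra.
exists (box_ends (pt ch)) => q dq qE.
exact: (coordinate_box_step (@dom_open _ _ _ ch) (@co_cube _ _ _ ch) (pt_dom ch) c1 c2 ax).
Qed.

Section Contribution.
Context {R : realType} (D : oriented_diagram R).
Context (k : comNzRingType) (X : choiceType) (T : X -> X -> X -> X).
Context (c : set 'rV[R]_3 -> X).
Hypothesis hc : KTQ_coloring D T c.

Let F := edge_color k T D c.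

Definition edge_color_on (Z : set 'rV[R]_3) (p : 'rV[R]_3) : normal_chain k T 1 :=
  if `[< Z p >] then F p else 0.

Definition contribution (y : 'rV[R]_3) : normal_chain k T 1 :=
  if `[< triple_points D y >] then
    (triple_point_sign D y)%:~R *: to_normal_chain T
      (boundary2_tuple k T (colored_path D c y))
  else 0.

(** The color at the octant with signs [b0], [b1], [b2] is [x b0 b1 b2], and the
    ascending path is the path [x false false false], [x true false false],
    [x true true false], [x true true true]. Each half axis carries the path of
    three of the four octants around it. By the coloring rule at four of the
    half axes, these six paths are the six terms of the differential. *)
Lemma triple_contribution (ch : plane_chart D 3) y Z Q : normal_plane_chart ch ->
  dom ch y -> co ch y = 0 -> Z `<=` box ch -> uniq Q -> step_off D (edge_color_on Z) Q ->
  (\forall p \near y, Z p) ->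
  \sum_(q <- Q | `[< double_points D q >] && `[< dom ch q >]) jump D (edge_color_on Z) q =
  - contribution y.
Proof.
move=> nch dy cy Zbox uQ sQ nZ.
have supH q : ~ box ch q -> edge_color_on Z q = 0.
  by move=> nq; rewrite /edge_color_on asboolF // => /Zbox.
have ey : pt ch 0 = y by rewrite -cy; exact: (co_cube dy).2.
have c0 (l : 'I_3) : cube R 3 ((0 : R) *: delta_mx 0 l) by rewrite scale0r; exact: cube0.
pose x b0 b1 b2 := c (octant_region ch (bits b0 b1 b2)).
pose v (l : 'I_3) b : normal_chain k T 1 :=
  let e b' b'' := c (octant_region ch (flip2 (fun=> b) (lower l) (upper l) b' b'')) in
  to_normal_chain T (@basis_chain k X 1 [tuple e false false; e true false; e true true]).
have Faxis (l : 'I_3) b s : (if b then 0 < s < 1 else -1 < s < 0) ->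
    F (axis_pt ch l s) = v l b.
  by move=> /(half_axis l) ax; rewrite /F (edge_colorE nch k T c ax).
have nZa (l : 'I_3) : \forall s \near (0 : R), Z (axis_pt ch l s).
  have h1 : axis_pt ch l s @[s --> (0 : R)] --> axis_pt ch l 0 := near_axis_pt (c0 l).
  by apply: h1; rewrite /axis_pt scale0r ey.
have nr (l : 'I_3) : \forall s \near (0 : R)^'+, edge_color_on Z (axis_pt ch l s) = v l true.
  have h1 : \forall s \near (0 : R)^'+, Z (axis_pt ch l s) by exact: cvg_within (nZa l).
  near=> s; rewrite /edge_color_on asboolT; last by near: s.
  by apply: Faxis; apply/andP; split; near: s;
    [exact: nbhs_right_gt | exact: nbhs_right_lt].
have nl (l : 'I_3) : \forall s \near (0 : R)^'-, edge_color_on Z (axis_pt ch l s) = v l false.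
  have h1 : \forall s \near (0 : R)^'-, Z (axis_pt ch l s) by exact: cvg_within (nZa l).
  near=> s; rewrite /edge_color_on asboolT; last by near: s.
  by apply: Faxis; apply/andP; split; near: s;
    [apply: nbhs_left_gt; lra | exact: nbhs_left_lt].
rewrite (total_jump3 nch uQ sQ supH nr nl).
have ty : triple_points D y.
  exists (sheet ch (inord 0) 0), (sheet ch (inord 1) 0), (sheet ch (inord 2) 0).
  by rewrite -ey; exact: sheets_triple_point.
rewrite /contribution asboolT // -ey (triple_point_signE nch) //.
pose E a b d := to_normal_chain T (@basis_chain k X 1 [tuple a; b; d]).
have fE (l : 'I_3) b b' b'' (o : 'I_3 -> bool) :
    flip2 (fun=> b) (lower l) (upper l) b' b'' =1 o ->
    c (octant_region ch (flip2 (fun=> b) (lower l) (upper l) b' b'')) =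
    c (octant_region ch o).
  by move=> eo; congr c; apply: eq_octant_region => i _; exact: eo.
have flipE : forall b b' b'',
  [/\ flip2 (fun=> b) (lower (inord 0)) (upper (inord 0)) b' b'' =1 bits b b' b'',
      flip2 (fun=> b) (lower (inord 1)) (upper (inord 1)) b' b'' =1 bits b' b b'' &
      flip2 (fun=> b) (lower (inord 2)) (upper (inord 2)) b' b'' =1 bits b' b'' b].
  move=> b b' b''; rewrite /lower /upper; split=> i; rewrite /flip2 /bits -!val_eqE /= !inordK //=;
    case: i => -[|[|[|//]]] ? /=; rewrite ?inordK //=.
have e0 b b' b'' := fE _ _ _ _ _ (let: And3 h _ _ := flipE b b' b'' in h).
have e1 b b' b'' := fE _ _ _ _ _ (let: And3 _ h _ := flipE b b' b'' in h).
have e2 b b' b'' := fE _ _ _ _ _ (let: And3 _ _ h := flipE b b' b'' in h).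
have v0 b : v (inord 0) b = E (x b false false) (x b true false) (x b true true).
  by rewrite /v !e0.
have v1 b : v (inord 1) b = E (x false b false) (x true b false) (x true b true).
  by rewrite /v !e1.
have v2 b : v (inord 2) b = E (x false false b) (x true false b) (x true true b).
  by rewrite /v !e2.
have lu (l : 'I_3) : (lower l < upper l < 3)%N by case: (lower_upperP l).
have rule (l : 'I_3) b := octant_coloring nch (fun=> b) hc (lu l).
(* With the ascending path colored [a], [b], [c], [d], the other four octants
   get the colors [T a b c], [T b c d], [T (T a b c) c d], [T a b (T b c d)]. *)
have := rule (inord 2) false; rewrite /= !e2 -!/(x _ _ _) => r010.
have := rule (inord 0) true; rewrite /= !e0 -!/(x _ _ _) => r101.
have := rule (inord 1) true; rewrite /= !e1 -!/(x _ _ _) => r011.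
have := rule (inord 1) false; rewrite /= !e1 -!/(x _ _ _) => r001.
have cp m : (m < 4)%N -> tnth (colored_path D c (pt ch 0)) (inord m) =
    x (0 < m)%N (1 < m)%N (2 < m)%N.
  by move=> m4; rewrite tnth_mktuple (ascending_path_triple nch) // inordK.
have bE : to_normal_chain T (boundary2_tuple k T (colored_path D c (pt ch 0))) =
    v (inord 0) true - v (inord 0) false - v (inord 1) true + v (inord 1) false
    + v (inord 2) true - v (inord 2) false.
  rewrite /boundary2_tuple !cp //= -r010 -r101 -r011 -r001.
  rewrite !(raddfB, raddfD) /= !v0 !v1 !v2 /E.
  by congr (_ - _); congr (_ + _); rewrite -!addrA.
rewrite bE; have i0 : ord0 = inord 0 :> 'I_3 by apply/val_inj; rewrite /= inordK.
have i1 : lift ord0 ord0 = inord 1 :> 'I_3 by apply/val_inj; rewrite /= inordK.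
have i2 : lift ord0 (lift ord0 ord0) = inord 2 :> 'I_3 by apply/val_inj; rewrite /= inordK.
rewrite !big_ord_recl big_ord0 i2 i1 i0 /reversed !inordK //= addbF addbT.
move: (v (inord 0)) (v (inord 1)) (v (inord 2)) => f0 f1 f2.
case: (orient ch) => /=; rewrite ?expr0 ?expr1 ?rmorphN1 ?scaleN1r ?scale1r ?opprK.
  rewrite addr0 !addrA !opprD !opprK [- f0 true + _]addrC.
  by rewrite [X in _ = X]addrAC.
by rewrite addr0 !addrA; congr (_ + _ - _); rewrite addrAC.
Unshelve. all: by end_near. Qed.

Lemma no_double_jump Z y (P : pred 'rV[R]_3) Q : ~ triple_points D y ->
  (forall q, P q -> ~ double_points D q) ->
  \sum_(q <- Q | `[< double_points D q >] && P q) jump D (edge_color_on Z) q = - contribution y.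
Proof.
move=> ty nP; rewrite /contribution asboolF // oppr0 big1 // => q /andP[/asboolP dq Pq].
by case: (nP q Pq).
Qed.

(** The local computation for the three models of a generic projection: the box
    [B] lies in the chart [W] around [y], and [E] are the points where a double
    curve crosses the boundary of [B]. The set [Z] is what remains of [B] after
    other boxes have been removed. *)
Lemma local_box y : (@proj R @` D) y ->
  exists (W B : set 'rV[R]_3) (E : seq 'rV[R]_3),
  [/\ closed B /\ B `<=` W, \forall p \near y, B p,
      forall q, double_points D q -> q \notin E ->
        \forall p \near q, double_points D p -> (B p <-> B q),
      forall q, W q -> triple_points D q -> q = y &
      forall Z Q, Z `<=` B -> uniq Q -> step_off D (edge_color_on Z) Q ->
        (triple_points D y -> \forall p \near y, Z p) ->
        \sum_(q <- Q | `[< double_points D q >] && `[< W q >]) jump D (edge_color_on Z) q =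
        - contribution y].
Proof.
move=> py; have c0 := @cube0 R 3.
have tripleE n (ch : plane_chart D n) q : normal_plane_chart ch -> dom ch q ->
    triple_points D q -> (2 < n)%N /\ co ch q = 0.
  move=> nch dq [xB [xM [xT tp]]]; have [cq eq] := co_cube dq.
  by rewrite -eq in tp; have [n2 z0 _] := triple_point_sheets nch cq tp.
have [[n n03 lf]|lf] := surface_generic py; last first.
  have [W [h [g [phi [[oW sh sg Wy hy] hg gh pphi [pm cov]]]]]] := whitney_local_form lf.
  have ch q : W q -> {for q, continuous h}.
    by move=> Wq; exact: differentiable_continuous (sh [::] q Wq).
  have cg z : cube R 3 z -> {for z, continuous g}.
    by move=> cz; exact: differentiable_continuous (sg [::] z cz).
  have nt := whitney_no_triple pphi pm cov.
  have ax q : W q -> double_points D q -> exists l : 'I_3, h q = h q 0 l *: delta_mx 0 l.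
    move=> Wq [xB [xT dp]]; have [t [_ _ hq _]] := whitney_double pm cov Wq dp.
    have e2 : vec3 0 0 (t * t) 0 (inord 2) = t * t by rewrite mxE inordK.
    exists (inord 2); rewrite hq e2; apply/rowP => -[[|[|[|//]]] ?];
      rewrite !mxE eqxx -val_eqE /= !inordK //= ?mulr0 ?mulr1 //.
  exists W, (coordinate_box W h), (box_ends g); split.
  - by split; [exact: (coordinate_box_closed hg gh cg) | move=> q []].
  - apply: (near_coordinate_box oW ch Wy) => l; rewrite hy mxE normr0; lra.
  - by move=> q; exact: (coordinate_box_step oW hg gh ch cg ax).
  - by move=> q /nt.
  move=> Z Q ZB uQ sQ _; rewrite /contribution asboolF; last exact: nt.
  rewrite oppr0 big1 // => q /andP[/asboolP dq _].
  apply: jump_const => //.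
  have cut0 p : double_points D p -> edge_color_on Z p = 0.
    move=> dp; rewrite /edge_color_on; case: asboolP => // /ZB[Wp _].
    apply: edge_color_whitney => //; have [xB [xT dbl]] := dp.
    have r1 := umbrella_outside_near oW sh sg hg gh pphi pm cov true Wp dbl.
    have r2 := umbrella_outside_near oW sh sg hg gh pphi pm cov false Wp dbl.
    by rewrite -(double_region_unique dp dbl r1) -(double_region_unique dp dbl r2).
  by apply: filterE => p dp; rewrite !cut0.
have [ch [nch dy cy]] := normal_plane_chart_exists n03 lf.
have [cB Bd nB [E hE]] := plane_box nch.
exists (dom ch), (box ch), E; split=> //.
- exact: nB.
- move=> q dq tq; have [_ cq] := tripleE n ch q nch dq tq.
  by have [_ <-] := co_cube dq; have [_ <-] := co_cube dy; rewrite cq cy.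
move=> Z Q ZB uQ sQ nZ.
have supH q : ~ box ch q -> edge_color_on Z q = 0.
  by move=> nq; rewrite /edge_color_on asboolF // => /ZB.
move: n03; case: (ltngtP n 2) => [n2|n3|n2] n03.
- apply: no_double_jump.
    by move=> ty; have [] := tripleE n ch y nch dy ty; lia.
  move=> q /asboolP dq dbl; have [i [j [_ [/andP[ij j_n] _ _ _ _]]]] := double_axis nch dbl dq.
  by lia.
- have en : n = 3%N by lia.
  move: ch nch dy cy ZB supH {lf cB Bd nB E hE tripleE n03 n3} nZ sQ.
  rewrite en => ch nch dy cy ZB supH nZ sQ.
  apply: triple_contribution => //; apply: nZ.
  have ey : pt ch 0 = y by rewrite -cy; exact: (co_cube dy).2.
  exists (sheet ch (inord 0) 0), (sheet ch (inord 1) 0), (sheet ch (inord 2) 0).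
  by rewrite -ey; exact: sheets_triple_point.
rewrite (total_jump2 nch uQ sQ supH n2) /contribution asboolF ?oppr0 //.
by move=> ty; have [] := tripleE n ch y nch dy ty; lia.
Qed.

End Contribution.

Lemma proj_compact (R : realType) (S : oriented_closed_surface R) :
  compact (@proj R @` S).
Proof.
apply: continuous_compact; last exact: carrier_compact.
by apply: continuous_subspaceT => x; exact: mulmx_continuous.
Qed.

(** * The sum of all contributions *)

Section Total.
Context {R : realType} (D : oriented_diagram R).
Context (k : comNzRingType) (X : choiceType) (T : X -> X -> X -> X).
Context (c : set 'rV[R]_3 -> X).
Hypothesis hc : KTQ_coloring D T c.

Let F := edge_color k T D c.

Lemma jump_sum (A : zmodType) (I : eqType) (s : seq I) (H : I -> 'rV[R]_3 -> A) Q q :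
  double_points D q -> (forall i, i \in s -> step_off D (H i) Q) ->
  jump D (fun p => \sum_(i <- s) H i p) q = \sum_(i <- s) jump D (H i) q.
Proof.
move=> dq; elim: s => [|i s IH] sH.
  rewrite big_nil; apply: jump_const => //; apply: filterE => p _.
  by rewrite !big_nil.
have sH' j : j \in s -> step_off D (H j) Q by move=> js; apply: sH; rewrite inE js orbT.
have ss : step_off D (fun p => \sum_(j <- s) H j p) Q.
  move=> p dp pQ; elim: (s) sH' => [|j t IHt] sHt.
    by apply: filterE => w _; rewrite !big_nil.
  have h1 := sHt j (mem_head _ _) p dp pQ.
  have h2 := IHt (fun l lt => sHt l ltac:(by rewrite inE lt orbT)).
  by apply: filterS2 h1 h2 => w e1 e2 dw; rewrite !big_cons e1 // e2.
rewrite big_cons -(IH sH') -(jumpD dq (sH i (mem_head _ _)) ss).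
by congr (jump D _ q); apply/funext => p; rewrite big_cons.
Qed.

(** Number the boxes of a finite cover and let each point be owned by the first
    box that contains it. The parts owned by the boxes are disjoint and cover
    the diagram, so the pieces of the edge colors on them sum to the edge colors,
    which do not jump. *)
Lemma contributions_cancel : exists s : seq 'rV[R]_3,
  [/\ uniq s, forall y, triple_points D y -> y \in s &
      \sum_(y <- s) contribution D k T c y = 0].
Proof.
pose K := @proj R @` D.
have /choice[bx hbx] y : exists b : (set 'rV[R]_3 * set 'rV[R]_3) * seq 'rV[R]_3,
    K y -> [/\ closed b.1.2 /\ b.1.2 `<=` b.1.1, \forall p \near y, b.1.2 p,
      forall q, double_points D q -> q \notin b.2 ->
        \forall p \near q, double_points D p -> (b.1.2 p <-> b.1.2 q),
      forall q, b.1.1 q -> triple_points D q -> q = y &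
      forall Z (Q : seq 'rV[R]_3), Z `<=` b.1.2 -> uniq Q -> step_off D (edge_color_on D k T c Z) Q ->
        (triple_points D y -> \forall p \near y, Z p) ->
        \sum_(q <- Q | `[< double_points D q >] && `[< b.1.1 q >])
          jump D (edge_color_on D k T c Z) q = - contribution D k T c y].
  have [Ky|nK] := pselect (K y); last by exists ((set0, set0), [::]).
  by have [W [B [E h]]] := local_box k hc Ky; exists ((W, B), E).
pose W y := (bx y).1.1; pose B y := (bx y).1.2; pose E y := (bx y).2.
have : compact K := @proj_compact R D.
rewrite compact_cover => /(_ _ K (fun y => (B y)^°)) [].
- by move=> y Ky; exact: open_interior.
- by move=> y Ky; exists y => //; have [_ nB _ _ _] := hbx y Ky.
move=> fs fsK cov; pose s := undup (finmap.enum_fset fs).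
have sK y : y \in s -> K y by rewrite mem_undup => /fsK /set_mem.
have covs p : K p -> exists2 y, y \in s & B y p.
  by move=> /cov[y /= yfs /interior_subset Bp]; exists y; rewrite // mem_undup.
have us : uniq s by exact: undup_uniq.
have triple_s y : triple_points D y -> y \in s.
  move=> ty; have [y' y's By] := covs y (triple_point_image ty).
  have [[_ BW] _ _ tW _] := hbx y' (sK y' y's).
  by rewrite (tW y (BW y By) ty).
exists s; split=> //.
(* The index of the first box that contains [p]; [Z y] is the part owned by
   the box around [y]. *)
pose own p := find (fun y => `[< B y p >]) s.
pose Z y := [set p | own p = index y s].
have ZB y : y \in s -> Z y `<=` B y.
  move=> ys p; rewrite /Z /= /own => e.
  have hs : has (fun y => `[< B y p >]) s by rewrite has_find e index_mem.
  by have /asboolP := nth_find y hs; rewrite e nth_index.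
pose Q := undup (flatten [seq E y | y <- s]).
have uQ : uniq Q by exact: undup_uniq.
have near_own q : double_points D q -> q \notin Q ->
    \forall p \near q, double_points D p -> own p = own q.
  move=> dq qQ.
  have : \forall p \near q, forall y, y \in s -> double_points D p -> (B y p <-> B y q).
    have sub : forall y, y \in s -> K y /\ q \notin E y.
      move=> y ys; split; first exact: sK.
      apply: contra qQ => qE; rewrite mem_undup; apply/flattenP; exists (E y) => //.
      exact: map_f.
    elim: (s) sub => [|y t IH] sub; first exact: filterE.
    have [Ky qE] := sub y (mem_head _ _); have [_ _ hE _ _] := hbx y Ky.
    have h1 := hE q dq qE.
    have h2 := IH (fun l lt => sub l ltac:(by rewrite inE lt orbT)).
    by apply: filterS2 h1 h2 => p e1 e2 l; rewrite inE => /orP[/eqP ->|/e2].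
  apply: filterS => p hp dp; apply: eq_in_find => y ys.
  by apply/asboolP/asboolP => /(hp y ys dp).
have sZ y : y \in s -> step_off D (edge_color_on D k T c (Z y)) Q.
  move=> ys q dq qQ.
  apply: filterS2 (near_own q dq qQ) (edge_color_locally_constant k T c dq) => p e1 e2 dp.
  by rewrite /edge_color_on /Z /= e1 // e2.
(* Since a chart contains no triple point besides its center, no other box
   contains points near [y]. *)
have nZ y : y \in s -> triple_points D y -> \forall p \near y, Z y p.
  move=> ys ty.
  have nBy : \forall p \near y, B y p by have [_ nB _ _ _] := hbx y (sK y ys).
  have : \forall p \near y, forall y', y' \in s -> y' != y -> ~ B y' p.
    elim: (s) sK => [|y' t IH] sKt; first exact: filterE.
    have h2 := IH (fun l lt => sKt l ltac:(by rewrite inE lt orbT)).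
    have [[cB BW] _ _ tW _] := hbx y' (sKt y' (mem_head _ _)).
    have [e|ne] := eqVneq y' y.
      by apply: filterS h2 => p h2 l; rewrite inE => /orP[/eqP ->|/h2 //]; rewrite e eqxx.
    have nb : ~ B y' y by move=> /BW /tW /(_ ty) e; rewrite e eqxx in ne.
    have h1 : \forall p \near y, ~ B y' p.
      exact: open_nbhs_nbhs (conj (closed_openC cB) nb).
    by apply: filterS2 h1 h2 => p h1 h2 l; rewrite inE => /orP[/eqP ->|/h2].
  apply: filterS2 nBy => p Bp h; rewrite /Z /= /own /index.
  apply: eq_in_find => y' y's; rewrite /= .
  apply/asboolP/eqP => [By'|-> //].
  by apply/eqP; apply: contraT => ne; case: (h y' y's ne).
(* Outside of the chart around [y] the piece vanishes, so the sum over the chart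
   is the sum over all double points. *)
have total y : y \in s ->
    \sum_(q <- Q | `[< double_points D q >]) jump D (edge_color_on D k T c (Z y)) q =
    - contribution D k T c y.
  move=> ys; have [[cB BW] _ _ _ ct] := hbx y (sK y ys).
  rewrite -(ct (Z y) Q (ZB y ys) uQ (sZ y ys) (nZ y ys)).
  rewrite (bigID (fun q => `[< W y q >])) /= [X in _ + X]big1 ?addr0 //.
  move=> q /andP[/asboolP dq /asboolP nW]; apply: jump_const => //.
  have nb : ~ B y q by move/BW.
  have h1 : \forall p \near q, ~ B y p.
    exact: open_nbhs_nbhs (conj (closed_openC cB) nb).
  have cut0 p : ~ B y p -> edge_color_on D k T c (Z y) p = 0.
    by move=> nB; rewrite /edge_color_on asboolF // => /(ZB y ys).
  by apply: filterS h1 => p nB _; rewrite !cut0.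
have sumF : (fun p => \sum_(y <- s) edge_color_on D k T c (Z y) p) = F.
  apply/funext => p; have [dp|ndp] := pselect (double_points D p); last first.
    rewrite /F edge_color_out // big1 // => y _; rewrite /edge_color_on; case: ifP => // _.
    exact: edge_color_out.
  have [y ys Byp] := covs p (double_point_image dp).
  have hs : has (fun y => `[< B y p >]) s by apply/hasP; exists y => //; exact/asboolP.
  have os : (own p < size s)%N by rewrite -has_find.
  rewrite (bigD1_seq (nth y s (own p))) ?mem_nth //= {1}/edge_color_on asboolT; last first.
    by rewrite /Z /= index_uniq.
  rewrite big_seq_cond big1 ?addr0 // => y' /andP[y's ne]; rewrite /edge_color_on asboolF //.
  by rewrite /Z /= => e; case/eqP: ne; rewrite e nth_index.
apply: oppr_inj; rewrite oppr0 -sumrN.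
rewrite big_seq; under eq_bigr => y ys do rewrite -(total y ys).
rewrite -big_seq exchange_big /= big1 // => q /asboolP dq.
rewrite -(jump_sum dq sZ) sumF.
by apply: jump_const => //; exact: edge_color_locally_constant.
Qed.

End Total.

Theorem lemma4p9 (k : comNzRingType) (X : choiceType) (T : X -> X -> X -> X)
    (hT : KTQ T) (R : realType) (D : oriented_diagram R)
    (c : set 'rV[R]_3 -> X) (hc : KTQ_coloring D T c) :
  normal_boundary2 (to_normal_chain T (associated_chain k D c)) = 0.
Proof.
have [s [us ts cs]] := contributions_cancel k hc.
have -> : associated_chain k D c = \sum_(y <- s | `[< triple_points D y >])
    (triple_point_sign D y)%:~R *: @basis_chain k X 2 (colored_path D c y).
  pose r := [seq y <- s | `[< triple_points D y >]].
  have sub : [set` r] `<=` triple_points D.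
    by move=> y /=; rewrite mem_filter => /andP[/asboolP].
  have out y : triple_points D y -> y \notin r ->
      (triple_point_sign D y)%:~R *: @basis_chain k X 2 (colored_path D c y) = 0.
    by move=> ty; rewrite mem_filter ts // andbT => /negP[]; exact/asboolP.
  rewrite /associated_chain (fsbigE r _ (filter_uniq _ us) sub out).
  rewrite big_filter_cond; apply: eq_bigl => y; rewrite andb_idr //.
rewrite (normal_boundary2E hT) (raddf_sum (@boundary2 k X T)) raddf_sum -[RHS]cs.
rewrite big_mkcond; apply: eq_bigr => y _; rewrite /contribution; case: ifP => // _.
by rewrite /= (linearZ_LR (@boundary2 k X T)) linearZ_LR /= /boundary2 linear_extension_basis.
Qed.
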